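(* In the unbounded-degree incidence-lists model, cycle-freeness of $N$-vertex graphs can be tested with one-sided error within time complexity $\widetilde{O}(\mathrm{poly}(1/\epsilon)\cdot\sqrt{N})$, where $\epsilon$ is the proximity parameter measured relative to the number of edges of the input graph. Furthermore, whenever the tester rejects, it outputs a simple cycle of the input graph of length $\mathrm{poly}(\epsilon^{-1}\log N)$.
   Context: Unbounded-degree incidence-lists model: a simple graph $G=([N],E)$ (no self-loops or parallel edges) is represented by $g:[N]\times[N-1]\to\{0,\dots,N\}$ where $g(v,i)$ is the $i$-th neighbor of $v$ (or $0$ if $v$ has fewer than $i$ neighbors); the algorithm may query $g$ and may also query the degree of any vertex. It is assumed that $|E|$ is at least linear in $N$ (i.e., $|E|=\Omega(N)$). $G$ is $\epsilon$-far from being cycle-free if more than $2\epsilon|E|$ edges must be removed to make it cycle-free. A one-sided error tester accepts every cycle-free graph with probability $1$ and accepts every graph $\epsilon$-far from cycle-free with probability at most $1/3$. Vertex-manipulation operations are counted at unit cost. *)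

(* Defs.v *)
From HB Require Import structures.
From mathcomp Require Import all_boot all_order all_algebra.
From mathcomp Require Import all_reals exp.
Set Implicit Arguments.
Unset Strict Implicit.
Unset Printing Implicit Defensive.
Import Order.TTheory GRing.Theory Num.Theory.
Local Open Scope ring_scope.

Record sgraph (N : nat) := SGraph {
  adj :> rel 'I_N;
  adj_sym : symmetric adj;
  adj_irr : irreflexive adj }.

Definition edges N (e : rel 'I_N) : {set {set 'I_N}} :=
  [set [set p.1; p.2] | p : 'I_N * 'I_N & e p.1 p.2].

Definition del_edges N (e : rel 'I_N) (F : {set {set 'I_N}}) : rel 'I_N :=
  fun x y => e x y && ([set x; y] \notin F).

(* Without the size condition, a single edge traversed back and forth would
   be a [ucycleb]. *)
Definition simple_cycle N (e : rel 'I_N) (s : seq 'I_N) : bool :=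
  (2 < size s)%N && ucycleb e s.

Definition cycle_free N (e : rel 'I_N) : Prop :=
  forall s : seq 'I_N, ~~ simple_cycle e s.

Definition eps_far (R : realType) N (eps : R) (e : rel 'I_N) : Prop :=
  forall F : {set {set 'I_N}}, F \subset edges e ->
    cycle_free (del_edges e F) -> 2%:R * eps * #|edges e|%:R < #|F|%:R.

(* The vertex [v : 'I_N] has the name [v.+1] in {1, ..., N}, and the position
   [i : 'I_N.-1] stands for [i.+1] in {1, ..., N-1}; the value 0 means that
   there is no such neighbor. *)
Definition incidence_lists (N : nat) := 'I_N -> 'I_N.-1 -> 'I_N.+1.

Definition represents N (g : incidence_lists N) (e : rel 'I_N) : Prop :=
  forall v : 'I_N, exists s : seq 'I_N,
    [/\ uniq s, forall u, (u \in s) = e v u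
      & forall i : 'I_N.-1, g v i = nth 0%N [seq (val u).+1 | u : 'I_N <- s] i :> nat].

Definition neighbor_query N (g : incidence_lists N) (v i : nat) : nat :=
  if [pick p : 'I_N * 'I_N.-1 | ((val p.1).+1 == v) && ((val p.2).+1 == i)]
    is Some p then g p.1 p.2 else 0%N.

Definition degree_query N (e : rel 'I_N) (v : nat) : nat :=
  if [pick u : 'I_N | (val u).+1 == v] is Some u
  then #|[set w | e u w]| else 0%N.

Record oracle := Oracle {
  ask_neighbor : nat -> nat -> nat;
  ask_degree : nat -> nat }.

Definition graph_oracle N (g : incidence_lists N) (e : rel 'I_N) : oracle :=
  Oracle (neighbor_query g) (degree_query e).

(* Algorithms are programs of a word RAM. A word is a natural number smaller
   than the modulus [W]; an instruction, including a query, the sampling of a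
   uniform random word in a range, and any access to a vertex name stored in a
   word, has unit cost. An expression occurring in a (fixed) program has
   constant size, so its evaluation is part of the unit cost. *)
Inductive expr :=
| EConst of nat
| EReg of nat
| EMem of expr
| EAdd of expr & expr
| ESub of expr & expr
| EMul of expr & expr
| EDiv of expr & expr
| EMod of expr & expr
| ELt of expr & expr
| EEq of expr & expr.

Inductive cmd :=
| CSkip
| CSeq of cmd & cmd
| CSet of nat & expr
| CStore of expr & expr
| CIf of expr & cmd & cmd
| CWhile of expr & cmd
| CNeighbor of nat & expr & expr
| CDegree of nat & expr
| CRandom of nat & expr
| COutput of expr
| CAccept
| CReject.

Record store := Store {
  regs : nat -> nat;
  ram : nat -> nat;
  out : seq nat }.

Fixpoint eval (W : nat) (s : store) (a : expr) : nat :=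
  ((match a with
    | EConst n => n
    | EReg x => regs s x
    | EMem b => ram s (eval W s b)
    | EAdd b1 b2 => eval W s b1 + eval W s b2
    | ESub b1 b2 => eval W s b1 - eval W s b2
    | EMul b1 b2 => eval W s b1 * eval W s b2
    | EDiv b1 b2 => eval W s b1 %/ eval W s b2
    | EMod b1 b2 => eval W s b1 %% eval W s b2
    | ELt b1 b2 => (eval W s b1 < eval W s b2)
    | EEq b1 b2 => (eval W s b1 == eval W s b2)
    end) %% W)%N.

Definition upd (f : nat -> nat) (x v : nat) : nat -> nat :=
  fun y => if y == x then v else f y.

Definition set_reg (W : nat) (s : store) (x v : nat) : store :=
  Store (upd (regs s) x (v %% W)%N) (ram s) (out s).

(* [Run k s]: the commands of [k] remain to be executed, in this order.
   [Halt b o]: the machine has accepted ([b = true]) or rejected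
   ([b = false]), after writing the sequence [o]. *)
Inductive config :=
| Run of seq cmd & store
| Halt of bool & seq nat.

(* The outcome of a step is determined by a coin which is uniform in
   {0, ..., choices W c - 1}; [CRandom x a] puts in register [x] a uniform
   random element of {0, ..., value of a}. *)
Definition choices (W : nat) (c : config) : nat :=
  if c is Run (CRandom _ a :: _) s then (eval W s a).+1 else 1%N.

Definition step (W : nat) (O : oracle) (c : config) (coin : nat) : config :=
  match c with
  | Halt _ _ => c
  | Run [::] s => Halt true (out s)
  | Run (i :: k) s =>
    match i with
    | CSkip => Run k s
    | CSeq p1 p2 => Run [:: p1, p2 & k] s
    | CSet x a => Run k (set_reg W s x (eval W s a))
    | CStore a b =>
        Run k (Store (regs s) (upd (ram s) (eval W s a) (eval W s b)) (out s))
    | CIf a p1 p2 => Run ((if eval W s a != 0%N then p1 else p2) :: k) s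
    | CWhile a p => Run (if eval W s a != 0%N then [:: p, i & k] else k) s
    | CNeighbor x a b =>
        Run k (set_reg W s x (ask_neighbor O (eval W s a) (eval W s b)))
    | CDegree x a => Run k (set_reg W s x (ask_degree O (eval W s a)))
    | CRandom x _ => Run k (set_reg W s x coin)
    | COutput a => Run k (Store (regs s) (ram s) (rcons (out s) (eval W s a)))
    | CAccept => Halt true (out s)
    | CReject => Halt false (out s)
    end
  end.

Fixpoint always W O (Q : config -> Prop) (t : nat) (c : config) : Prop :=
  if t is t'.+1
  then forall coin, (coin < choices W c)%N -> always W O Q t' (step W O c coin)
  else Q c.

Fixpoint prob (R : realType) W O (A : pred config) (t : nat) (c : config) : R :=
  if t is t'.+1
  then (\sum_(coin < choices W c) prob R W O A t' (step W O c coin))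
         / (choices W c)%:R
  else (A c)%:R.

Definition halted (c : config) : bool := if c is Halt _ _ then true else false.
Definition accepted (c : config) : bool := if c is Halt b _ then b else false.

(* A real proximity parameter is presented to the machine as the integer
   ceiling of [1 / eps]. *)
Definition inv_param (R : realType) (eps : R) : nat := `|Num.ceil eps^-1|%N.

Definition initial (R : realType) (P : cmd) (N : nat) (eps : R) : config :=
  Run [:: P] (Store (fun x => if x == 0%N then N
                              else if x == 1%N then inv_param eps else 0%N)
                    (fun _ => 0%N) [::]).

(* Words of d * log (N + 1/eps) bits, up to rounding. *)
Definition word_modulus (R : realType) (d N : nat) (eps : R) : nat :=
  ((N + inv_param eps).+1 ^ d)%N.

(* [T] is O(f * polylog f) on the domain [D]; the shift by 2 only serves to
   keep the logarithm positive for small values of [f]. *)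
Definition soft_O (R : realType) (I : Type) (D : I -> Prop) (T f : I -> R) :
    Prop :=
  exists (C : R) (k : nat),
    forall i, D i -> T i <= C * (f i * ln (2%:R + f i) ^+ k).

Definition valid_params (R : realType) (x : nat * R) : Prop :=
  (0 < x.1)%N /\ 0 < x.2 <= 1.

Definition names_short_cycle (R : realType) N (e : rel 'I_N) (l : R)
    (o : seq nat) : Prop :=
  exists s : seq 'I_N,
    [/\ o = [seq (val v).+1 | v : 'I_N <- s], simple_cycle e s & (size s)%:R <= l].

(* Main.v *)
(* Call an arc live when more than [B] nonbacktracking paths start with it, and
   let the core consist of the edges both of whose arcs are live. All cycles lie
   in the core. Deleting the core edges at the marked vertices (core degree at
   least 3, or representative of a core component) destroys every cycle, so that
   a graph far from cycle-free has many core arcs at marked vertices, whereas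
   it has few vertices of core degree 1.

   The tester runs lazy nonbacktracking walks in the core from a random arc,
   deciding liveness by a breadth-first search of size [O(B)]. Up to polynomials
   in [log N] and [1 / eps], a constant fraction of the starting arcs gives walks
   that visit many marked vertices with constant probability; each visit halves
   the probability of the individual trajectory, so that among about [sqrt N]
   walks two distinct trajectories end at the same vertex, by the birthday
   paradox. The trajectories are kept as a tree of parent pointers, and
   the first edge that contradicts it closes a short cycle. As the degrees are
   unbounded, the starting arcs are drawn by rejection sampling, at every scale
   [2 ^ i] of the degrees. *)

Require Import Defs.
From mathcomp Require Import all_boot all_order all_algebra.
From mathcomp Require Import all_reals exp boolp.
From mathcomp Require Import zify ring lra.
Import Order.TTheory GRing.Theory Num.Theory.
Local Open Scope ring_scope.

(** * Pruning *)

(** The obstacle is laziness. A walk cannot list the core neighbors of a vertex of large degree, so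
    it draws a neighbor in the whole graph and stays put when the arc is dead; leaving [v] then
    takes [deg v / (core_deg v - 1)] tries on average. With this delay as the weight of each core
    arc into [v], the lazy walk is stationary, except for the hard vertices: those of core degree at
    most 1, where it is stuck, and those whose delay exceeds a threshold [Q]. Hard vertices carry
    few core arcs, because each leaf of the core accounts for more than [B] arcs of its own, and
    each long delay for many arcs of the graph. All parameters are powers of one number [x], the sum
    of the number of scales, of the ceiling of [1 / eps] and of a constant, times the square root of
    [N] for some; the powers are chosen so that each loss falls below the gain by a factor of order
    [x]. Two walks with the same end reveal a cycle only if they differ, which is why the individual
    trajectory must be improbable. *)

Section Pruning.
Variables (N : nat) (e : rel 'I_N) (B : nat).
Hypotheses (e_sym : symmetric e) (e_irr : irreflexive e).

(** The number of nonbacktracking walks with between 1 and [n] arcs whose first arc is [(u, v)]. *)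
Fixpoint branch (n : nat) (u v : 'I_N) : nat :=
  if n is n'.+1 then (\sum_(w | e v w && (w != u)) branch n' v w).+1 else 0.

Definition live (u v : 'I_N) : bool := `[< exists n, (B < branch n u v)%N >].

Definition core : rel 'I_N := fun u v => [&& e u v, live u v & live v u].

Definition core_deg (v : 'I_N) : nat := #|[set w | core v w]|.

Definition deg (v : 'I_N) : nat := #|[set w | e v w]|.

Definition marked (v : 'I_N) : bool := (2 < core_deg v)%N || (fingraph.root core v == v).

Definition nb_arcs : nat := (\sum_v deg v)%N.

Definition marked_arcs : nat := (\sum_(v | marked v) core_deg v)%N.

Lemma core_sym : symmetric core.
Proof. by move=> u v; rewrite /core e_sym; case: (e v u) => //=; rewrite andbC. Qed.

Lemma core_edge u v : core u v -> e u v.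
Proof. by case/and3P. Qed.

Lemma core_deg_le v : (core_deg v <= deg v)%N.
Proof. by apply/subset_leq_card/subsetP => w; rewrite !inE => /core_edge. Qed.

Lemma live_pred z y p : e y p -> p != z -> live y p -> live z y.
Proof.
move=> eyp pz /asboolP[n Bn]; apply/asboolP; exists n.+1 => /=.
apply: leq_trans Bn _; rewrite (bigD1 p) ?eyp//=.
by rewrite -addnS leq_addr.
Qed.

(** A walk in the core only has to test liveness forwards: the reverse arc [(w, v)] is live because
    it is continued by [(v, u)], which is live. *)
Lemma core_next u v w : core u v ->
  [&& e v w, w != u & live v w] = core v w && (w != u).
Proof.
case/and3P => euv luv lvu; rewrite /core.
case: (e v w) => //=; case: (altP (w =P u)) => [->|wu]; rewrite ?andbF//= andbT.
rewrite (_ : live w v = true) ?andbT//.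
by apply: (@live_pred _ _ u) => //; rewrite 1?e_sym // eq_sym.
Qed.

Lemma next_next_neq (s : seq 'I_N) u :
  (2 < size s)%N -> uniq s -> u \in s -> next s (next s u) != u.
Proof.
move=> s2 us /rot_to[i p Ep].
have s2' : (2 < size (u :: p))%N by rewrite -Ep size_rot.
have us' : uniq (u :: p) by rewrite -Ep rot_uniq.
rewrite -!(next_rot i us) Ep.
case: p {Ep} s2' us' => [|a [|b p]] //= _.
rewrite !inE !negb_or eqxx => /andP[/and3P[ua ub _] _].
by rewrite !eqxx [a == u]eq_sym (negbTE ua) eq_sym.
Qed.

(** Winding around the cycle gives a nonbacktracking walk of every length; with more than two
    vertices the cycle never turns back. *)
Lemma cycle_branch (s : seq 'I_N) u n :
  simple_cycle e s -> u \in s -> (n <= branch n u (next s u))%N.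
Proof.
case/andP=> s2 /andP[cs us]; elim: n u => // n IHn u u_s /=.
rewrite ltnS (bigD1 (next s (next s u))) /=; last first.
  by rewrite (next_cycle cs) ?mem_next//= next_next_neq.
by apply: leq_trans (leq_addr _ _); apply: IHn; rewrite mem_next.
Qed.

Lemma simple_cycle_rev (s : seq 'I_N) : simple_cycle e s -> simple_cycle e (rev s).
Proof.
case/andP=> s2 /andP[cs us]; rewrite /simple_cycle /ucycleb size_rev s2 rev_uniq us andbT.
rewrite rev_cycle /=; rewrite (eq_cycle (e' := e)) // => x y; exact: e_sym.
Qed.

Lemma cycle_core (s : seq 'I_N) u : simple_cycle e s -> u \in s -> core u (next s u).
Proof.
move=> sc u_s; have [s2 /andP[cs us]] := andP sc.
apply/and3P; split; first exact: next_cycle.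
- by apply/asboolP; exists B.+1; apply: cycle_branch.
- apply/asboolP; exists B.+1.
  have := @cycle_branch (rev s) (next s u) B.+1 (simple_cycle_rev _ sc).
  by rewrite mem_rev mem_next next_rev // prev_next //; apply.
Qed.

Lemma nb_arcsE : nb_arcs = #|[set p : 'I_N * 'I_N | e p.1 p.2]|.
Proof.
rewrite -sum1_card /nb_arcs.
under eq_bigr do rewrite /deg -sum1_card.
by rewrite pair_big_dep /=; apply: eq_bigl => p; rewrite !inE.
Qed.

Lemma nb_arcs_le : (nb_arcs <= 2 * #|edges e|)%N.
Proof.
rewrite nb_arcsE -sum1_card.
rewrite (partition_big (fun p => [set p.1; p.2]) (fun F => F \in edges e)) /=; last first.
  by move=> p; rewrite inE => ep; apply/imsetP; exists p; rewrite ?inE.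
rewrite mulnC -sum_nat_const; apply: leq_sum => F /imsetP[[a b]]; rewrite inE /= => eab ->.
rewrite sum1_card; apply: leq_trans (_ : #|[set (a, b); (b, a)]| <= 2)%N; last first.
  by rewrite cards2; case: (_ != _).
apply/subset_leq_card/subsetP => -[c d]; rewrite inE /= inE /= => /andP[ecd /eqP E].
have ca : c \in [set a; b] by rewrite -E set21.
have da : d \in [set a; b] by rewrite -E set22.
move: ca da ecd; rewrite !inE => /orP[] /eqP-> /orP[] /eqP->; rewrite ?e_irr ?eqxx ?orbT //.
Qed.

Lemma edges_le_arcs : (#|edges e| <= nb_arcs)%N.
Proof.
rewrite nb_arcsE /edges; apply: leq_trans (leq_imset_card _ _) _.
by apply: eq_leq; apply: eq_card => p; rewrite !inE.
Qed.

(** A cycle surviving the deletion has only unmarked vertices, so their core degree is at most 2 and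
    their core neighbors lie on the cycle. The cycle thus fills its core component and contains the
    root, which is marked. *)
Lemma far_marked (R : realType) (eps : R) : eps_far eps e ->
  2%:R * eps * #|edges e|%:R < marked_arcs%:R.
Proof.
pose F := [set [set p.1; p.2] | p : 'I_N * 'I_N & core p.1 p.2 && marked p.1].
move=> /(_ F) far.
apply: lt_le_trans (far _ _) _.
- apply/subsetP => X /imsetP[p]; rewrite inE => /andP[/core_edge ep _] ->.
  by apply/imsetP; exists p; rewrite ?inE.
- move=> s; apply/negP => sc.
  have sce : simple_cycle e s.
    have [s2 /andP[cs us]] := andP sc; rewrite /simple_cycle s2 /ucycleb us andbT /=.
    by apply: sub_cycle cs => x y /andP[].
  have [s2 /andP[cs us]] := andP sc.
  have unm v : v \in s -> ~~ marked v.
    move=> v_s; apply/negP => mv; have /andP[_ /negP[]] := next_cycle cs v_s.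
    by apply/imsetP; exists (v, next s v); rewrite ?inE //= (cycle_core _ _ sce).
  have nbr v w : v \in s -> core v w -> w \in s.
    move=> v_s vw; apply/negPn/negP => w_s.
    have := unm v v_s; rewrite negb_or -leqNgt => /andP[+ _]; apply/negP; rewrite -ltnNge.
    pose v' := prev s v; have v'_s : v' \in s by rewrite mem_prev.
    have E : #|[set w; next s v; v']| = 3.
      rewrite -setUA cardsU1 cards2 !inE negb_or.
      have nv : next s v \in s by rewrite mem_next.
      rewrite (_ : w != next s v); last by apply: contraNneq w_s => ->.
      rewrite (_ : w != v'); last by apply: contraNneq w_s => ->.
      by rewrite -{1}(next_prev us v) next_next_neq.
    apply: (@leq_trans #|[set w; next s v; v']|); first by rewrite E.
    apply/subset_leq_card/subsetP => x; rewrite !inE => /orP[/orP[]|] /eqP-> //.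
      exact: cycle_core.
    by rewrite core_sym; have := cycle_core s v' sce v'_s; rewrite next_prev.
  have [v v_s] : exists v, v \in s by case: (s) s2 => // v ? _; exists v; rewrite mem_head.
  have cl : closed core (mem s).
    move=> x y xy; apply/idP/idP => [x_s|y_s]; first exact: nbr x_s xy.
    by apply: nbr y_s _; rewrite core_sym.
  have r_s : fingraph.root core v \in s.
    by rewrite -(closed_connect cl (connect_root core v)).
  move: (unm _ r_s); rewrite /marked root_root ?eqxx ?orbT //.
  exact: sym_connect_sym core_sym.
- rewrite ler_nat; apply: leq_trans (leq_imset_card _ _) _.
  rewrite -sum1_card /marked_arcs.
  under [leqRHS]eq_bigr do rewrite /core_deg -sum1_card.
  rewrite pair_big_dep /=; apply: eq_leq; apply: eq_bigl => p.
  by rewrite !inE andbC.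
Qed.

Definition leaves : nat := #|[set v | core_deg v == 1]|.

Definition push (f : 'I_N -> 'I_N -> nat) : 'I_N -> 'I_N -> nat :=
  fun y z => (\sum_(p | e p y && (p != z)) f p y)%N.

(** The nonbacktracking walks with at most [n] arcs that end with [(y, z)], each weighted by the
    value of [f] at its first arc. *)
Fixpoint flow (f : 'I_N -> 'I_N -> nat) (n : nat) : 'I_N -> 'I_N -> nat :=
  if n is n'.+1 then fun y z => (f y z + push (flow f n') y z)%N else fun _ _ => 0.

Lemma flow_push f n y z : flow (push f) n y z = push (flow f n) y z.
Proof.
elim: n y z => [|n IHn] y z /=; first by rewrite /push big1.
rewrite /push big_split /=; congr (_ + _)%N.
by apply: eq_bigr => p _; exact: IHn.
Qed.

(** Double counting of the weighted walks, by first arc on the left and by last arc on the right. *)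
Lemma sum_branch f n :
  (\sum_u \sum_(v | e u v) f u v * branch n u v
     = \sum_u \sum_(v | e u v) flow f n u v)%N.
Proof.
elim: n f => [|n IHn] f /=.
  by apply: eq_bigr => u _; apply: eq_bigr => v _; rewrite muln0.
transitivity (\sum_u \sum_(v | e u v) f u v +
              \sum_u \sum_(v | e u v) push f u v * branch n u v)%N.
  under eq_bigr do under eq_bigr do rewrite mulnS.
  under eq_bigr do rewrite big_split /=.
  rewrite big_split /=; congr (_ + _)%N.
  under eq_bigr do under eq_bigr do rewrite big_distrr /=.
  rewrite (exchange_big_dep predT) //=.
  apply: eq_bigr => v _; under [RHS]eq_bigr do rewrite /push big_distrl /=.
  rewrite [RHS](exchange_big_dep (fun u => e u v)) /=; last by move=> w p _ /andP[].
  by apply: eq_bigr => u euv; apply: eq_bigl => w; rewrite euv eq_sym.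
rewrite IHn -big_split /=; apply: eq_bigr => u _; rewrite -big_split /=.
by apply: eq_bigr => v _; rewrite flow_push.
Qed.

Definition at_leaf (u v : 'I_N) : nat := core u v && (core_deg v == 1%N).

(* The flows issued by distinct leaves never merge. *)
Lemma leaf_flow n u v : e u v -> (flow at_leaf n u v <= 1)%N /\
  (flow at_leaf n u v != 0%N ->
     live v u /\ forall z, e v z -> z != u -> ~~ live v z).
Proof.
elim: n u v => // n IHn y z eyz /=.
have sub p : e p y -> p != z -> flow at_leaf n p y != 0%N -> live z y /\ ~~ live y z.
  move=> epy pz fp; have [_ /(_ fp)[lyp dy]] := IHn p y epy; split.
    by apply: (@live_pred _ _ p) => //; rewrite e_sym.
  by apply: dy; rewrite // eq_sym.
have [p0|] := boolP [forall p, (e p y && (p != z)) ==> (flow at_leaf n p y == 0%N)].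
  have -> : push (flow at_leaf n) y z = 0%N.
    by apply: big1 => p pyz; have /implyP/(_ pyz)/eqP := forallP p0 p.
  rewrite addn0 /at_leaf; case: (boolP (core y z)) => //= cyz.
  split; first by case: (_ == _).
  rewrite eqb0 negbK => /cards1P[x Ex].
  have := cyz => /and3P[_ _ lzy]; split => // w ezw wy; apply/negP => lzw.
  have : core z w && (w != y) by rewrite -(core_next _ _ _ cyz) ezw wy lzw.
  case/andP=> czw _; have : w \in [set x] by rewrite -Ex inE.
  have : y \in [set x] by rewrite -Ex inE core_sym.
  by rewrite !inE => /eqP yx /eqP wx; rewrite wx yx eqxx in wy.
rewrite negb_forall => /existsP[p]; rewrite negb_imply => /andP[/andP[epy pz] fp].
have [lzy ndyz] := sub p epy pz fp.
have -> : at_leaf y z = 0%N by rewrite /at_leaf /core (negbTE ndyz) andbF.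
have := IHn p y epy => -[fp1 /(_ fp)[lyp dy]].
(* Flow from [p] leaves [(y, p)] as the only possible live arc out of [y], whereas flow from another
   [q] would make [(y, q)] live. *)
have -> : push (flow at_leaf n) y z = flow at_leaf n p y.
  rewrite /push (bigD1 p) /=; last by rewrite epy.
  rewrite big1 ?addn0 // => q /andP[/andP[eqy qz] qp].
  apply/eqP/negPn/negP => fq; have := IHn q y eqy => -[_ /(_ fq)[lyq _]].
  by move: (dy q); rewrite e_sym lyq => /(_ eqy qp).
rewrite add0n; split=> // _; split=> // w ezw wy.
apply/negP => lzw; case/negP: ndyz.
exact: (@live_pred _ _ w).
Qed.

(** The core arc into a leaf is live and starts more than [B] walks; by [leaf_flow] all these walks,
    for all leaves, have distinct last arcs. *)
Lemma leaves_le : (leaves * B.+1 <= nb_arcs)%N.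
Proof.
have /choice[m mP] (p : 'I_N * 'I_N) : exists m, live p.1 p.2 -> (B < branch m p.1 p.2)%N.
  case: (boolP (live p.1 p.2)) => [/asboolP[m Bm]|_]; last by exists 0%N.
  by exists m.
(* One depth that witnesses the liveness of all live arcs at once. *)
pose M := (\max_p m p)%N.
have bmono i u v : (branch i u v <= branch i.+1 u v)%N.
  by elim: i u v => //= i IHi u v; rewrite ltnS leq_sum // => w _; exact: IHi.
have liveM u v : live u v -> (B < branch M u v)%N.
  move=> /(mP (u, v)) /= /leq_trans; apply.
  have: (m (u, v) <= M)%N by exact: (leq_bigmax (u, v)).
  move=> /subnK <-; elim: (M - _)%N => // i /leq_trans; apply; exact: bmono.
apply: (@leq_trans (\sum_u \sum_(v | e u v) at_leaf u v * branch M u v)%N).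
  rewrite /leaves -sum1_card big_distrl /=.
  under [leqRHS]eq_bigr do rewrite big_mkcond /=.
  rewrite exchange_big /= [leqLHS]big_mkcond /=; apply: leq_sum => v _.
  rewrite inE; case: ifP => // /eqP d1.
  have /cards1P[u Eu] : core_deg v == 1%N by rewrite d1.
  have : u \in [set u] by rewrite set11.
  rewrite -Eu inE core_sym => cuv.
  rewrite (bigD1 u) //= (core_edge _ _ cuv) /at_leaf cuv d1 eqxx !mul1n.
  by apply: leq_trans (leq_addr _ _); apply: liveM; case/and3P: cuv.
rewrite sum_branch /nb_arcs; apply: leq_sum => u _.
rewrite /deg -sum1_card; rewrite [leqRHS](eq_bigl (fun v => e u v)); last by move=> v; rewrite inE.
by apply: leq_sum => v euv; case: (leaf_flow M u v euv).
Qed.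

End Pruning.

(** * Nonbacktracking walks in the core *)

Section Walks.
Variables (R : realType) (N : nat) (e : rel 'I_N) (B : nat).
Hypothesis e_sym : symmetric e.
Local Notation live := (live N e B).
Local Notation core := (core N e B).
Local Notation core_deg := (core_deg N e B).
Local Notation deg := (deg N e).
Local Notation marked := (marked N e B).
Local Notation nb_arcs := (nb_arcs N e).
Local Notation marked_arcs := (marked_arcs N e B).
Local Notation leaves := (leaves N e B).
Implicit Types (p : seq 'I_N) (F G : seq 'I_N -> R).

(* The trajectory of a walk is listed backwards, so that its current position
   is the head of the list. *)
Fixpoint walk (n : nat) p F : R :=
  if n is n'.+1 then
    if p is v :: u :: _ then
      (\sum_(w | e v w) walk n' (if (w != u) && live v w then w :: p else p) F)
        / (deg v)%:R
    else F p
  else F p.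

Lemma core_pathS u v w p : sorted core [:: v, u & p] -> e v w -> w != u ->
  live v w -> sorted core [:: w, v, u & p].
Proof.
move=> /= /andP[cvu ->] evw wu lvw; rewrite cvu !andbT core_sym //.
have : [&& e v w, w != u & live v w] by rewrite evw wu lvw.
by rewrite core_next // 1?core_sym // => /andP[].
Qed.

Lemma core_deg_gt0 v u : core v u -> (0 < core_deg v)%N.
Proof. by move=> cvu; apply/card_gt0P; exists u; rewrite inE. Qed.

Lemma deg_gt0 v u : core v u -> (0 < deg v)%N.
Proof. by move=> /core_deg_gt0 /leq_trans; apply; exact: core_deg_le. Qed.

Lemma sum_nbr (v : 'I_N) (c : R) : \sum_(w | e v w) c = (deg v)%:R * c.
Proof.
rewrite sumr_const mulr_natl; congr (_ *+ _).
by apply: eq_card => w; rewrite !inE.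
Qed.

Lemma sum_core (v : 'I_N) (c : R) : \sum_(w | core v w) c = (core_deg v)%:R * c.
Proof.
rewrite sumr_const mulr_natl; congr (_ *+ _).
by apply: eq_card => w; rewrite !inE.
Qed.

Lemma walk_le (I : pred (seq 'I_N)) n p F G :
  (forall u v w q, I [:: v, u & q] -> e v w -> w != u -> live v w ->
     I [:: w, v, u & q]) ->
  (forall q, I q -> (size q <= n + size p)%N -> F q <= G q) -> I p ->
  walk n p F <= walk n p G.
Proof.
move=> Istep; elim: n p => [|n IHn] [|v [|u p]] FG Ip //=;
  try by apply: FG => //=; lia.
rewrite ler_wpM2r ?invr_ge0 ?ler0n //; apply: ler_sum => w evw.
apply: IHn => [q Iq sq|].
  by apply: FG => //; move: sq; case: ifP => _ /= sq; lia.
by case: ifP => // /andP[wu lvw]; exact: Istep.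
Qed.

Lemma walk_leW n p F G : (forall q, F q <= G q) -> walk n p F <= walk n p G.
Proof. by move=> FG; apply: (walk_le predT). Qed.

Lemma walk_ext n p F G : F =1 G -> walk n p F = walk n p G.
Proof. by move=> FG; apply/eqP; rewrite eq_le !walk_leW // => q; rewrite FG. Qed.

Lemma walkD n p F G : walk n p (fun q => F q + G q) = walk n p F + walk n p G.
Proof.
elim: n p => [|n IHn] [|v [|u p]] //=.
by rewrite -mulrDl -big_split /=; under eq_bigr do rewrite IHn.
Qed.

Lemma walkZ n p c F : walk n p (fun q => c * F q) = c * walk n p F.
Proof.
elim: n p => [|n IHn] [|v [|u p]] //=.
by under eq_bigr do rewrite IHn; rewrite -big_distrr /= mulrA.
Qed.

Lemma walk_sum (I : finType) (P : pred I) n p (F : I -> seq 'I_N -> R) :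
  walk n p (fun q => \sum_(i | P i) F i q) = \sum_(i | P i) walk n p (F i).
Proof.
elim: n p => [|n IHn] [|v [|u p]] //=.
by under eq_bigr do rewrite IHn; rewrite exchange_big /= big_distrl.
Qed.

Lemma walk_cst n p (c : R) : sorted core p -> walk n p (fun=> c) = c.
Proof.
elim: n p => [|n IHn] [|v [|u p]] // sp; have /andP[cvu _] := sp.
rewrite /=; under eq_bigr => w evw.
  rewrite IHn; last by case: ifP => // /andP[wu lvw]; exact: core_pathS.
over.
rewrite sum_nbr mulrAC divff ?mul1r // pnatr_eq0 -lt0n; exact: deg_gt0 cvu.
Qed.

Lemma walk_ge0 n p F : (forall q, 0 <= F q) -> 0 <= walk n p F.
Proof.
move=> F0; elim: n p => [|n IHn] [|v [|u p]] //=.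
by apply: divr_ge0 => //; apply: sumr_ge0.
Qed.

Lemma walk_le_cst n p F (c : R) : 0 <= c -> (forall q, F q <= c) -> walk n p F <= c.
Proof.
move=> c0 Fc; elim: n p => [|n IHn] [|v [|u p]] //=.
apply: (@le_trans _ _ ((\sum_(w | e v w) c) / (deg v)%:R)).
  by rewrite ler_wpM2r ?invr_ge0 ?ler0n //; apply: ler_sum => w _; exact: IHn.
rewrite sum_nbr mulrAC; case: (posnP (deg v)) => [->|d0]; first by rewrite !mul0r.
by rewrite divff ?mul1r // pnatr_eq0 -lt0n.
Qed.

(** The expected number of marked vertices that [n] lazy steps append to a trajectory ending with
    the arc [(u, v)], as [walk_count] confirms. *)
Fixpoint hits (n : nat) (u v : 'I_N) : R :=
  if n is n'.+1 then
    (\sum_(w | e v w) if (w != u) && live v w then (marked w)%:R + hits n' v w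
                      else hits n' u v) / (deg v)%:R
  else 0.

Lemma walk_count n p : sorted core p ->
  walk n p (fun q => (count marked q)%:R) =
  (count marked p)%:R + (if p is [:: v, u & _] then hits n u v else 0).
Proof.
elim: n p => [|n IHn] [|v [|u p]] sp; rewrite ?addr0 //.
have /andP[cvu _] := sp; rewrite [LHS]/=.
under eq_bigr => w evw.
  rewrite IHn; last by case: ifP => // /andP[wu lvw]; exact: core_pathS.
  rewrite (_ : _ + _ = (count marked [:: v, u & p])%:R +
    (if (w != u) && live v w then (marked w)%:R + hits n v w else hits n u v));
    last by case: ifP => _ //=; rewrite natrD addrAC addrC.
over.
rewrite big_split /= sum_nbr mulrDl mulrAC divff ?mul1r // pnatr_eq0 -lt0n.
exact: deg_gt0 cvu.
Qed.

Lemma hits_ge0 n u v : 0 <= hits n u v.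
Proof.
elim: n u v => //= n IHn u v; apply: divr_ge0 => //.
by apply: sumr_ge0 => w _; case: ifP => _ //; rewrite addr_ge0.
Qed.

Lemma hits_le n u v : hits n u v <= n%:R.
Proof.
elim: n u v => //= n IHn u v.
apply: (@le_trans _ _ ((\sum_(w | e v w) n.+1%:R) / (deg v)%:R)).
  rewrite ler_wpM2r ?invr_ge0 ?ler0n //; apply: ler_sum => w _.
  have n1 : (n%:R : R) <= n.+1%:R by rewrite ler_nat.
  case: ifP => _; last exact: le_trans n1.
  by rewrite -addn1 natrD addrC lerD // lern1; case: (marked w).
rewrite sum_nbr mulrAC; case: (posnP (deg v)) => [->|d0].
  by rewrite !mul0r.
by rewrite divff ?mul1r // pnatr_eq0 -lt0n.
Qed.

Lemma hitsS n u v : core u v -> hits n.+1 u v =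
  (\sum_(w | core v w && (w != u)) ((marked w)%:R + hits n v w)) / (deg v)%:R +
  (1 - (core_deg v).-1%:R / (deg v)%:R) * hits n u v.
Proof.
move=> cuv; have cvu : core v u by rewrite core_sym.
have dv := deg_gt0 _ _ cvu; have cdv := core_deg_gt0 _ _ cvu.
rewrite /= (bigID (fun w => (w != u) && live v w)) /= mulrDl; congr (_ + _).
  congr (_ / _); rewrite (eq_bigl (fun w => core v w && (w != u))).
    apply: eq_bigr => w; rewrite -core_next // => /and3P[_ -> ->] //.
  by move=> w; rewrite -core_next.
rewrite (eq_bigr (fun=> hits n u v)); last by move=> w /andP[_ /negbTE->].
rewrite sumr_const -[hits n u v *+ _]mulr_natl mulrAC; congr (_ * _).
have d0 : ((deg v)%:R : R) != 0 by rewrite pnatr_eq0 -lt0n.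
rewrite (_ : 1 - _ = ((deg v)%:R - (core_deg v).-1%:R) / (deg v)%:R); last by field.
congr (_ / _).
rewrite -natrB; last by apply: leq_trans (leq_pred _) _; exact: core_deg_le.
congr (_%:R); rewrite /deg -(cardsID [set w | core v w && (w != u)]).
have -> : [set w | e v w] :&: [set w | core v w && (w != u)] = [set w | core v w] :\ u.
  apply/setP => w; rewrite !inE andbC; case: (boolP (core v w)) => //= cvw.
    by rewrite (core_edge _ _ _ _ _ cvw) andbT.
  by rewrite andbF.
have -> : #|[set w | core v w] :\ u| = (core_deg v).-1.
  by rewrite /core_deg [in RHS](cardsD1 u) inE cvu.
rewrite addKn -[RHS]sum1_card -sum1_card; apply: eq_bigl => w.
by rewrite !inE -core_next // !unfold_in /=; case: (e v w); rewrite ?andbF ?andbT.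
Qed.

Variable Q : nat.

Definition easy (v : 'I_N) : bool :=
  (1 < core_deg v)%N && (deg v <= Q * (core_deg v).-1)%N.

Definition hard_arcs : nat := (\sum_(v | ~~ easy v) core_deg v)%N.

(* The expected time that the lazy walk takes to leave [v] *)
Definition delay (v : 'I_N) : R := (deg v)%:R / (core_deg v).-1%:R.

(** Up to normalization, [delay v] is the stationary weight of a core arc into [v]. Arcs into hard
    vertices are left out, as their weight is undefined or too large. *)
Definition weighted_hits (n : nat) : R :=
  \sum_(v | easy v) \sum_(u | core v u) delay v * hits n u v.

(** Multiplying [hitsS] by the delay and summing over [u], each core arc [(v, w)] is entered with
    total weight 1, so that one more step collects [marked_arcs]. The arcs leaving hard vertices are
    missing from this sum and would give at most [n.+1] each. *)
Lemma weighted_hitsS n :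
  weighted_hits n + marked_arcs%:R - hard_arcs%:R * n.+1%:R <= weighted_hits n.+1.
Proof.
have -> : weighted_hits n.+1 = \sum_(v | easy v)
   (\sum_(w | core v w) ((marked w)%:R + hits n v w) +
    \sum_(u | core v u) (delay v - 1) * hits n u v).
  apply: eq_bigr => v /andP[cd1 _].
  have cd0 : ((core_deg v).-1%:R : R) != 0 by rewrite pnatr_eq0; lia.
  have d0 : ((deg v)%:R : R) != 0.
    by rewrite pnatr_eq0; have := core_deg_le N e B v; lia.
  transitivity (\sum_(u | core v u) (
     \sum_(w | core v w && (w != u)) ((marked w)%:R + hits n v w) / (core_deg v).-1%:R
     + (delay v - 1) * hits n u v)).
    apply: eq_bigr => u cvu; rewrite hitsS 1?core_sym // -big_distrl /= /delay.
    set S := \sum_(w | _) _; field; by rewrite cd0 d0.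
  rewrite big_split /=; congr (_ + _).
  rewrite (exchange_big_dep (core v)) /=; last by move=> u w _ /andP[].
  apply: eq_bigr => w cvw.
  rewrite -big_distrr /= -[RHS]mulr1; congr (_ * _).
  rewrite sumr_const -[LHS]mulr_natl -[RHS](divff cd0); congr (_%:R / _).
  rewrite -sum1_card /core_deg (cardsD1 w) inE cvw /= -sum1_card.
  by apply: eq_bigl => u; rewrite !inE unfold_in /= eq_sym andbC.
rewrite big_split /=.
have -> : \sum_(v | easy v) \sum_(u | core v u) (delay v - 1) * hits n u v =
  weighted_hits n - \sum_(v | easy v) \sum_(u | core v u) hits n u v.
  rewrite /weighted_hits -sumrB; apply: eq_bigr => v _.
  by rewrite -sumrB; apply: eq_bigr => u _; rewrite mulrBl mul1r.
set T := \sum_(v | easy v) \sum_(u | core v u) hits n u v.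
pose T' := \sum_v \sum_(w | core v w) hits n v w.
have TT' : T <= T'.
  rewrite /T' (exchange_big_dep predT) //= /T [leLHS]big_mkcond /=.
  apply: ler_sum => v _; case: ifP => _; last by apply: sumr_ge0 => u _; exact: hits_ge0.
  rewrite (eq_bigl (core^~ v)) // => u; exact: core_sym.
have E : \sum_v \sum_(w | core v w) ((marked w)%:R + hits n v w) = marked_arcs%:R + T'.
  under eq_bigr do rewrite big_split /=.
  rewrite big_split /= (exchange_big_dep predT) //=; congr (_ + _).
  rewrite /marked_arcs natr_sum [RHS]big_mkcond /=; apply: eq_bigr => w _.
  rewrite (eq_bigl (core w)); last by move=> u; rewrite core_sym.
  by rewrite sum_core; case: (marked w); rewrite ?mulr1 ?mulr0.
have {}E : \sum_(v | easy v) \sum_(w | core v w) ((marked w)%:R + hits n v w) +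
  \sum_(v | ~~ easy v) \sum_(w | core v w) ((marked w)%:R + hits n v w) =
  marked_arcs%:R + T' by rewrite -E [in RHS](bigID easy).
have : \sum_(v | ~~ easy v) \sum_(w | core v w) ((marked w)%:R + hits n v w)
    <= hard_arcs%:R * n.+1%:R.
  rewrite /hard_arcs natr_sum big_distrl /=; apply: ler_sum => v _.
  rewrite -sum_core; apply: ler_sum => w _.
  rewrite -addn1 natrD addrC lerD ?hits_le // lern1; by case: (marked w).
lra.
Qed.

Lemma weighted_hits_ge n :
  n%:R * marked_arcs%:R - hard_arcs%:R * n%:R ^+ 2 <= weighted_hits n.
Proof.
elim: n => [|n IHn].
  rewrite mul0r expr0n /= mulr0 subr0; apply: sumr_ge0 => v _.
  by apply: sumr_ge0 => u _; rewrite mulr0.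
apply: le_trans (weighted_hitsS n).
have h0 : 0 <= (hard_arcs%:R : R) by [].
have n0 : 0 <= (n%:R : R) by [].
have := mulr_ge0 h0 n0.
rewrite -[n.+1%:R]natr1; nra.
Qed.

(** A hard vertex of positive core degree is a leaf of the core, or has core degree at least 2 and
    then [Q * core_deg v <= 2 * deg v]. *)
Lemma hard_arcs_le : (Q * hard_arcs <= Q * leaves + 2 * nb_arcs)%N.
Proof.
have -> : leaves = (\sum_(v | core_deg v == 1) 1)%N.
  by rewrite sum1_card; apply: eq_card => v; rewrite !inE.
rewrite /hard_arcs /nb_arcs !big_distrr /=.
rewrite [leqLHS]big_mkcond [X in (_ <= X + _)%N]big_mkcond -big_split /=.
apply: leq_sum => v _; rewrite /easy.
case: (ltngtP (core_deg v) 1) => [|d1|->] /=.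
- by rewrite ltnS leqn0 => /eqP->; rewrite muln0.
- case: (leqP (deg v)) => //= h.
  apply: (@leq_trans (2 * (Q * (core_deg v).-1))%N); last by rewrite leq_mul2l ltnW.
  by rewrite mulnCA leq_mul2l; apply/orP; right; lia.
- lia.
Qed.

Lemma sum_delay : \sum_(v | easy v) \sum_(u | core v u) delay v <= 2 * nb_arcs%:R.
Proof.
rewrite /nb_arcs natr_sum big_distrr /= big_mkcond /=; apply: ler_sum => v _.
case: ifP => [/andP[cd1 _]|_]; last by rewrite mulr_ge0.
rewrite sum_core /delay mulrCA mulrC ler_wpM2r //.
rewrite ler_pdivrMr ?ltr0n; last by lia.
by rewrite -natrM ler_nat; lia.
Qed.

Definition rich (k A : nat) (u v : 'I_N) : R :=
  walk A [:: v; u] (fun q => (k <= count marked q)%N%:R).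

Lemma rich_ge0 k A u v : 0 <= rich k A u v.
Proof. exact: walk_ge0. Qed.

Lemma rich_le1 k A u v : core v u -> rich k A u v <= 1.
Proof.
move=> cvu; apply: (@le_trans _ _ (walk A [:: v; u] (fun=> 1))); last first.
  by rewrite walk_cst //= cvu.
by apply: walk_leW => q /=; rewrite lern1 leq_b1.
Qed.

Lemma hits_rich k A u v : core v u -> hits A u v <= k%:R + A.+2%:R * rich k A u v.
Proof.
move=> cvu; have sp : sorted core [:: v; u] by rewrite /= cvu.
have := walk_count A _ sp => H.
apply: (@le_trans _ _ (walk A [:: v; u] (fun q => (count marked q)%:R))).
  by rewrite H lerDr.
rewrite /rich -walkZ -[k%:R](walk_cst A _ _ sp) -walkD.
apply: (walk_le predT) => // q _ sq.
case: leqP => kc; last by rewrite mulr0 addr0 ler_nat ltnW.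
rewrite mulr1 -natrD ler_nat; have := count_size marked q; move: sq => /=; lia.
Qed.

(** A trajectory has at most [A.+2] vertices, so [hits] splits into at most [k] and at most [A.+2]
    times the probability of [k] marked ones. The total delay bounds the first part, and the bound
    [Q] on each delay the second. *)
Lemma rich_mass k A :
  A%:R * marked_arcs%:R - hard_arcs%:R * A%:R ^+ 2 - 2 * k%:R * nb_arcs%:R
  <= Q%:R * A.+2%:R * \sum_v \sum_(u | core v u) rich k A u v.
Proof.
have := weighted_hits_ge A.
suff : weighted_hits A <= 2 * k%:R * nb_arcs%:R +
   Q%:R * A.+2%:R * \sum_v \sum_(u | core v u) rich k A u v by lra.
apply: (@le_trans _ _ (\sum_(v | easy v) \sum_(u | core v u)
   (k%:R * delay v + Q%:R * A.+2%:R * rich k A u v))).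
  apply: ler_sum => v /andP[cd1 dQ]; apply: ler_sum => u cvu.
  have del0 : 0 <= delay v by apply: divr_ge0.
  have delQ : delay v <= Q%:R.
    by rewrite /delay ler_pdivrMr ?ltr0n; [rewrite -natrM ler_nat|lia].
  apply: le_trans (ler_wpM2l del0 (hits_rich k A _ _ cvu)) _.
  rewrite mulrDr mulrC lerD2l mulrA ler_wpM2r ?rich_ge0 //.
  by rewrite ler_wpM2r.
rewrite (eq_bigr (fun v => k%:R * (\sum_(u | core v u) delay v) +
    Q%:R * A.+2%:R * (\sum_(u | core v u) rich k A u v))); last first.
  by move=> v _; rewrite big_split /= !mulr_sumr.
rewrite big_split /= -[X in X + _]mulr_sumr -[X in _ + X]mulr_sumr lerD //.
  rewrite [2 * _]mulrC -[leRHS]mulrA; apply: ler_wpM2l => //; exact: sum_delay.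
apply: ler_wpM2l; first by rewrite mulr_ge0.
rewrite [leRHS](bigID easy) /= lerDl.
by apply: sumr_ge0 => v _; apply: sumr_ge0 => u _; exact: rich_ge0.
Qed.

End Walks.

(** * The birthday paradox *)

Section Birthday.
Variables (R : realType) (L : finType) (a : L -> R).
Hypotheses (a_ge0 : forall l, 0 <= a l) (a_sum : \sum_l a l <= 1).
Implicit Types (S : {set L}).

(* The probability that [j] further draws hit neither each other nor [S],
   where [l] is drawn with probability [a l], and nothing with the remaining
   probability. *)
Fixpoint no_collision (j : nat) S : R :=
  if j is j'.+1 then
    \sum_(l | l \notin S) a l * no_collision j' (l |: S)
      + (1 - \sum_l a l) * no_collision j' S
  else 1.

Lemma no_collision_ge0 j S : 0 <= no_collision j S.
Proof.
elim: j S => //= j IHj S; apply: addr_ge0; last by rewrite mulr_ge0 ?subr_ge0.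
by apply: sumr_ge0 => l _; exact: mulr_ge0.
Qed.

Lemma mass_compl S : \sum_(l | l \notin S) a l = \sum_l a l - \sum_(l in S) a l.
Proof. by rewrite [\sum_l a l](bigID (mem S)) /= addrC addrK. Qed.

Lemma mass_le1 S : \sum_(l in S) a l <= 1.
Proof.
apply: le_trans a_sum; rewrite [leRHS](bigID (mem S)) /= lerDl.
by apply: sumr_ge0.
Qed.

Lemma no_collision_le j S : no_collision j S <= (1 - \sum_(l in S) a l) ^+ j.
Proof.
elim: j S => //= j IHj S; set t := \sum_(l in S) a l.
have t1 : 0 <= 1 - t by rewrite subr_ge0 mass_le1.
apply: (@le_trans _ _ (\sum_(l | l \notin S) a l * (1 - t) ^+ j +
    (1 - \sum_l a l) * (1 - t) ^+ j)).
  apply: lerD; last by apply: ler_wpM2l; rewrite ?subr_ge0.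
  apply: ler_sum => l lS; apply: ler_wpM2l => //; apply: le_trans (IHj _) _.
  apply: lerXn2r; rewrite ?nnegrE ?subr_ge0 ?mass_le1 //.
  by rewrite lerD2l lerN2 big_setU1 //= lerDr.
rewrite -mulr_suml -mulrDl mass_compl exprS -/t.
by rewrite (_ : _ - t + _ = 1 - t) //; ring.
Qed.

Lemma no_collision_le1 j S : no_collision j S <= 1.
Proof.
apply: le_trans (no_collision_le j S) _; apply: exprn_ile1; rewrite ?subr_ge0 ?mass_le1 //.
by rewrite gerBl sumr_ge0.
Qed.

Lemma pow_le_inv (y : R) j : 0 <= y <= 1 -> (1 - y) ^+ j <= (1 + j%:R * y)^-1.
Proof.
case/andP=> y0 y1.
have pos i : 0 < 1 + i%:R * y by rewrite ltr_pwDl // mulr_ge0.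
rewrite -[leRHS]mul1r ler_pdivlMr //; elim: j => [|j IHj]; first by rewrite mul0r addr0 mulr1.
apply: le_trans IHj; rewrite exprSr -mulrA ler_wpM2l ?exprn_ge0 ?subr_ge0 //.
rewrite -natr1; have : 0 <= (j%:R : R) by []. nra.
Qed.

Variable lam : nat.
Hypothesis lam_gt0 : (0 < lam)%N.

(** The cap serves twice: the elements already drawn hold at most [capped_mass S / lam] of the
    energy, and a single draw overshoots the target by at most [1 / lam]. *)
Definition capped (l : L) : R := Num.min (a l) lam%:R^-1.

Definition capped_mass S : R := \sum_(l in S) capped l.

Definition energy : R := \sum_l capped l ^+ 2.

Lemma capped_ge0 l : 0 <= capped l.
Proof. by rewrite le_min a_ge0 invr_ge0 ler0n. Qed.

Lemma capped_mass_ge0 S : 0 <= capped_mass S.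
Proof. by apply: sumr_ge0 => l _; exact: capped_ge0. Qed.

Lemma capped_mass_le S : capped_mass S <= \sum_(l in S) a l.
Proof. by apply: ler_sum => l _; rewrite ge_min lexx. Qed.

Lemma energy_ge0 : 0 <= energy.
Proof. by apply: sumr_ge0 => l _; exact: sqr_ge0. Qed.

(* As long as the capped mass is below its target [lam * energy / 2], each
   draw increases it by at least [energy / 2] on average. *)
Lemma no_collision_step i j S :
  let C := lam%:R * energy / 2 + lam%:R^-1 in
  let b := (1 + j%:R * (lam%:R * energy / 2))^-1 in
  capped_mass S <= C ->
  i%:R * (energy / 2) * (no_collision (i + j) S - b) <= C - capped_mass S.
Proof.
move=> C b; have e0 := energy_ge0.
have l0 : 0 < (lam%:R : R) by rewrite ltr0n.
have xs0 : 0 <= lam%:R * energy / 2 by rewrite divr_ge0 ?mulr_ge0.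
have b0 : 0 <= b.
  by rewrite /b invr_ge0; apply: addr_ge0 => //; exact: mulr_ge0.
elim: i S => [|i IHi] S SC; first by rewrite !mul0r subr_ge0.
(* At the target, every further draw hits [S] with at least that probability, and at least [j] draws
   remain, whence the bound [b]. Below the target, the capped mass still grows on average. *)
have [xS|Sx] := lerP (lam%:R * energy / 2) (capped_mass S).
  suff h : no_collision (i.+1 + j) S <= b.
    apply: (@le_trans _ _ 0); last by rewrite subr_ge0.
    apply: mulr_ge0_le0; last by rewrite subr_le0.
    by apply: mulr_ge0 => //; exact: divr_ge0.
  apply: le_trans (no_collision_le _ _) _.
  apply: (@le_trans _ _ ((1 - capped_mass S) ^+ (i.+1 + j))).
    apply: lerXn2r; rewrite ?nnegrE ?subr_ge0 ?mass_le1 //.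
      exact: le_trans (capped_mass_le S) (mass_le1 S).
    by rewrite lerD2l lerN2 capped_mass_le.
  apply: le_trans (pow_le_inv _ _ _) _.
    by rewrite capped_mass_ge0 (le_trans (capped_mass_le S)) ?mass_le1.
  rewrite lef_pV2 ?posrE; last 2 first.
  - by rewrite ltr_pwDl // mulr_ge0 ?capped_mass_ge0.
  - by rewrite ltr_pwDl // mulr_ge0.
  by rewrite lerD2l ler_pM // ler_nat leq_addl.
rewrite addSn /=.
set D := \sum_(l | _) _ + _ => /=.
have D1 : D <= 1 by exact: (no_collision_le1 (i + j).+1 S).
have E : D - b = \sum_(l | l \notin S) a l * (no_collision (i + j) (l |: S) - b)
    + (1 - \sum_l a l) * (no_collision (i + j) S - b) - (\sum_(l in S) a l) * b.
  rewrite /D; under [X in _ = X + _ - _]eq_bigr do rewrite mulrBr.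
  rewrite sumrB -mulr_suml mass_compl; ring.
have h1 : i%:R * (energy / 2) * (D - b) <=
    \sum_(l | l \notin S) a l * (C - capped_mass S - capped l)
    + (1 - \sum_l a l) * (C - capped_mass S).
  rewrite E mulrBr lerBlDr mulrDr.
  apply: (@le_trans _ _ (\sum_(l | l \notin S) a l * (C - capped_mass S - capped l)
    + (1 - \sum_l a l) * (C - capped_mass S))); last first.
    rewrite lerDl; apply: mulr_ge0; first by rewrite mulr_ge0 ?divr_ge0.
    by rewrite mulr_ge0 ?sumr_ge0.
  apply: lerD.
    rewrite mulr_sumr; apply: ler_sum => l lS; rewrite mulrCA ler_wpM2l //.
    rewrite -addrA -opprD.
    have E2 : capped_mass S + capped l = capped_mass (l |: S).
      by rewrite /capped_mass big_setU1 //= addrC.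
    rewrite E2; apply: IHi; rewrite -E2.
    by apply: lerD; [exact: ltW | rewrite ge_min lexx orbT].
  by rewrite mulrCA ler_wpM2l ?subr_ge0 //; exact: IHi.
have h2 : \sum_(l | l \notin S) a l * (C - capped_mass S - capped l) =
   (\sum_(l | l \notin S) a l) * (C - capped_mass S) - \sum_(l | l \notin S) a l * capped l.
  by under eq_bigr do rewrite mulrBr; rewrite sumrB -mulr_suml.
(* The capped mass of [S] is below the target, so at most half of the energy lies in [S]. *)
have h3 : energy / 2 <= \sum_(l | l \notin S) a l * capped l.
  apply: (@le_trans _ _ (\sum_(l | l \notin S) capped l ^+ 2)); last first.
    apply: ler_sum => l _; rewrite expr2 ler_wpM2r ?capped_ge0 //.
    by rewrite ge_min lexx.
  have : \sum_(l in S) capped l ^+ 2 <= lam%:R^-1 * capped_mass S.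
    rewrite mulr_sumr; apply: ler_sum => l _; rewrite expr2 ler_wpM2r ?capped_ge0 //.
    by rewrite ge_min lexx orbT.
  have : lam%:R^-1 * capped_mass S <= energy / 2.
    rewrite mulrC ler_pdivrMr //; apply: ltW; apply: lt_le_trans Sx _.
    by rewrite -[_ * energy / 2]mulrA mulrC.
  rewrite /energy (bigID (mem S)) /=; lra.
rewrite h2 in h1; rewrite -natr1.
have h4 : energy / 2 * (D - b) <= energy / 2.
  by rewrite -[leRHS]mulr1 ler_wpM2l ?divr_ge0 // lerBlDr (le_trans D1) ?lerDl.
have h5 : 0 <= (\sum_(l in S) a l) * (C - capped_mass S).
  by rewrite mulr_ge0 ?sumr_ge0 ?subr_ge0.
rewrite mass_compl in h1; nra.
Qed.

(** The last [6 * lam] draws are reserved for hitting a set of the target mass, which gives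
    [b <= 1 / 4]. The [12 * lam] or more draws before them add at most another [1 / 4] through the
    potential of [no_collision_step]. *)
Lemma no_collision_half (K : nat) : (18 * lam <= K)%N -> 1 <= lam%:R ^+ 2 * energy ->
  no_collision K set0 <= 1 / 2.
Proof.
move=> lK e1; have e0 := energy_ge0.
have l0 : 0 < (lam%:R : R) by rewrite ltr0n.
have m0 : capped_mass set0 = 0 by rewrite /capped_mass big_set0.
have := no_collision_step (K - 6 * lam) (6 * lam) set0.
rewrite subnK; last by lia.
rewrite m0 /= subr0 => step.
have inv0 : 0 < (lam%:R^-1 : R) by rewrite invr_gt0.
have mu0 : lam%:R^-1 <= lam%:R * energy.
  by rewrite -[leLHS]mul1r ler_pdivrMr // mulrAC -expr2.
have {}step := step (addr_ge0 (divr_ge0 (mulr_ge0 (ltW l0) e0) (ler0n _ 2)) (ltW inv0)).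
set b := (1 + _ * _)^-1 in step.
have b4 : b <= 1 / 4.
  rewrite div1r lef_pV2 ?posrE; last 2 first.
  - rewrite ltr_pwDl //; apply: mulr_ge0 => //; apply: divr_ge0 => //; exact: mulr_ge0.
  - by [].
  rewrite natrM; nra.
rewrite leNgt; apply/negP => big.
have iK : 12 * (lam%:R : R) <= (K - 6 * lam)%:R by rewrite -natrM ler_nat; lia.
have : 12 * lam%:R * (energy / 2) * (1 / 4) < (K - 6 * lam)%:R * (energy / 2) * (no_collision K set0 - b).
  apply: (@lt_le_trans _ _ (12 * lam%:R * (energy / 2) * (no_collision K set0 - b))).
    rewrite ltr_pM2l; first lra.
    have : 0 < lam%:R * energy by exact: lt_le_trans mu0.
    lra.
  rewrite ler_wpM2r //; first lra.
  by rewrite ler_wpM2r // divr_ge0.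
lra.
Qed.

(** Either one element has mass at least [1 / lam] and its capped square suffices, or nothing is
    capped and the energy is at least [eta ^+ 2 / n]. *)
Lemma energy_ge (n : nat) (eta : R) : (0 < n)%N -> (#|L| <= n)%N -> 0 <= eta <= \sum_l a l ->
  n%:R <= lam%:R ^+ 2 * eta ^+ 2 -> 1 <= lam%:R ^+ 2 * energy.
Proof.
move=> n0 Ln /andP[eta0 eta_a] lamn.
have l0 : 0 < (lam%:R : R) by rewrite ltr0n.
have [/existsP[l al]|/existsPn small] := boolP [exists l, lam%:R^-1 <= a l].
  rewrite /energy (bigD1 l) //= {1}/capped min_r //.
  rewrite mulrDr -exprMn divff ?gt_eqF // expr2 mulr1 lerDl.
  by rewrite mulr_ge0 ?exprn_ge0 ?sumr_ge0 // => i _; rewrite sqr_ge0.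
have cE l : capped l = a l by rewrite /capped min_l // ltW // ltNge small.
have E : energy = \sum_l a l ^+ 2 by apply: eq_bigr => l _; rewrite cE.
(* Cauchy-Schwarz, through the tangent of the square at [t] *)
have tangent (t : R) : 0 <= t -> 2 * t * eta - n%:R * t ^+ 2 <= energy.
  move=> t0; apply: (@le_trans _ _ (\sum_l (2 * t * a l - t ^+ 2))).
    rewrite sumrB -mulr_sumr sumr_const -[_ *+ #|_|]mulr_natl; apply: lerB.
      by apply: ler_wpM2l => //; exact: mulr_ge0.
    by rewrite ler_wpM2r ?sqr_ge0 // ler_nat.
  by rewrite E; apply: ler_sum => l _; have := sqr_ge0 (a l - t); nra.
have n0' : 0 < (n%:R : R) by rewrite ltr0n.
have := tangent (eta / n%:R) (divr_ge0 eta0 (ltW n0')).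
rewrite (_ : _ - _ = eta ^+ 2 / n%:R); last by field; rewrite gt_eqF.
move=> eE; apply: (@le_trans _ _ (lam%:R ^+ 2 * (eta ^+ 2 / n%:R))).
  by rewrite mulrA ler_pdivlMr // mul1r.
by rewrite ler_wpM2l // exprn_ge0.
Qed.

End Birthday.

(** * Conflicting trajectories *)

Section Conflicts.
Variables (R : realType) (N : nat) (e : rel 'I_N) (B : nat).
Hypothesis e_sym : symmetric e.
Local Notation live := (live N e B).
Local Notation core := (core N e B).
Local Notation core_deg := (core_deg N e B).
Local Notation deg := (deg N e).
Local Notation marked := (marked N e B).
Local Notation walk := (walk R N e B).
Local Notation rich := (rich R N e B).
Implicit Types (p q : seq 'I_N).

Definition branching : pred 'I_N := fun v => (2 < core_deg v)%N.

Lemma walk_core_le n p (F G : seq 'I_N -> R) : sorted core p ->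
  (forall q, sorted core q -> F q <= G q) -> walk n p F <= walk n p G.
Proof.
move=> sp FG; apply: (walk_le R N e B (sorted core)) => // [u v w q|q sq _].
  exact: core_pathS.
exact: FG.
Qed.

Lemma walk_off_suffix n p t : ~~ suffix p t -> walk n p (fun q => (q == t)%:R) = 0.
Proof.
move=> pt; apply/eqP; rewrite eq_le walk_ge0 // andbT.
apply: (@le_trans _ _ (walk n p (fun q => 0 * (q == t)%:R))); last by rewrite walkZ mul0r.
apply: (walk_le R N e B (suffix p)) => [u v w q pq _ _ _|q pq _|]; last exact: suffix_refl.
  by apply: suffix_trans pq _; exact: suffix_cons.
by rewrite mul0r; case: eqP pt => // <-; rewrite pq.
Qed.

(** Staying at [v] keeps the bound, so laziness is harmless. Among the moves at most one leads
    towards [t], while a branching vertex offers at least two. The current vertex is dropped by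
    [behead] because it has not been left yet. *)
Lemma walk_point_le n p t : sorted core p ->
  walk n p (fun q => (q == t)%:R) * (2 ^ count branching (behead t))%:R
    <= (2 ^ count branching (behead p))%:R.
Proof.
elim: n p => [|n IHn] p.
  by move=> _ /=; case: eqP => [->|_]; rewrite ?mul1r ?mul0r.
case: p => [|v [|u p]] sp.
- by rewrite /=; case: eqP => [<-|_]; rewrite ?mul1r ?mul0r.
- by rewrite /=; case: eqP => [<-|_]; rewrite ?mul1r ?mul0r.
have /andP[cvu _] := sp; have cuv : core u v by rewrite core_sym.
have dv := deg_gt0 _ _ _ _ _ cvu.
set b := (2 ^ count branching (behead [:: v, u & p]))%:R.
set E := (2 ^ count branching (behead t))%:R.
rewrite [walk _ _ _]/= mulrAC ler_pdivrMr ?ltr0n // mulr_suml.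
pose c : R := (2 ^ branching v)%:R.
(* Trajectories are listed backwards: the successor of [v] in [t] stands just before the suffix
   [[:: v, u & p]]. *)
pose w0 := nth v t (size t - (size p).+3).
apply: (@le_trans _ _ (\sum_(w | e v w)
   if (w != u) && live v w then (w == w0)%:R * (b * c) else b)).
  apply: ler_sum => w evw; case: ifP => [/andP[wu lvw]|_]; last exact: IHn.
  have [sw|nsw] := boolP (suffix [:: w, v, u & p] t); last first.
    by rewrite walk_off_suffix // mul0r !mulr_ge0.
  have -> : w == w0.
    case/suffixP: sw => t' Et; rewrite /w0 Et size_cat /= nth_cat.
    by rewrite addnK ltnn subnn.
  rewrite mul1r; apply: le_trans (IHn _ _) _; first exact: core_pathS.
  by rewrite /b /c -natrM -expnD addnC.
have -> : b * (deg v)%:R = \sum_(w | e v w) b by rewrite (sum_nbr R N e) mulrC.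
rewrite (bigID (fun w => (w != u) && live v w)) /= [leRHS](bigID (fun w => (w != u) && live v w)) /=.
apply: lerD; last by apply: ler_sum => w /andP[_ /negbTE->].
rewrite (eq_bigr (fun w => (w == w0)%:R * (b * c))); last by move=> w /andP[_ ->].
rewrite -mulr_suml sumr_const -[b *+ _]mulr_natl [b * c]mulrC mulrA ler_wpM2r ?ler0n //.
have [w0in|w0out] := boolP (e v w0 && ((w0 != u) && live v w0)); last first.
  rewrite big1 ?mul0r // => w /= wP; case: eqP => // w0E; by rewrite -w0E wP in w0out.
rewrite (bigD1 w0) //= eqxx big1 ?addr0 ?mul1r; last by move=> w /andP[_ /negbTE->].
rewrite /c ler_nat.
set A := (X in (_ <= X)%N).
have -> : A = (core_deg v).-1.
  rewrite /A /core_deg [in RHS](cardsD1 u) inE cvu /= -[RHS]sum1_card -sum1_card.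
  apply: eq_bigl => w; rewrite !inE [LHS](_ : _ = [&& e v w, w != u & live v w]) //.
  by rewrite core_next // andbC.
have : (0 < (core_deg v).-1)%N.
  move: w0in; rewrite core_next // => /andP[cvw0 w0u].
  rewrite /core_deg (cardsD1 u) inE cvu /=; apply/card_gt0P; exists w0.
  by rewrite !inE w0u cvw0.
rewrite /branching; case: (ltnP 2 (core_deg v)) => h h1 /=; rewrite ?expn0 ?expn1; lia.
Qed.

Lemma core_root p v : sorted core (v :: p) ->
  all (fun w => fingraph.root core w == fingraph.root core v) (v :: p).
Proof.
have cs := sym_connect_sym (core_sym _ _ B e_sym).
elim: p v => [|w p IHp] v /=; first by rewrite eqxx.
case/andP=> cvw sp; rewrite eqxx /=.
have /eqP -> : fingraph.root core v == fingraph.root core w.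
  by rewrite root_connect // connect1.
exact: IHp.
Qed.

(** One unit of slack pays for the single root of the component, the other one for the head, which
    [behead] drops. *)
Lemma uniq_marked p : sorted core p -> uniq p ->
  (count marked p <= count branching (behead p) + 2)%N.
Proof.
case: p => // v p sp up.
have cm : (count marked (v :: p) <= count branching (v :: p) +
    count (fun w => fingraph.root core w == w) (v :: p))%N.
  by rewrite -count_predUI leq_addr.
have cr : (count (fun w => fingraph.root core w == w) (v :: p) <= 1)%N.
  apply: (@leq_trans (count_mem (fingraph.root core v) (v :: p))).
    have /allP r := core_root _ _ sp.
    rewrite leq_eqVlt; apply/orP; left; apply/eqP; apply: eq_in_count => w w_p /=.
    by rewrite (eqP (r w w_p)) eq_sym.
  by rewrite count_uniq_mem // leq_b1.
move: cm cr => /=; case: (branching v) => /=; lia.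
Qed.

Definition conflict p (P : seq (seq 'I_N)) : bool :=
  ~~ uniq p || has (fun q => (ohead q == ohead p) && (q != p)) P.

Fixpoint no_conflict (A : nat) p0 (j : nat) (P : seq (seq 'I_N)) : R :=
  if j is j'.+1 then
    walk A p0 (fun p => if conflict p P then 0 else no_conflict A p0 j' (p :: P))
  else 1.

Lemma no_conflict01 A p0 j P : sorted core p0 -> 0 <= no_conflict A p0 j P <= 1.
Proof.
move=> sp0; elim: j P => [|j IHj] P /=; first by rewrite ler01 lexx.
rewrite walk_ge0 /=; last by move=> q; case: ifP => // _; case/andP: (IHj (q :: P)).
rewrite -[leRHS](walk_cst R N e B e_sym A p0) //.
by apply: walk_leW => q; case: ifP => // _; case/andP: (IHj (q :: P)).
Qed.

Lemma no_conflict_ge0 A p0 j P : 0 <= no_conflict A p0 j P.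
Proof.
elim: j P => //= j IHj P; apply: walk_ge0 => q.
by case: ifP => _; [exact: lexx | exact: IHj].
Qed.

Lemma no_conflict_le1 A p0 j P : no_conflict A p0 j P <= 1.
Proof.
elim: j P => //= j IHj P; apply: walk_le_cst => // q.
by case: ifP => _; [exact: ler01 | exact: IHj].
Qed.

(* Rich trajectories with a repeated vertex, each of which is a conflict by
   itself, share the label [Some None]. *)
Definition label (k : nat) p : option (option 'I_N) :=
  if (k <= count marked p)%N then Some (if uniq p then ohead p else None) else None.

Definition label_prob (k A : nat) p0 (l : option 'I_N) : R :=
  walk A p0 (fun p => (label k p == Some l)%:R).

Lemma label_prob_ge0 k A p0 l : 0 <= label_prob k A p0 l.
Proof. exact: walk_ge0. Qed.

Lemma sum_label_prob k A u v :
  \sum_l label_prob k A [:: v; u] l = rich k A u v.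
Proof.
rewrite /label_prob -(walk_sum R N e B); apply: (walk_ext R N e B) => q.
rewrite /label; case: leqP => _; last by rewrite big1.
rewrite (bigD1 (if uniq q then ohead q else None)) //= eqxx big1 ?addr0 // => l /negbTE.
by rewrite eq_sym => /eqP h; case: eqP => // -[].
Qed.

Lemma walk_label k A p0 (f : option 'I_N -> R) (S : {set option 'I_N}) (c : R) :
  sorted core p0 ->
  walk A p0 (fun p => if label k p is Some l then if l \in S then 0 else f l else c) =
  \sum_(l | l \notin S) label_prob k A p0 l * f l + (1 - \sum_l label_prob k A p0 l) * c.
Proof.
move=> sp0.
transitivity (walk A p0 (fun p => (\sum_(l | l \notin S) f l * (label k p == Some l)%:R)
   + (c + (- c) * \sum_l (label k p == Some l)%:R))).
  apply: walk_ext => p; case: (label k p) => [l|]; last first.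
    by rewrite !big1 ?mulr0 ?addr0 ?add0r // => l _; rewrite mulr0.
  rewrite [X in - c * X](bigD1 l) //= eqxx [X in 1 + X]big1 ?addr0; last first.
    by move=> i il; case: eqP => // -[E]; rewrite E eqxx in il.
  rewrite mulr1 subrr addr0; case: ifP => lS; last first.
    rewrite (bigD1 l) ?lS //= eqxx mulr1 big1 ?addr0 // => i /andP[_ il].
    by case: eqP => [[E]|_]; [rewrite E eqxx in il | rewrite mulr0].
  rewrite big1 // => i iS; case: eqP => [[E]|_]; last by rewrite mulr0.
  by rewrite -E lS in iS.
rewrite !walkD walkZ (walk_cst R N e B) // !walk_sum /label_prob.
rewrite mulrBl mul1r mulNr [c * _]mulrC; congr (_ + _).
by apply: eq_bigr => l _; rewrite walkZ mulrC.
Qed.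

Definition labels k (P : seq (seq 'I_N)) : {set option 'I_N} :=
  [set l | Some l \in map (label k) P].

(** Here 8 is 2, for the tail of the starting arc, times [2 ^ 2], for the slack in [uniq_marked]. *)
Definition repeat_bound (k : nat) : R := 8 / (2 ^ k)%:R.

(** A walk is read as a draw of its label. Two rich trajectories with the same label conflict unless
    they are one and the same simple trajectory, an event paid for by a union bound over pairs of
    walks. *)
Lemma no_conflict_le k A u v K j P : core v u -> (0 < k)%N -> (size P + j <= K)%N ->
  no_conflict A [:: v; u] j P <=
    no_collision R _ (label_prob k A [:: v; u]) j (labels k P) +
    j%:R * (K%:R * repeat_bound k).
Proof.
move=> cvu k0; set p0 := [:: v; u]; have sp0 : sorted core p0 by rewrite /= cvu.
have rb0 : 0 <= repeat_bound k by rewrite divr_ge0.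
elim: j P => [|j IHj] P PK /=; first by rewrite mul0r addr0.
rewrite -(walk_label k A p0 (fun l => no_collision _ _ _ j (l |: labels k P))) //.
set f := fun p => if label k p is Some l then _ else _.
pose rep p : R := \sum_(q <- P) ((p == q) && (uniq q && (k <= count marked q)%N))%:R.
apply: (@le_trans _ _ (walk A p0 (fun p => f p + (j%:R * (K%:R * repeat_bound k) + rep p)))).
  apply: walk_leW => p.
  have rep0 : 0 <= rep p by apply: sumr_ge0.
  have kb0 : 0 <= j%:R * (K%:R * repeat_bound k) by do 2![apply: mulr_ge0 => //].
  case: ifP => [_|/negbT].
    rewrite addr_ge0 ?addr_ge0 // /f; case: label => [l|].
      by case: ifP => // _; apply: no_collision_ge0 => *; rewrite ?label_prob_ge0 // sum_label_prob rich_le1.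
    by apply: no_collision_ge0 => *; rewrite ?label_prob_ge0 // sum_label_prob rich_le1.
  rewrite negb_or negbK => /andP[up /hasPn hp].
  have IH := IHj (p :: P).
  have {}IH : no_conflict A p0 j (p :: P) <= no_collision R _ (label_prob k A p0) j (labels k (p :: P)) +
     j%:R * (K%:R * repeat_bound k) by apply: IH => /=; lia.
  case El : (label k p) => [l|]; last first.
    rewrite /f El; apply: le_trans IH _.
    rewrite (_ : labels k (p :: P) = labels k P); first by rewrite addrA lerDl.
    by apply/setP => l; rewrite !inE El.
  rewrite /f El; case: ifP => lP; last first.
    apply: le_trans IH _.
    rewrite (_ : labels k (p :: P) = l |: labels k P); first by rewrite addrA lerDl.
    by apply/setP => i; rewrite !inE El.
  apply: (@le_trans _ _ 1); first by case/andP: (no_conflict01 A p0 j (p :: P) sp0).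
  rewrite add0r; apply: (@le_trans _ _ (rep p)); last by rewrite lerDr.
  move: lP; rewrite inE => /mapP[q qP Eq].
  have Eqp : q == p.
    move: El Eq (hp q qP); rewrite /label up; case: ifP => // kp [<-].
    case: (p) kp => [|x p']; first by rewrite leqNgt k0.
    move=> _; case: ifP => // _ []; case: ifP => // _ E /=.
    by rewrite -E eqxx negbK.
  move: up El; rewrite -(eqP Eqp) /label => uq; case: ifP => // kq _.
  rewrite /rep (big_rem q) //= eqxx uq kq /=.
  by rewrite lerDl; apply: sumr_ge0.
rewrite walkD lerD2l walkD (walk_cst R N e B) // -natr1 mulrDl mul1r lerD2l.
apply: (@le_trans _ _ ((size P)%:R * repeat_bound k)); last first.
  by rewrite ler_wpM2r // ler_nat; lia.
rewrite /rep; elim: P {IHj PK f rep} => [|q P IHP].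
  rewrite mul0r -[leRHS](mul0r (walk A p0 (fun=> 0))) -walkZ.
  by apply: walk_leW => p; rewrite big_nil mul0r.
apply: (@le_trans _ _ (walk A p0 (fun p => ((p == q) && (uniq q && (k <= count marked q)%N))%:R
  + \sum_(q <- P) ((p == q) && (uniq q && (k <= count marked q)%N))%:R))).
  by apply: walk_leW => p; rewrite big_cons.
rewrite walkD /= -natr1 mulrDl mul1r addrC; apply: lerD => // {IHP}.
have [/andP[uq kq]|nq] := boolP (uniq q && (k <= count marked q)%N); last first.
  apply: le_trans rb0; rewrite -[leRHS](mul0r (walk A p0 (fun=> 0))) -walkZ.
  by apply: walk_leW => p; rewrite andbF mul0r.
have [sq|nsq] := boolP (sorted core q); last first.
  apply: le_trans rb0; rewrite -[leRHS](mul0r (walk A p0 (fun=> 0))) -walkZ.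
  apply: walk_core_le => // p sp; rewrite mul0r andbT; case: eqP => // pq.
  by rewrite -pq sp in nsq.
under walk_ext do rewrite andbT.
have := walk_point_le A p0 q sp0; rewrite -ler_pdivlMr ?ltr0n ?expn_gt0 // => h.
apply: le_trans h _; rewrite /repeat_bound ler_pdivrMr ?ltr0n ?expn_gt0 //.
rewrite mulrAC ler_pdivlMr ?ltr0n ?expn_gt0 // -!natrM ler_nat.
have := uniq_marked q sq uq => h.
have b1 : (2 ^ count branching (behead p0) <= 2)%N by rewrite /= addn0; case: (branching u).
apply: (@leq_trans (2 * 2 ^ (count branching (behead q) + 2))%N).
  by rewrite leq_mul // leq_exp2l //; lia.
by rewrite expnD mulnA mulnAC.
Qed.

(* Two rich draws ending at the same vertex conflict unless they are equal. *)
Lemma no_conflict_bound k A u v K lam (eta : R) : core v u -> (0 < k)%N ->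
  (0 < lam)%N -> (18 * lam <= K)%N -> 0 <= eta <= rich k A u v ->
  N.+1%:R <= lam%:R ^+ 2 * eta ^+ 2 -> 32 * K%:R ^+ 2 <= (2 ^ k)%:R :> R ->
  no_conflict A [:: v; u] K [::] <= 3 / 4.
Proof.
move=> cvu k0 l0 lK eta_le N_le K_le.
apply: le_trans (no_conflict_le k A u v K K [::] cvu k0 _) _ => //.
have -> : labels k [::] = set0 by apply/setP => l; rewrite !inE.
have h : no_collision R _ (label_prob k A [:: v; u]) K set0 <= 1 / 2.
  apply: (no_collision_half _ _ _ _ _ lam) => //.
  - by move=> l; exact: label_prob_ge0.
  - by rewrite sum_label_prob rich_le1.
  - apply: (energy_ge _ _ _ _ l0 N.+1 eta) => //.
    + by rewrite card_option card_ord.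
    + by rewrite sum_label_prob.
have : K%:R * (K%:R * repeat_bound k) <= 1 / 4.
  rewrite /repeat_bound !mulrA ler_pdivrMr ?ltr0n ?expn_gt0 //.
  move: K_le; rewrite expr2; lra.
lra.
Qed.

End Conflicts.

(** * A program logic for acceptance probabilities *)

Section Logic.
Variables (R : realType) (W : nat) (O : oracle) (Q : seq nat -> Prop).

Definition rejected (c : config) : bool := if c is Halt false _ then true else false.

Definition safe (f : config) : Prop := halted f /\ forall o, f = Halt false o -> Q o.

(** Running time, validity of the output and soundness are carried together. The bound concerns the
    runs that do not reject, among which are the accepting ones. *)
Definition judge (t : nat) (c : config) (x : R) : Prop :=
  always W O safe t c /\ prob R W O (fun f => ~~ rejected f) t c <= x.

Lemma judge_step t c x (f : nat -> R) :
  (forall coin, (coin < choices W c)%N -> judge t (step W O c coin) (f coin)) ->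
  (\sum_(coin < choices W c) f coin) / (choices W c)%:R <= x -> judge t.+1 c x.
Proof.
move=> H fx; split=> [coin /H[]//|]; apply: le_trans fx => /=.
by rewrite ler_wpM2r ?invr_ge0 // ler_sum // => i _; case: (H i (ltn_ord i)).
Qed.

Lemma judge_det t c x : choices W c = 1%N -> judge t (step W O c 0) x -> judge t.+1 c x.
Proof.
move=> c1 H; apply: (judge_step _ _ _ (fun=> x)); rewrite c1.
  by move=> [|coin].
by rewrite big_ord1 divr1.
Qed.

Lemma judgeS t c x : judge t c x -> judge t.+1 c x.
Proof.
elim: t c x => [|t IHt] c x; last first.
  move=> [al cx]; apply: (judge_step _ _ _ (fun coin => prob R W O (fun f => ~~ rejected f) t (step W O c coin))) => //.
  by move=> coin lc; apply: IHt; split => //; exact: al.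
case=> [sc]; case: c sc => [k s [] //|b o] sc cx; apply: judge_det => //.
Qed.

Lemma judge_time t u c x : (t <= u)%N -> judge t c x -> judge u c x.
Proof.
move=> /subnK <- H; elim: (u - t)%N => // n IHn; rewrite addSn; exact: judgeS.
Qed.

(* In [Phi s y], the number [y] is the value promised at the store [s]: the
   rest of the program must not reject with probability at most [y] from it. *)
Definition triple (p : cmd) (n : nat) (s : store) (x : R)
    (Phi : store -> R -> Prop) : Prop :=
  forall k t, (forall s' y, Phi s' y -> judge t (Run k s') y) ->
    judge (t + n) (Run (p :: k) s) x.

Implicit Types (p : cmd) (s : store) (x y : R) (Phi Psi : store -> R -> Prop).

Lemma triple_time n m p s x Phi : (n <= m)%N -> triple p n s x Phi -> triple p m s x Phi.
Proof. by move=> nm H k t /H; apply: judge_time; rewrite leq_add2l. Qed.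

Lemma triple_post p n s x Phi Psi : (forall s' y, Phi s' y -> Psi s' y) ->
  triple p n s x Phi -> triple p n s x Psi.
Proof. by move=> PP H k t h; apply: H => s' y /PP; exact: h. Qed.

Lemma triple_skip s x Phi : Phi s x -> triple CSkip 1 s x Phi.
Proof. by move=> h k t H; rewrite addn1; apply: judge_det => //=; exact: H. Qed.

Lemma triple_seq p1 p2 n m s x Phi Psi : triple p1 n s x Psi ->
  (forall s' y, Psi s' y -> triple p2 m s' y Phi) ->
  triple (CSeq p1 p2) (n + m).+1 s x Phi.
Proof.
move=> H1 H2 k t H; rewrite addnS; apply: judge_det => //=.
rewrite [(n + m)%N]addnC addnA; apply: H1 => s' y /H2; exact.
Qed.

Lemma triple_set r a s x Phi : Phi (set_reg W s r (eval W s a)) x ->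
  triple (CSet r a) 1 s x Phi.
Proof. by move=> h k t H; rewrite addn1; apply: judge_det => //=; exact: H. Qed.

Lemma triple_store a b s x Phi :
  Phi (Store (regs s) (upd (ram s) (eval W s a) (eval W s b)) (out s)) x ->
  triple (CStore a b) 1 s x Phi.
Proof. by move=> h k t H; rewrite addn1; apply: judge_det => //=; exact: H. Qed.

Lemma triple_neighbor r a b s x Phi :
  Phi (set_reg W s r (ask_neighbor O (eval W s a) (eval W s b))) x ->
  triple (CNeighbor r a b) 1 s x Phi.
Proof. by move=> h k t H; rewrite addn1; apply: judge_det => //=; exact: H. Qed.

Lemma triple_degree r a s x Phi :
  Phi (set_reg W s r (ask_degree O (eval W s a))) x ->
  triple (CDegree r a) 1 s x Phi.
Proof. by move=> h k t H; rewrite addn1; apply: judge_det => //=; exact: H. Qed.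

Lemma triple_output a s x Phi :
  Phi (Store (regs s) (ram s) (rcons (out s) (eval W s a))) x ->
  triple (COutput a) 1 s x Phi.
Proof. by move=> h k t H; rewrite addn1; apply: judge_det => //=; exact: H. Qed.

(** Rejection fulfils every nonnegative promise, and no command is run after it, hence the arbitrary
    [Phi]. *)
Lemma triple_reject s x Phi : Q (out s) -> 0 <= x -> triple CReject 1 s x Phi.
Proof.
move=> Qs x0 k t _; apply: (judge_time 1); first by rewrite addn1.
by apply: judge_det => //=; split=> //; split=> // o [<-].
Qed.

Lemma triple_random r a s x (f : nat -> R) Phi :
  (forall coin, (coin <= eval W s a)%N -> Phi (set_reg W s r coin) (f coin)) ->
  (\sum_(coin < (eval W s a).+1) f coin) / (eval W s a).+1%:R <= x ->
  triple (CRandom r a) 1 s x Phi.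
Proof.
move=> h fx k t H; rewrite addn1.
apply: (judge_step _ _ _ f) => //= coin lc; exact/H/h.
Qed.

Lemma triple_if a p1 p2 n s x Phi :
  (eval W s a != 0%N -> triple p1 n s x Phi) ->
  (eval W s a = 0%N -> triple p2 n s x Phi) ->
  triple (CIf a p1 p2) n.+1 s x Phi.
Proof.
move=> h1 h2 k t H; rewrite addnS; apply: judge_det => //=.
by case: eqP => [/h2|/eqP/h1]; exact.
Qed.

(** The index of [I] counts the iterations that are still allowed, and thereby bounds the time. *)
Lemma triple_while a p n (I : nat -> store -> R -> Prop) i s x Phi :
  (forall i s y, I i s y -> eval W s a != 0%N ->
     exists2 j, i = j.+1 & triple p n s y (I j)) ->
  (forall i s y, I i s y -> eval W s a = 0%N -> Phi s y) ->
  I i s x -> triple (CWhile a p) (i * n.+1).+1 s x Phi.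
Proof.
move=> body post Is k t H; rewrite addnS.
elim: i s x Is => [|i IHi] s x Is; apply: judge_det => //=; have [E|E] := eqVneq (eval W s a) 0%N.
- by apply: judge_time (H _ _ (post _ _ _ Is E)); rewrite leq_addr.
- by have [j] := body _ _ _ Is E.
- by apply: judge_time (H _ _ (post _ _ _ Is E)); rewrite leq_addr.
have [j [<-] tr] := body _ _ _ Is E.
rewrite mulSn addSn addnS [(n + _)%N]addnC addnA -addSn; apply: tr => s' y Is'.
exact: IHi.
Qed.

Definition for_ (r b : nat) (p : cmd) : cmd :=
  CSeq (CSet r (EConst 0))
    (CWhile (ELt (EReg r) (EReg b)) (CSeq p (CSet r (EAdd (EReg r) (EConst 1))))).

(** The invariant has to resist every write to the counter [r]; this settles the initialization and
    all increments at once. *)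
Lemma triple_for r b p n m (I : nat -> store -> R -> Prop) s x Phi :
  (0 < m < W)%N -> r != b -> regs s b = m ->
  (forall i s y v, I i s y -> I i (set_reg W s r v) y) ->
  I 0%N s x ->
  (forall i s y, (i < m)%N -> regs s r = i -> regs s b = m -> I i s y ->
     triple p n s y (fun s' y' => [/\ regs s' r = i, regs s' b = m & I i.+1 s' y'])) ->
  (forall s y, regs s b = m -> I m s y -> Phi s y) ->
  triple (for_ r b p) (m * (n + 3) + 3) s x Phi.
Proof.
move=> /andP[m0 mW] rb sb Iset I0 body post.
have W1 : (1 < W)%N by apply: leq_ltn_trans mW.
pose J j s y := exists i, [/\ (i + j = m)%N, regs s r = i, regs s b = m & I i s y].
apply: (@triple_time (1 + (m * (n + 2).+1).+1).+1); first by rewrite addn2 addn3; lia.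
apply: (@triple_seq _ _ _ _ _ _ _ (J m)).
  apply: triple_set; exists 0%N; split; rewrite ?add0n //=.
  - by rewrite /upd eqxx !mod0n.
  - by rewrite /upd eq_sym (negbTE rb).
  - by apply: Iset.
move=> {x s sb I0} s' x' Jm; apply: (triple_while _ _ _ J) Jm.
- move=> j s y [i [ij sr sb Ii]] /=.
  rewrite sr sb (modn_small mW) (@modn_small i); last lia.
  rewrite (@modn_small (i < m)); last by case: (i < m)%N; lia.
  case: (ltnP i m) => // im _; exists j.-1; first by lia.
  apply: (@triple_time (n + 1).+1); first by lia.
  apply: (triple_seq _ _ _ _ _ _ _ _ (body i s y im sr sb Ii)).
  move=> s1 y1 [s1r s1b I1]; apply: triple_set; exists i.+1; split; first by lia.
  - by rewrite /= /upd eqxx s1r !modn_mod [(1 %% W)%N]modn_small // addn1 !modn_small //; lia.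
  - by rewrite /= /upd eq_sym (negbTE rb).
  - exact: Iset.
- move=> j s y [i [ij sr sb Ii]] /=.
  rewrite sr sb (modn_small mW) (@modn_small i); last lia.
  rewrite (@modn_small (i < m)); last by case: (i < m)%N; lia.
  case: (ltnP i m) => // im _; apply: post => //.
  by have <- : i = m by lia.
Qed.

End Logic.

Local Close Scope ring_scope.

(** * Exploration of a branch *)

Section Exploration.
Variables (N : nat) (e : rel 'I_N) (B : nat) (nb : 'I_N -> seq 'I_N).
Hypothesis e_sym : symmetric e.
Hypotheses (nb_uniq : forall v, uniq (nb v)) (nb_mem : forall v u, (u \in nb v) = e v u).
Local Notation branch := (branch N e).
Local Notation live := (live N e B).
Local Notation arc := ('I_N * 'I_N)%type.

(* Breadth-first exploration of a branch: the arcs [q] found so far, the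
   number [h] of them which are fully expanded, and the number [i] of neighbors
   already inspected for the next one. *)
Definition bfs_state := (seq arc * nat * nat)%type.

Definition bfs_step (a0 : arc) (st : bfs_state) : bfs_state :=
  let: (q, h, i) := st in
  if (h < size q) && (size q <= B) then
    let: (p, x) := nth a0 q h in
    if i < size (nb x) then
      let y := nth x (nb x) i in
      (if y == p then q else rcons q (x, y), h, i.+1)
    else (q, h.+1, 0)
  else st.

Definition bfs (a0 : arc) (n : nat) : bfs_state := iter n (bfs_step a0) ([:: a0], 0, 0).

(** The entries of the queue stand for walks, so an arc may occur several times. Counted are the
    expanded entries, the walks through the neighbors not yet inspected of the current entry, and
    those continuing the waiting entries. *)
Definition bfs_size (a0 : arc) (st : bfs_state) (n : nat) : nat :=
  let: (q, h, i) := st in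
  let: (p, x) := nth a0 q h in
  (h + if h < size q then
         (\sum_(y <- drop i (nb x) | y != p) branch n x y).+1 +
           \sum_(b <- drop h.+1 q) branch n b.1 b.2
       else 0)%N.

(** The step count [b] is paid for by one unit per entry found, two per expanded entry (its end, and
    the skipping of its parent), and one if the parent of the current entry has been passed. The
    last two clauses sandwich [bfs_size] between branch counts, up to a shift [k] of the depth. *)
Definition bfs_ok (a0 : arc) (b : nat) (st : bfs_state) : Prop :=
  let: (q, h, i) := st in
  let: (p, x) := nth a0 q h in
  [/\ all (fun c => e c.1 c.2) q, h <= size q <= B.+1, 0 < size q,
      i <= size (nb x) &
      h < size q <= B -> b <= (size q).-1 + h.*2 + (p \in take i (nb x))] /\
  [/\ h = size q -> i = 0, forall n, branch n a0.1 a0.2 <= bfs_size a0 st n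
    & exists k, forall n, bfs_size a0 st n <= branch (n + k) a0.1 a0.2].

Lemma branchS n u v : branch n.+1 u v = (\sum_(w <- nb v | w != u) branch n v w).+1.
Proof.
rewrite /=; congr _.+1; rewrite -[LHS]big_filter -[RHS]big_filter.
apply: perm_big; apply: uniq_perm.
- by rewrite filter_uniq // index_enum_uniq.
- exact: filter_uniq.
by move=> w; rewrite !mem_filter nb_mem mem_index_enum andbT andbC.
Qed.

Lemma branch_mono n m u v : n <= m -> branch n u v <= branch m u v.
Proof.
move=> /subnK <-; elim: (m - n) => // k; move/leq_trans; apply; rewrite addSn.
elim: (k + n) u v => //= i IHi u v; rewrite ltnS leq_sum // => w _; exact: IHi.
Qed.

Lemma bfs_okS a0 b st : bfs_ok a0 b st -> bfs_ok a0 b.+1 (bfs_step a0 st).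
Proof.
case: st => [[q h] i]; rewrite /bfs_ok /bfs_step.
case Ea: (nth a0 q h) => [p x] [[allq hq q0 ix bb] [hi up lo]].
case: (boolP ((h < size q) && (size q <= B))) => [hqB|nact]; last first.
  rewrite Ea; split; split => //; by rewrite (negbTE nact).
have {}bb := bb hqB; have /andP[hq1 qB] := hqB.
have epx : e p x.
  by have /allP := allq => /(_ (nth a0 q h)); rewrite mem_nth // Ea => /(_ isT).
have p_nb : p \in nb x by rewrite nb_mem e_sym.
have [ix1|ix1] := ltnP i (size (nb x)).
  set y := nth x (nb x) i.
  have dropE : drop i (nb x) = y :: drop i.+1 (nb x) by rewrite (drop_nth x).
  have takeE : take i.+1 (nb x) = rcons (take i (nb x)) y by rewrite (take_nth x).
  case: (boolP (y == p)) => yp.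
    have E n : bfs_size a0 (q, h, i.+1) n = bfs_size a0 (q, h, i) n.
      by rewrite /bfs_size Ea hq1 dropE big_cons yp.
    rewrite Ea; split; split => //.
    - move=> _; apply: leq_trans (_ : b.+1 <= ((size q).-1 + h.*2 + (p \in take i (nb x))).+1) _ => //.
      rewrite takeE mem_rcons inE (eqP yp) eqxx /= addn1 ltnS.
      have ynt : y \notin take i (nb x).
        have : uniq (take i (nb x) ++ y :: drop i.+1 (nb x)) by rewrite -dropE cat_take_drop.
        by rewrite cat_uniq /= negb_or => /and3P[_ /andP[]].
      by rewrite -(eqP yp) (negbTE ynt) addn0.
    - by move=> hE; rewrite hE ltnn in hq1.
    - by move=> n; rewrite E.
    - by have [k kP] := lo; exists k => n; rewrite E.
  have nth_h : nth a0 (rcons q (x, y)) h = (p, x) by rewrite nth_rcons hq1 Ea.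
  have E n : bfs_size a0 (rcons q (x, y), h, i.+1) n = bfs_size a0 (q, h, i) n.
    rewrite /bfs_size nth_h Ea size_rcons ltnS (ltnW hq1) hq1 dropE big_cons yp.
    rewrite drop_rcons // -cats1 big_cat big_seq1 /=; lia.
  rewrite nth_h size_rcons; split; split => //.
  - rewrite all_rcons allq andbT /= -nb_mem mem_nth //.
  - lia.
  - move=> _; rewrite takeE mem_rcons inE eq_sym (negbTE yp) /=; move: bb; case: (p \in _); lia.
  - by move=> hE; rewrite hE in hq1; lia.
  - by move=> n; rewrite E.
  - by have [k kP] := lo; exists k => n; rewrite E.
have iE : i = size (nb x) by lia.
case Ea' : (nth a0 q h.+1) => [p' x'].
have step_up n : bfs_size a0 (q, h, i) n <= bfs_size a0 (q, h.+1, 0) n.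
  rewrite /bfs_size Ea Ea' hq1 iE drop_size big_nil.
  have [h1|h1] := ltnP h.+1 (size q); last by rewrite drop_oversize // big_nil; lia.
  rewrite (drop_nth a0 h1) big_cons Ea' drop0 -branchS.
  have : branch n p' x' <= branch n.+1 p' x' by exact: branch_mono.
  rewrite [(p', x').1]/= [(p', x').2]/=; lia.
have step_lo n : bfs_size a0 (q, h.+1, 0) n <= bfs_size a0 (q, h, i) n.+1.
  rewrite /bfs_size Ea Ea' hq1 iE drop_size big_nil.
  have [h1|h1] := ltnP h.+1 (size q); last by rewrite drop_oversize // big_nil; lia.
  rewrite (drop_nth a0 h1) big_cons Ea' drop0 -branchS.
  have : \sum_(b0 <- drop h.+2 q) branch n b0.1 b0.2 <= \sum_(b0 <- drop h.+2 q) branch n.+1 b0.1 b0.2.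
    by apply: leq_sum => c _; exact: branch_mono.
  rewrite [(p', x').1]/= [(p', x').2]/=; lia.
split; split => //.
- by rewrite hq1; lia.
- move=> _; rewrite take0 in_nil addn0 doubleS.
  move: bb; rewrite iE take_size p_nb; lia.
- by move=> n; apply: leq_trans (up n) _.
- have [k kP] := lo; exists k.+1 => n; apply: leq_trans (step_lo n) _.
  by have := kP n.+1; rewrite addSnnS.
Qed.

Lemma bfs_okP a0 n : e a0.1 a0.2 -> bfs_ok a0 n (bfs a0 n).
Proof.
move=> ea0; elim: n => [|n IHn]; last by rewrite /bfs iterS; exact: bfs_okS.
rewrite /bfs_ok /bfs /=; case: a0 ea0 => u v /= euv; split; split => //=.
- by rewrite euv.
- move=> n; rewrite /bfs_size /= drop0 big_nil addn0 add0n -branchS; exact: branch_mono.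
- by exists 1%N => n; rewrite /bfs_size /= drop0 big_nil addn0 add0n addn1 -branchS.
Qed.

(** An active search has [h < size q <= B], which keeps its step count below [3 * B]. So it has
    stopped: either more than [B] walks are found, or the queue is exhausted and contains all
    walks. *)
Lemma bfs_live u v n q h i : e u v -> (3 * B < n)%N -> bfs (u, v) n = (q, h, i) ->
  (B < size q)%N = live u v.
Proof.
move=> euv Bn Eq; have := bfs_okP (u, v) n euv; rewrite Eq /bfs_ok.
case Ea: (nth (u, v) q h) => [p x] [[allq hq q0 ix bb] [hi up [k lo]]].
have [qB|qB] := ltnP B (size q).
  apply/esym/asboolP; exists (1 + k); apply: leq_trans (lo 1%N).
  apply: leq_trans qB _; rewrite /bfs_size Ea; case: ltnP => hq1; last by lia.
  have -> : \sum_(c <- drop h.+1 q) branch 1 c.1 c.2 = size q - h.+1.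
    by rewrite -size_drop -sum1_size; apply: eq_bigr => c _; rewrite branchS big1.
  lia.
apply/esym/negbTE/negP => /asboolP[m Bm].
have hE : h = size q.
  case: (ltnP h (size q)) => [h1|]; last by lia.
  by have := bb _; rewrite h1 qB => /(_ isT); case: (p \in _) => /=; lia.
have := up m; rewrite /bfs_size Ea hE ltnn addn0 /=; move: Bm qB; lia.
Qed.

End Exploration.

(** * Symbolic execution of straight-line programs without overflow *)

Definition setr (s : store) (r v : nat) : store := Store (upd (regs s) r v) (ram s) (out s).

Definition setm (s : store) (a v : nat) : store := Store (regs s) (upd (ram s) a v) (out s).

Definition block (l : seq cmd) : cmd := foldr CSeq CSkip l.

Definition name N (v : 'I_N) : nat := (val v).+1.

Arguments name {N} v.

Lemma name_le N (v : 'I_N) : name v <= N.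
Proof. exact: ltn_ord. Qed.

Lemma name_inj N : injective (@name N).
Proof. by move=> u v [/val_inj]. Qed.

Lemma name_eq N (u v : 'I_N) : (name u == name v) = (u == v).
Proof. by apply/eqP/eqP => [/name_inj|->]. Qed.

Section Eval.
Variables (W : nat) (s : store).
Hypothesis W1 : 1 < W.

Lemma ev_const n : n < W -> eval W s (EConst n) = n.
Proof. exact: modn_small. Qed.

Lemma ev_reg r v : regs s r = v -> v < W -> eval W s (EReg r) = v.
Proof. by move=> /= ->; exact: modn_small. Qed.

Lemma ev_mem a va v : eval W s a = va -> ram s va = v -> v < W -> eval W s (EMem a) = v.
Proof. by move=> /= -> ->; exact: modn_small. Qed.

Lemma ev_add a b va vb : eval W s a = va -> eval W s b = vb -> va + vb < W ->
  eval W s (EAdd a b) = va + vb.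
Proof. by move=> /= -> ->; exact: modn_small. Qed.

Lemma ev_sub a b va vb : eval W s a = va -> eval W s b = vb -> va < W ->
  eval W s (ESub a b) = va - vb.
Proof. by move=> /= -> -> vW; apply: modn_small; apply: leq_ltn_trans vW; exact: leq_subr. Qed.

Lemma ev_mul a b va vb : eval W s a = va -> eval W s b = vb -> va * vb < W ->
  eval W s (EMul a b) = va * vb.
Proof. by move=> /= -> ->; exact: modn_small. Qed.

Lemma ev_div a b va vb : eval W s a = va -> eval W s b = vb -> va < W ->
  eval W s (EDiv a b) = va %/ vb.
Proof. by move=> /= -> -> vW; apply: modn_small; apply: leq_ltn_trans vW; exact: leq_div. Qed.

Lemma ev_mod a b va vb : eval W s a = va -> eval W s b = vb -> va < W ->
  eval W s (EMod a b) = va %% vb.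
Proof. by move=> /= -> -> vW; apply: modn_small; apply: leq_ltn_trans vW; exact: leq_mod. Qed.

Lemma ev_lt a b va vb : eval W s a = va -> eval W s b = vb ->
  eval W s (ELt a b) = (va < vb).
Proof. by move=> /= -> ->; apply: modn_small; case: (va < vb) => //; exact: ltnW. Qed.

Lemma ev_eq a b va vb : eval W s a = va -> eval W s b = vb ->
  eval W s (EEq a b) = (va == vb).
Proof. by move=> /= -> ->; apply: modn_small; case: (va == vb) => //; exact: ltnW. Qed.

End Eval.

(* The registers of the tester: 0 and 1 hold [N] and the ceiling of [1 / eps];
   2 to 11 hold the parameters [x], [sq], [lg], [A], [B], [K], [M], [T], [F] and
   [C]; 12 the scale of the degrees; 13 the address of the parent pointers; 14
   to 18, 30 and 34 the loop counters; 19 and 20 the starting arc; 21 the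
   current vertex, 22 the next one, 23 the previous one; 24, 25 and 26 the
   breadth-first search; the other ones are temporary. *)
Definition succN : expr := EAdd (EReg 0) (EConst 1).

Definition cell (r : nat) : expr := EAdd (EReg 13) (EReg r).

Ltac ev := lazymatch goal with
  | |- eval _ _ (EAdd _ _) = _ => eapply ev_add; [ev | ev | ]
  | |- eval _ _ (ESub _ _) = _ => eapply ev_sub; [ev | ev | ]
  | |- eval _ _ (EMul _ _) = _ => eapply ev_mul; [ev | ev | ]
  | |- eval _ _ (EDiv _ _) = _ => eapply ev_div; [ev | ev | ]
  | |- eval _ _ (EMod _ _) = _ => eapply ev_mod; [ev | ev | ]
  | |- eval _ _ (ELt _ _) = _ => eapply ev_lt; [ | ev | ev]
  | |- eval _ _ (EEq _ _) = _ => eapply ev_eq; [ | ev | ev]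
  | |- eval _ _ (EMem _) = _ => eapply ev_mem; [ev | cbn; solve [eassumption | reflexivity] | ]
  | |- eval _ _ (EConst _) = _ => eapply ev_const
  | |- eval _ _ (EReg _) = _ => eapply ev_reg; [cbn; solve [eassumption | reflexivity] | ]
  | |- eval _ _ succN = _ => unfold succN; ev
  | |- eval _ _ (cell _) = _ => unfold cell; ev
  | _ => idtac
  end.

(* [lia], in a context restricted to the inequalities and the equations which
   do not mention registers *)
Ltac qlia := repeat match goal with
  | H : ?P |- _ =>
    lazymatch type of P with
    | Prop => lazymatch P with
        | is_true (leq _ _) => fail
        | is_true (andb (leq _ _) (leq _ _)) => fail
        | is_true (negb (leq _ _)) => fail
        | regs _ _ = _ => clear H
        | @eq nat _ _ => fail
        | _ => clear H
        end
    end
  end; lia.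

Section Blocks.
Variables (R : realType) (W : nat) (O : oracle) (Q : seq nat -> Prop).
Local Notation triple := (triple R W O Q).

Lemma set_regE s r v : v < W -> set_reg W s r v = setr s r v.
Proof. by move=> vW; rewrite /set_reg modn_small. Qed.

Lemma do_skip n s x (Phi : store -> R -> Prop) : Phi s x -> triple (block [::]) n.+1 s x Phi.
Proof. by move=> h; apply: (triple_time _ _ _ _ 1) => //; exact: triple_skip. Qed.

Lemma do_nop n s x (Phi : store -> R -> Prop) : Phi s x -> triple CSkip n.+1 s x Phi.
Proof. exact: do_skip. Qed.

Lemma do_set r a l v n s x Phi : eval W s a = v -> v < W ->
  triple (block l) n (setr s r v) x Phi -> triple (block (CSet r a :: l)) n.+2 s x Phi.
Proof.
move=> ea vW H; apply: (triple_seq _ _ _ _ _ _ 1 _ _ _ _ (fun s' y => s' = setr s r v /\ y = x)).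
  by apply: triple_set; rewrite ea set_regE.
by move=> s' y [-> ->].
Qed.

Lemma do_store a b l va vb n s x Phi : eval W s a = va -> eval W s b = vb ->
  triple (block l) n (setm s va vb) x Phi -> triple (block (CStore a b :: l)) n.+2 s x Phi.
Proof.
move=> ea eb H; apply: (triple_seq _ _ _ _ _ _ 1 _ _ _ _ (fun s' y => s' = setm s va vb /\ y = x)).
  by apply: triple_store; rewrite ea eb.
by move=> s' y [-> ->].
Qed.

Lemma do_neighbor r a b l va vb v n s x Phi : eval W s a = va -> eval W s b = vb ->
  ask_neighbor O va vb = v -> v < W ->
  triple (block l) n (setr s r v) x Phi -> triple (block (CNeighbor r a b :: l)) n.+2 s x Phi.
Proof.
move=> ea eb ev vW H.
apply: (triple_seq _ _ _ _ _ _ 1 _ _ _ _ (fun s' y => s' = setr s r v /\ y = x)).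
  by apply: triple_neighbor; rewrite ea eb ev set_regE.
by move=> s' y [-> ->].
Qed.

Lemma do_degree r a l va v n s x Phi : eval W s a = va ->
  ask_degree O va = v -> v < W ->
  triple (block l) n (setr s r v) x Phi -> triple (block (CDegree r a :: l)) n.+2 s x Phi.
Proof.
move=> ea ev vW H.
apply: (triple_seq _ _ _ _ _ _ 1 _ _ _ _ (fun s' y => s' = setr s r v /\ y = x)).
  by apply: triple_degree; rewrite ea ev set_regE.
by move=> s' y [-> ->].
Qed.

Lemma do_output a l va n s x Phi : eval W s a = va ->
  triple (block l) n (Store (regs s) (ram s) (rcons (out s) va)) x Phi ->
  triple (block (COutput a :: l)) n.+2 s x Phi.
Proof.
move=> ea H.
apply: (triple_seq _ _ _ _ _ _ 1 _ _ _ _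
  (fun s' y => s' = Store (regs s) (ram s) (rcons (out s) va) /\ y = x)).
  by apply: triple_output; rewrite ea.
by move=> s' y [-> ->].
Qed.

Lemma do_cmd p l n m s x Phi Psi : triple p n s x Psi ->
  (forall s' y, Psi s' y -> triple (block l) m s' y Phi) ->
  triple (block (p :: l)) (n + m).+1 s x Phi.
Proof. by move=> H1 H2; apply: triple_seq H1 _. Qed.

Lemma do_if a p1 p2 n s x Phi (b : bool) : eval W s a = b ->
  (b -> triple p1 n s x Phi) -> (~~ b -> triple p2 n s x Phi) ->
  triple (CIf a p1 p2) n.+1 s x Phi.
Proof.
move=> ea h1 h2; apply: triple_if; rewrite ea; first by case: b h1 {h2 ea} => // /(_ isT).
by case: b h2 {h1 ea} => // /(_ isT).
Qed.

Lemma do_if_neq0 a p1 p2 n s x Phi v : eval W s a = v ->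
  (v != 0 -> triple p1 n s x Phi) -> (v = 0 -> triple p2 n s x Phi) ->
  triple (CIf a p1 p2) n.+1 s x Phi.
Proof. by move=> ea h1 h2; apply: triple_if; rewrite ea. Qed.

End Blocks.

(* An arc [(p, x)] of the exploration queue is packed in the word
   [name p * (N + 1) + name x]. *)
Definition bfs_body : cmd :=
  CIf (ELt (EReg 24) (EReg 25))
    (CIf (ELt (EReg 25) (EAdd (EReg 6) (EConst 1)))
      (block [:: CSet 27 (EMod (EMem (EReg 24)) succN);
                 CSet 28 (EDiv (EMem (EReg 24)) succN);
                 CSet 26 (EAdd (EReg 26) (EConst 1));
                 CNeighbor 29 (EReg 27) (EReg 26);
                 CIf (EReg 29)
                   (CIf (EEq (EReg 29) (EReg 28)) CSkip
                     (block [:: CStore (EReg 25) (EAdd (EMul (EReg 27) succN) (EReg 29));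
                                CSet 25 (EAdd (EReg 25) (EConst 1))]))
                   (block [:: CSet 24 (EAdd (EReg 24) (EConst 1)); CSet 26 (EConst 0)])])
      CSkip)
    CSkip.

Definition live_cmd : cmd :=
  block [:: CStore (EConst 0) (EAdd (EMul (EReg 21) succN) (EReg 22));
            CSet 24 (EConst 0); CSet 25 (EConst 1); CSet 26 (EConst 0);
            for_ 30 10 bfs_body].

(** * The liveness search on the machine *)

Section Search.
Variables (R : realType) (N : nat) (e : rel 'I_N) (W B F : nat) (g : incidence_lists N).
Variables (Q : seq nat -> Prop) (nb : 'I_N -> seq 'I_N).
Hypotheses (e_sym : symmetric e) (e_irr : irreflexive e).
Hypotheses (nb_uniq : forall v, uniq (nb v)) (nb_mem : forall v u, (u \in nb v) = e v u).
Hypothesis nb_g : forall v (i : 'I_N.-1), g v i = nth 0 [seq name u | u <- nb v] i :> nat.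
Hypotheses (NW : N.+1 * N.+1 < W) (BW : B.+2 < W) (FW : F < W) (BF : 3 * B < F).
Let O := graph_oracle g e.
Local Notation triple := (triple R W O Q).
Local Notation live := (live N e B).

Lemma size_nb v : size (nb v) <= N.-1.
Proof.
have /card_uniqP <- := nb_uniq v; rewrite -[N in leqRHS]card_ord.
have /subset_leq_card : nb v \subset [set~ v].
  by apply/subsetP => u; rewrite nb_mem !inE; apply: contraTneq => ->; rewrite e_irr.
by rewrite cardsC1.
Qed.

Lemma size_nbE v : size (nb v) = deg N e v.
Proof.
rewrite -(card_uniqP (nb_uniq v)); apply: eq_card => u; by rewrite inE nb_mem.
Qed.

(** Past the last valid position both sides are 0, because a vertex has at most [N.-1] neighbors. *)
Lemma query_nb v i : ask_neighbor O (name v) i.+1 = nth 0 [seq name u | u <- nb v] i.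
Proof.
rewrite /= /neighbor_query; case: pickP => [[v' j] /= /andP[/eqP[v'v] /eqP[ji]]|no].
  by rewrite nb_g ji; congr (nth _ [seq _ | _ <- nb _] _); apply: val_inj.
rewrite nth_default // size_map; apply: leq_trans (size_nb v) _; rewrite leqNgt; apply/negP => iN.
by have := no (v, Ordinal iN); rewrite /= !eqxx.
Qed.

Lemma query_nb_lt v i : nth 0 [seq name u | u <- nb v] i <= N.
Proof.
case: (ltnP i (size (nb v))) => ib; last by rewrite nth_default // size_map.
by rewrite (nth_map v) // name_le.
Qed.

Lemma query_deg v : ask_degree O (name v) = deg N e v.
Proof.
rewrite /= /degree_query; case: pickP => [v' /eqP[/val_inj ->] //|/(_ v)].
by rewrite eqxx.
Qed.

Definition pack (a : 'I_N * 'I_N) : nat := name a.1 * N.+1 + name a.2.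

Lemma pack_lt a : pack a < N.+1 * N.+1.
Proof.
rewrite /pack; have := name_le N a.1; have := name_le N a.2.
move: (name a.1) (name a.2) => b c; nia.
Qed.

Lemma pack_mod a : pack a %% N.+1 = name a.2.
Proof. by rewrite /pack modnMDl modn_small // ltnS name_le. Qed.

Lemma pack_div a : pack a %/ N.+1 = name a.1.
Proof. by rewrite /pack divnMDl // divn_small ?addn0 // ltnS name_le. Qed.

Definition keeps (rs : seq nat) (lo : nat) (s s' : store) : Prop :=
  [/\ forall r, r \notin rs -> regs s' r = regs s r,
      forall a, lo <= a -> ram s' a = ram s a & out s' = out s].

Lemma keeps_trans rs lo s1 s2 s3 : keeps rs lo s1 s2 -> keeps rs lo s2 s3 -> keeps rs lo s1 s3.
Proof.
move=> [r12 m12 o12] [r23 m23 o23]; split; last by rewrite o23.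
- by move=> r rn; rewrite r23 ?r12.
- by move=> a la; rewrite m23 ?m12.
Qed.

Lemma keeps_setr rs lo s s' r v : r \in rs -> keeps rs lo s s' -> keeps rs lo s (setr s' r v).
Proof.
move=> rr [rs12 m12 o12]; split=> // r' r'n; rewrite /= /upd.
by case: eqP => [E|_]; [rewrite E rr in r'n | exact: rs12].
Qed.

Lemma keeps_setm rs lo s s' a v : a < lo -> keeps rs lo s s' -> keeps rs lo s (setm s' a v).
Proof.
move=> al [rs12 m12 o12]; split=> // a' la'; rewrite /= /upd.
by case: eqP => [E|_]; [lia | exact: m12].
Qed.

Lemma set_reg_setr s r v : set_reg W s r v = setr s r (v %% W).
Proof. by []. Qed.

(** The search works in the registers 24 to 30, and its queue fills at most the cells 0 to [B]. *)
Lemma bfs_triple v w s x : e v w ->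
  regs s 0 = N -> regs s 6 = B -> regs s 10 = F -> regs s 21 = name v -> regs s 22 = name w ->
  triple live_cmd (F * 22 + 20) s x
    (fun s' y => [/\ y = x, keeps (iota 24 7) B.+1 s s', regs s' 25 <= B.+1
       & (B < regs s' 25) = live v w]).
Proof.
move=> evw s0 s6 s10 s21 s22; have W1 : 1 < W by lia.
have := name_le _ v; have := name_le _ w => wN vN.
have vwW := leq_ltn_trans (ltnW (pack_lt (v, w))) NW; rewrite /pack /= in vwW.
apply: (@triple_time _ _ _ _ ((F * (19 + 3) + 3) + 1).+1.+4.+4); first by lia.
rewrite /live_cmd.
eapply do_store; [by ev; qlia | by ev; rewrite ?addn1; lia | ].
do 3![eapply do_set; [by ev; qlia | qlia | ]].
set s1 := setr _ 26 0.
pose I b s2 y := y = x /\ keeps (iota 24 7) B.+1 s s2 /\ exists q h i,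
  [/\ bfs N B nb (v, w) b = (q, h, i), regs s2 24 = h, regs s2 25 = size q,
      regs s2 26 = i & forall j, j < size q -> ram s2 j = pack (nth (v, w) q j)].
have k1 : keeps (iota 24 7) B.+1 s s1 by do 3!apply: keeps_setr => //; exact: keeps_setm.
apply: (do_cmd _ _ _ _ _ _ _ _ _ _ _ (fun s2 y => I F s2 y)).
  apply: (triple_for _ _ _ _ _ _ _ _ _ I) => //.
  - by rewrite FW andbT; lia.
  - move=> b s2 y c [-> [k2 [q [h [i [Eb r24 r25 r26 rm]]]]]]; split=> //; split.
      by rewrite set_reg_setr; exact: keeps_setr.
    by exists q, h, i.
  - split=> //; split; first exact: k1.
    by exists [:: (v, w)], 0, 0; split=> // -[|j] //= _; rewrite /pack addn1.
  move=> b s2 y bF r30 r10 [-> {y}[k2 [q [h [i [Eb r24 r25 r26 rm]]]]]].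
  have := bfs_okP N e B nb e_sym nb_uniq nb_mem (v, w) b evw.
  have EbS : bfs N B nb (v, w) b.+1 = bfs_step N B nb (v, w) (q, h, i) by rewrite -Eb.
  rewrite Eb /bfs_ok; case Ea: (nth (v, w) q h) => [p z] [[_ /andP[hq qB] _ ix _] _].
  have [k2r _ _] := k2.
  have r0 : regs s2 0 = N by rewrite k2r.
  have r6 : regs s2 6 = B by rewrite k2r.
  have kr s3 y3 : keeps (iota 24 7) B.+1 s2 s3 -> regs s3 30 = b -> y3 = x ->
    (exists q' h' i', [/\ bfs_step N B nb (v, w) (q, h, i) = (q', h', i'),
      regs s3 24 = h', regs s3 25 = size q', regs s3 26 = i' &
      forall j, j < size q' -> ram s3 j = pack (nth (v, w) q' j)]) ->
    [/\ regs s3 30 = b, regs s3 10 = F & I b.+1 s3 y3].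
    move=> k3 r3 -> H; have k03 := keeps_trans _ _ _ _ _ k2 k3; split=> //.
      by have [-> //] := k03.
    by split=> //; split=> //; rewrite EbS.
  eapply do_if; first by ev; qlia.
    move=> hq1; eapply do_if; first by ev; qlia.
      move=> qB1.
      have rh : ram s2 h = pack (p, z) by rewrite rm // Ea.
      have phW := leq_ltn_trans (ltnW (pack_lt (p, z))) NW.
      have pN := name_le _ p; have zN := name_le _ z.
      have hW : h < W by lia.
      have iW : i + 1 < W by have := size_nb z; nia.
      have actE : (h < size q) && (size q <= B) by rewrite hq1; lia.
      have := kr; rewrite /bfs_step actE Ea => {}kr.
      eapply (do_set _ _ _ _ 27 _ _ (name z)); [ | qlia | ].
        by rewrite -[RHS](pack_mod (p, z)) -[N.+1]addn1; ev; qlia.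
      eapply (do_set _ _ _ _ 28 _ _ (name p)); [ | qlia | ].
        by rewrite -[RHS](pack_div (p, z)) -[N.+1]addn1; ev; qlia.
      eapply do_set; [by ev; qlia | qlia | ].
      have yN := query_nb_lt z i.
      eapply (do_neighbor _ _ _ _ 29 _ _ _ _ _ (nth 0 [seq name u | u <- nb z] i)); [by ev; qlia | by ev; qlia | | | ].
      + by rewrite addn1; exact: query_nb.
      + by lia.
      eapply (do_cmd _ _ _ _ _ _ 7 1); last by move=> s' y' H; apply: do_skip; exact: H.
      eapply do_if_neq0; first by ev; qlia.
        case: (ltnP i (size (nb z))) => iz; last by rewrite nth_default ?size_map.
        rewrite (nth_map z) //; set c := nth z (nb z) i => _.
        have cN := name_le _ c.
        rewrite iz -/c in kr.
        have k3 : keeps (iota 24 7) B.+1 s2 (setr (setr (setr (setr s2 27 (name z)) 28 (name p)) 26 (i + 1)) 29 (name c)).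
          by do !apply: keeps_setr => //.
        eapply do_if; first by ev; qlia.
          rewrite name_eq => cp; rewrite cp in kr.
          apply: do_nop; apply: kr => //; exists q, h, i.+1; split=> //.
          by rewrite /= /upd /= addn1.
        rewrite name_eq => /negbTE cp; rewrite cp in kr.
        have zcW := leq_ltn_trans (ltnW (pack_lt (z, c))) NW.
        have zcW' : name z * (N + 1) + name c < W by move: zcW; rewrite /pack /= addn1.
        eapply do_store; [by ev; qlia | by ev; qlia | ].
        eapply do_set; [by ev; qlia | by qlia | ].
        apply: do_skip; apply: kr => //.
          by apply: keeps_setr => //; apply: keeps_setm => //; lia.
        exists (rcons q (z, c)), h, i.+1; split=> //.
        - by rewrite size_rcons /= /upd /= addn1.
        - by rewrite /= /upd /= addn1.
        move=> j; rewrite size_rcons ltnS leq_eqVlt nth_rcons /= /upd.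
        case: eqP => [->|_] /=; last by move=> jq; rewrite jq; exact: rm.
        by rewrite ltnn ?eqxx /pack addn1.
      case: (ltnP i (size (nb z))) => iz.
        by rewrite (nth_map z) // /name.
      move=> _; rewrite ltnNge iz /= in kr.
      eapply do_set; [by ev; qlia | by qlia | ].
      eapply do_set; [by ev; qlia | by qlia | ].
      apply: do_skip; apply: kr => //.
        by do !apply: keeps_setr => //.
      exists q, h.+1, 0; split=> //.
      by rewrite /= /upd /= addn1.
    move=> nq; apply: do_nop; apply: kr => //.
    exists q, h, i; split=> //; rewrite /bfs_step.
    by rewrite (_ : (size q <= B) = false) ?andbF //; lia.
  move=> nh; apply: do_nop; apply: kr => //.
  by exists q, h, i; split=> //; rewrite /bfs_step (negbTE nh).
move=> s2 y [-> [k2 [q [h [i [Eb r24 r25 r26 rm]]]]]]; apply: do_skip; split=> //.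
  have := bfs_okP N e B nb e_sym nb_uniq nb_mem (v, w) F evw.
  rewrite Eb /bfs_ok r25; case: (nth _ _ _) => [p z] [[_ /andP[_ ->]]] //.
rewrite r25; exact: bfs_live Eb.
Qed.

End Search.

(** * Trees of parent pointers *)

Section Trees.
Variables (N : nat) (e : rel 'I_N).
Hypotheses (e_sym : symmetric e) (e_irr : irreflexive e).
Implicit Types (par : 'I_N -> nat) (q : seq 'I_N).

(* A tree is stored by parent names, its root [r] having the junk parent
   [N + 1]; the parent of a vertex outside of the tree is 0. *)
Definition up par : rel 'I_N := fun a b => (par a == name b) && e a b.

Definition chain par (r a : 'I_N) q : bool :=
  [&& path (up par) a q, last a q == r & par r == N.+1].

Lemma chain_cons par r a b q : chain par r a (b :: q) = up par a b && chain par r b q.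
Proof. by rewrite /chain /= -andbA. Qed.

Lemma root_up par r b : par r = N.+1 -> ~~ up par r b.
Proof.
move=> pr; rewrite /up pr; apply/nandP; left.
by apply/eqP => h; have := name_le _ b; rewrite -h ltnn.
Qed.

(** The pointers determine each step, and at the root the junk parent, which is not a name, forces
    the chain to stop. *)
Lemma chain_det par r a q q' : chain par r a q -> chain par r a q' -> q = q'.
Proof.
elim: q q' a => [|b q IHq] [|b' q'] a //.
- move=> /and3P[_ /eqP /= <- /eqP pr]; rewrite chain_cons.
  by rewrite (negbTE (root_up _ _ b' pr)).
- rewrite chain_cons => /andP[ab _] /and3P[_ /eqP /= ar /eqP pr].
  by move: ab; rewrite ar (negbTE (root_up _ _ b pr)).
rewrite !chain_cons => /andP[/andP[/eqP ab _] cb] /andP[/andP[/eqP ab' _] cb'].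
have E : b = b' by apply: name_inj; rewrite -ab -ab'.
by rewrite -E in cb' *; rewrite (IHq q' b).
Qed.

Lemma chain_suffix par r a q1 b q2 : chain par r a (q1 ++ b :: q2) -> chain par r b q2.
Proof.
case/and3P; rewrite cat_path /= => /and3P[_ _ pb] l pr.
by apply/and3P; split=> //; move: l; rewrite last_cat.
Qed.

Lemma chain_uniq par r a q : chain par r a q -> uniq (a :: q).
Proof.
elim: q a => [|b q IHq] a //; rewrite [uniq _]/= -/(uniq (b :: q)) => c.
have cb : chain par r b q by move: c; rewrite chain_cons => /andP[].
rewrite (IHq b cb) andbT; apply/negP => /path.splitPr h.
case: h c => q1 q2 c.
have := chain_det _ _ _ _ _ c (chain_suffix _ _ _ _ _ _ c) => /(congr1 size).
rewrite size_cat /=; lia.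
Qed.

Lemma chain_upd par par' r a q : (forall b, par b != 0 -> par' b = par b) ->
  chain par r a q -> chain par' r a q.
Proof.
move=> pp; elim: q a => [|b q IHq] a.
  by case/and3P=> _ l /eqP pr; apply/and3P; split=> //; rewrite pp pr.
rewrite !chain_cons => /andP[/andP[/eqP ab eab] /IHq->]; rewrite andbT /up eab andbT.
by rewrite pp ab.
Qed.

(** Trajectories that agree with one tree are determined by their ends. A conflict can therefore
    only arise after an edge that contradicts the tree. *)
Lemma chain_conflict par r (p : seq 'I_N) (P : seq (seq 'I_N)) :
  (forall q, q \in p :: P -> exists a q', q = a :: q' /\ chain par r a q') ->
  ~~ conflict N p P.
Proof.
move=> H; have [a [p' [Ep cp]]] := H p (mem_head _ _).
rewrite negb_or negbK Ep (chain_uniq _ _ _ _ cp) /=.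
apply/hasPn => q qP; have [b [q' [-> cq]]] := H q (mem_behead (s := p :: P) qP).
rewrite negb_and negbK; case: eqVneq => //= -[E].
by rewrite E in cq *; rewrite (chain_det _ _ _ _ _ cq cp) eqxx.
Qed.

(* The parents after the pointers have been reversed along the first [j]
   vertices of [pv]. *)
Definition reversed par (pv : seq 'I_N) (j : nat) (a : 'I_N) : nat :=
  if index a pv < j then
    if index a pv is i.+1 then name (nth a pv i) else 0
  else par a.

Definition down par (pv : seq 'I_N) : rel 'I_N := fun a b =>
  (reversed par pv (size pv) a == name b) && e a b.

Lemma reversed_head par v p : reversed par (v :: p) (size (v :: p)) v = 0.
Proof. by rewrite /reversed /= eqxx. Qed.

Lemma reversed_path par r v p w : chain par r v p -> w \in v :: p ->
  exists o, [/\ path (down par (v :: p)) w o, last w o = v, uniq (w :: o),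
     size o <= size p & {subset w :: o <= v :: p}].
Proof.
move=> cv wp; have uv := chain_uniq _ _ _ _ cv.
set pv := v :: p in uv wp *; set k := index w pv.
have kp : k < size pv by rewrite index_mem.
have E : w :: rev (take k pv) = rev (take k.+1 pv).
  by rewrite (take_nth w) // nth_index // rev_rcons.
exists (rev (take k pv)); split.
- have : sorted (down par pv) (w :: rev (take k pv)); last by [].
  rewrite E rev_sorted; apply: take_sorted; apply/(sortedP w) => i ip.
  rewrite /down /reversed index_uniq // ip (set_nth_default w) ?(ltnW ip) // eqxx /=.
  have : sorted (up par) pv by case/and3P: cv.
  by move/(sortedP w)/(_ i ip)/andP => [_]; rewrite e_sym.
- rewrite -[LHS]/(last w (w :: rev (take k pv))) E.
  by rewrite take_cons rev_cons last_rcons.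
- by rewrite E rev_uniq take_uniq.
- by rewrite size_rev size_take; move: kp; rewrite /pv /=; case: ltnP => /=; lia.
- by move=> z; rewrite E mem_rev; exact: mem_take.
Qed.

(** Reversing the pointers from [v] up to the root replaces the search for a common ancestor: from
    [w], the old pointers lead to the chain of [v], and from there the reversed ones lead down to
    [v]. *)
Lemma cycle_path par r v p w q : chain par r v p -> chain par r w q ->
  exists o, [/\ path (down par (v :: p)) w o, last w o = v, uniq (w :: o),
     size o <= size p + size q &
     forall z, z \in w :: o -> (z \in v :: p) || (z \in w :: q)].
Proof.
move=> cv; elim: q w => [|b q IHq] w cw; (have [wp|wp] := boolP (w \in v :: p);
  first by [have [o [po lo uo so mo]] := reversed_path _ _ _ _ _ cv wp; exists o;
     split=> //; [lia | move=> z /mo ->]]).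
  case/negP: wp; have /and3P[_ /eqP /= -> _] := cw.
  by have /and3P[_ /eqP <- _] := cv; exact: mem_last.
move: (cw); rewrite chain_cons => /andP[/andP[/eqP wb ewb] cb].
have [o [po lo uo so mo]] := IHq b cb; exists (b :: o); split=> //=.
- by rewrite po andbT /down /reversed index_mem (negbTE wp) wb eqxx.
- rewrite -/(uniq (b :: o)) uo andbT; apply/negP => /mo; rewrite (negbTE wp) /=.
  by have /andP[/negP] := chain_uniq _ _ _ _ cw.
- lia.
- move=> z; rewrite inE => /orP[/eqP->|/mo /orP[->//|zb]]; first by rewrite mem_head orbT.
  by rewrite [z \in w :: _]inE zb !orbT.
Qed.

(** The tree path from [w] to [v] is closed by the edge between them; it has more than two vertices
    because neither end is the parent of the other. *)
Lemma closing_cycle par r v p w q : chain par r v p -> chain par r w q ->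
  e v w -> par v != name w -> par w != name v ->
  exists o, [/\ path (down par (v :: p)) w o, last w o = v,
     simple_cycle e (w :: o) & size o <= size p + size q].
Proof.
move=> cv cw evw vw wv; have [o [po lo uo so mo]] := cycle_path _ _ _ _ _ _ cv cw.
exists o; split=> //; rewrite /simple_cycle /ucycleb uo andbT; apply/andP; split; last first.
  by rewrite /cycle rcons_path lo evw andbT; apply: sub_path po => a b /andP[].
case: o po lo {uo so mo} => [|b [|c o]] //=.
  by move=> _ wE; rewrite wE e_irr in evw.
rewrite andbT => dwb bv; rewrite bv in dwb => {b bv}.
move: dwb; rewrite /down e_sym evw andbT /reversed.
(* A pointer from [w] to [v] is either an old one, excluded by [wv], or a reversed one, and then [w]
   is the parent of [v]. *)
case: ifP => wp; last by rewrite (negbTE wv).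
case E: (index w (v :: p)) => [|i] //; rewrite name_eq => /eqP iv.
have wp' : w \in v :: p by rewrite -index_mem.
have ip : i.+1 < size (v :: p) by rewrite -E.
have i0 : i = 0.
  have := index_uniq v (ltnW ip) (chain_uniq _ _ _ _ cv).
  by rewrite (set_nth_default w) ?(ltnW ip) //; move: iv; rewrite (set_nth_default v) ?(ltnW ip) // => ->; rewrite /= eqxx.
case: p cv E ip {wp wp' iv} => [|b p]; rewrite i0 // => cv E _.
have bw : b = w.
  by have := nth_index v (s := [:: v, b & p]) (x := w); rewrite E /=; apply; rewrite -index_mem E.
by move: cv vw; rewrite chain_cons => /andP[/andP[/eqP-> _] _]; rewrite bw eqxx.
Qed.

End Trees.

(** * Output of a cycle *)

(** In-place list reversal, with the current vertex in register 31, the previous one in 32 and the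
    saved parent in 33. It stops at the junk parent of the root, the only one above [N]. *)
Definition reverse_body : cmd :=
  CIf (ELt (EReg 31) succN)
    (block [:: CSet 33 (EMem (cell 31)); CStore (cell 31) (EReg 32);
               CSet 32 (EReg 31); CSet 31 (EReg 33)]) CSkip.

Definition print_body : cmd :=
  CIf (EReg 31) (block [:: COutput (EReg 31); CSet 31 (EMem (cell 31))]) CSkip.

Definition cycle_cmd : cmd :=
  block [:: CSet 31 (EReg 21); CSet 32 (EConst 0); for_ 34 11 reverse_body;
            CSet 31 (EReg 22); for_ 34 11 print_body; CReject].

Definition cycle_output N (e : rel 'I_N) (l : nat) (o : seq nat) : Prop :=
  exists s : seq 'I_N, [/\ o = [seq name v | v <- s], simple_cycle e s & size s <= l].

Section Cycle.
Variables (R : realType) (N : nat) (e : rel 'I_N) (W C len : nat) (O : oracle).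
Hypotheses (e_sym : symmetric e) (e_irr : irreflexive e).
Hypotheses (CW : 0 < C < W) (lenC : len <= C).
Local Notation triple := (triple R W O (cycle_output N e len)).

Definition stored (s : store) (par : 'I_N -> nat) : Prop :=
  forall a, ram s (regs s 13 + name a) = par a.

Lemma chain_nth par r v p j : chain N e par r v p -> j < size (v :: p) ->
  par (nth v (v :: p) j) = if j.+1 < size (v :: p) then name (nth v (v :: p) j.+1) else N.+1.
Proof.
elim: p v j => [|b p IHp] v [|j] // cv jp.
- by case/and3P: cv => _ /eqP /= -> /eqP ->.
- by move: cv; rewrite chain_cons => /andP[/andP[/eqP -> _] _].
move: cv; rewrite chain_cons => /andP[_ cb].
have := IHp b j cb jp; rewrite /= (set_nth_default v) // => ->.
by rewrite !ltnS; case: ltnP => // jp'; rewrite (set_nth_default v).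
Qed.

Lemma reversedS par (v : 'I_N) pv j a : uniq pv -> j < size pv ->
  reversed N par pv j.+1 a = if a == nth v pv j then if j is i.+1 then name (nth v pv i) else 0
    else reversed N par pv j a.
Proof.
move=> up jp; rewrite /reversed; case: eqP => [->|ne].
  rewrite index_uniq // ltnSn; case: j jp => // j jp.
  by rewrite (set_nth_default v) // ltnW.
rewrite ltnS leq_eqVlt; case: eqP => //= ij; case: ne.
by rewrite -ij nth_index // -index_mem ij.
Qed.

Lemma cycle_triple base par r v p w q s x Phi : (0 <= x :> R)%R ->
  chain N e par r v p -> chain N e par r w q -> e v w -> par v != name w -> par w != name v ->
  (size p + size q).+1 <= len -> out s = [::] -> base + N.+1 < W ->
  regs s 0 = N -> regs s 11 = C -> regs s 13 = base -> regs s 21 = name v ->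
  regs s 22 = name w -> stored s par ->
  triple cycle_cmd (C * 40 + 40) s x Phi.
Proof.
move=> x0 cv cw evw vw wv pqC out0 bW s0 s11 s13 s21 s22 par_s.
have W1 : 1 < W by lia.
have vN := name_le _ v; have wN := name_le _ w.
have uv := chain_uniq _ _ _ _ _ _ cv.
set pv := v :: p in uv.
have szC : size pv <= C by rewrite /pv /=; lia.
have [o [po lo so szo]] := closing_cycle _ _ e_sym e_irr _ _ _ _ _ _ cv cw evw vw wv.
apply: (@triple_time _ _ _ _ ((C * (10 + 3) + 3) + ((C * (6 + 3) + 3) + 4).+3).+1.+4); first by lia.
rewrite /cycle_cmd.
eapply do_set; [by ev; qlia | qlia | ].
eapply do_set; [by ev; qlia | qlia | ].
set s1 := setr _ 32 0.
pose J1 j s2 := [/\ regs s2 31 = (if j < size pv then name (nth v pv j) else N.+1),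
    regs s2 32 = (if j is i.+1 then name (nth v pv i) else 0) &
    stored s2 (reversed N par pv j)].
(* The loop always runs [C] times and idles once the chain is reversed, hence the minimum. *)
pose I1 j s2 y := [/\ y = x, regs s2 0 = N, regs s2 13 = base, regs s2 22 = name w & out s2 = [::]] /\
  J1 (minn j (size pv)) s2.
apply: (do_cmd _ _ _ _ _ _ _ _ _ _ _ (fun s2 y => regs s2 11 = C /\ I1 C s2 y)).
  apply: (triple_for _ _ _ _ _ _ _ _ _ I1) => //.
  - move=> j s2 y jC r34 r11 [[-> r0 r13 r22 o2]].
    have [jp|jp] := ltnP j (size pv); last first.
      rewrite /J1 ltnn => -[r31 r32 st].
      eapply do_if; first by ev; qlia.
        by lia.
      move=> _; apply: do_nop; split=> //; split=> //.
      have -> : minn j.+1 (size pv) = size pv by lia.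
      by rewrite /J1 ltnn; split.
    rewrite /J1 jp; set a := nth v pv j => -[r31 r32 st].
    have aN := name_le _ a.
    have st_a : ram s2 (base + name a) = if j.+1 < size pv then name (nth v pv j.+1) else N.+1.
      by rewrite -r13 st /reversed /a index_uniq // ltnn (chain_nth _ _ _ _ _ cv).
    have [X EX XW] : exists2 X, (if j.+1 < size pv then name (nth v pv j.+1) else N.+1) = X & X < W.
      have nN := name_le _ (nth v pv j.+1).
      by exists (if j.+1 < size pv then name (nth v pv j.+1) else N.+1) => //; case: ifP; qlia.
    have [Y EY YW] : exists2 Y, (if j is i.+1 then name (nth v pv i) else 0) = Y & Y < W.
      exists (if j is i.+1 then name (nth v pv i) else 0) => //.
      by case: (j) => [|i]; [qlia | have := name_le _ (nth v pv i); qlia].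
    rewrite EX in st_a; rewrite EY in r32.
    eapply do_if; first by ev; qlia.
      move=> _.
      eapply do_set; [by ev; qlia | qlia | ].
      eapply do_store; [by ev; qlia | by ev; qlia | ].
      eapply do_set; [by ev; qlia | qlia | ].
      eapply do_set; [by ev; qlia | qlia | ].
      apply: do_skip; split=> //; split=> //.
      have -> : minn j.+1 (size pv) = j.+1 by lia.
      split=> // b; rewrite /= (reversedS _ v) // -/a /upd /= r13 EY.
      rewrite eqn_add2l name_eq; case: eqP => // _.
      by rewrite -r13 st.
    by lia.
move=> s2 y [r11 [[-> r0 r13 r22 o2]]].
have -> : minn C (size pv) = size pv by lia.
rewrite /J1 ltnn => -[_ _ st].
eapply do_set; [by ev; qlia | qlia | ].
set wo := w :: o in so.
pose I2 j s3 y' := [/\ y' = x, regs s3 13 = base, out s3 = [seq name a | a <- take j wo],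
  regs s3 31 = nth 0 [seq name a | a <- wo] j & stored s3 (reversed N par pv (size pv))].
have wN0 j : nth 0 [seq name a | a <- wo] j <= N.
  by case: (ltnP j (size wo)) => jo; [rewrite (nth_map v) // name_le | rewrite nth_default ?size_map].
have wo_sz : size wo <= len by rewrite /wo /=; lia.
apply: (do_cmd _ _ _ _ _ _ _ _ _ _ _ (fun s3 y' => I2 C s3 y')).
  apply: (triple_for _ _ _ _ _ _ _ _ _ I2) => //.
  move=> j s3 y' jC r34 r11' [-> r13' o3 r31 st'].
  have := wN0 j; have := wN0 j.+1 => jN1 jN.
  eapply do_if_neq0; first by ev; qlia.
    case: (ltnP j (size wo)) => jo; last by rewrite nth_default ?size_map.
    move=> _.
    have E : nth 0 [seq name b | b <- wo] j = name (nth v wo j) by rewrite (nth_map v).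
    have st_j : ram s3 (base + nth 0 [seq name b | b <- wo] j) = nth 0 [seq name b | b <- wo] j.+1.
      rewrite E -r13' st'; have [jo1|jo1] := ltnP j.+1 (size wo).
        have /(pathP v)/(_ j) := po; rewrite -ltnS => /(_ jo1)/andP[/eqP h _].
        by rewrite [RHS](nth_map v) //; exact: h.
      rewrite [RHS]nth_default ?size_map //.
      have -> : nth v wo j = v.
        have -> : j = size o by move: jo jo1; rewrite /wo /=; lia.
        by rewrite /wo -(last_nth v w) lo.
      exact: reversed_head.
    eapply do_output; first by ev; qlia.
    eapply do_set; [by ev; qlia | qlia | ].
    apply: do_skip; split=> //; split=> //.
    by rewrite [out _]/= o3 E (take_nth v) // map_rcons.
  move=> z0; apply: do_nop; split=> //; split=> //.
    rewrite o3; have jo : size wo <= j.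
      by rewrite leqNgt; apply/negP => jo; move: z0; rewrite (nth_map v).
    by rewrite !take_oversize // ltnW.
  rewrite r31 z0; have jo : size wo <= j.
    by rewrite leqNgt; apply/negP => jo; move: z0; rewrite (nth_map v).
  by rewrite nth_default // size_map ltnW.
move=> s3 y' [-> _ o3 _ _].
eapply (do_cmd _ _ _ _ _ _ 1 2 _ _ _ (fun _ _ => False)); last by [].
apply: triple_reject => //; rewrite o3 take_oversize; last by lia.
by exists wo.
Qed.

End Cycle.

(** * Walks *)

Definition move_cmd : cmd :=
  CIf (ELt (EReg 6) (EReg 25))
    (block [:: CSet 29 (EMem (cell 22));
      CIf (EReg 29) (CIf (EEq (EReg 29) (EReg 21)) (CSet 21 (EReg 22)) cycle_cmd)
        (block [:: CStore (cell 22) (EReg 21); CSet 21 (EReg 22)])])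
    CSkip.

(** The walk does not store its previous vertex: it is the parent of the current one. *)
Definition try_cmd : cmd :=
  block [:: CDegree 26 (EReg 21); CRandom 26 (ESub (EReg 26) (EConst 1));
    CSet 26 (EAdd (EReg 26) (EConst 1)); CNeighbor 22 (EReg 21) (EReg 26);
    CSet 23 (EMem (cell 21));
    CIf (EEq (EReg 22) (EReg 23)) CSkip (block [:: live_cmd; move_cmd])].

Definition walks_cmd : cmd :=
  for_ 17 7 (block [:: CSet 21 (EReg 20); for_ 18 5 try_cmd]).

Definition scratch : seq nat := 17 :: 18 :: iota 21 14.

Lemma mem_scratch x : (x \in scratch) = [|| x == 17, x == 18 | 21 <= x < 35].
Proof. by rewrite /scratch !inE; apply/idP/idP; lia. Qed.

Definition loops (s : store) := (regs s 17, regs s 18).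

Section Walking.
Variables (R : realType) (N : nat) (e : rel 'I_N) (W A B F C K : nat).
Variables (g : incidence_lists N) (nb : 'I_N -> seq 'I_N).
Hypotheses (e_sym : symmetric e) (e_irr : irreflexive e).
Hypotheses (nb_uniq : forall v, uniq (nb v)) (nb_mem : forall v u, (u \in nb v) = e v u).
Hypothesis nb_g : forall v (i : 'I_N.-1), g v i = nth 0 [seq name u | u <- nb v] i :> nat.
Hypotheses (NW : N.+1 * N.+1 < W) (BW : B.+2 < W) (FW : F < W) (BF : 3 * B < F).
Hypotheses (AW : 0 < A < W) (CW : 0 < C < W) (KW : 0 < K < W) (AC : 2 * A.+2 <= C).
Let O := graph_oracle g e.
Let len := 2 * A.+2.
Local Notation triple := (triple R W O (cycle_output N e len)).
Local Notation live := (live N e B).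
Local Notation walk := (walk R N e B).

Lemma sum_nb v (f : 'I_N -> R) :
  (\sum_(i < size (nb v)) f (nth v (nb v) i) = \sum_(w | e v w) f w)%R.
Proof.
rewrite -(big_mkord xpredT (fun i => f (nth v (nb v) i))) -(big_nth v xpredT).
rewrite -[RHS]big_filter; apply: perm_big; apply: uniq_perm => //.
  by rewrite filter_uniq // index_enum_uniq.
by move=> w; rewrite mem_filter mem_index_enum andbT nb_mem.
Qed.

Variables (s0 : store) (base : nat) (r v0 : 'I_N).
Hypotheses (s0_0 : regs s0 0 = N) (s0_5 : regs s0 5 = A) (s0_6 : regs s0 6 = B).
Hypotheses (s0_7 : regs s0 7 = K) (s0_10 : regs s0 10 = F) (s0_11 : regs s0 11 = C).
Hypotheses (s0_13 : regs s0 13 = base) (s0_20 : regs s0 20 = name v0).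
Hypotheses (baseW : base + N.+1 < W) (Bbase : B < base).

(** A vertex enters the tree below the end of the current walk, whence the bound on its chain [q],
    and through it on the length of the cycles. *)
Definition walking (par : 'I_N -> nat) (s : store) : Prop :=
  [/\ forall x, x \notin scratch -> regs s x = regs s0 x, out s = [::],
      forall a, base + N < a -> ram s a = ram s0 a, stored N s par &
      forall a, par a != 0 -> exists2 q, chain N e par r a q & size q < A.+2].

Definition rooted (par : 'I_N -> nat) (p : seq 'I_N) : Prop :=
  exists a q, p = a :: q /\ chain N e par r a q.

Definition at_path (par : 'I_N -> nat) (n : nat) (p : seq 'I_N) (P : seq (seq 'I_N)) (s : store) : Prop :=
  [/\ walking par s, size p + n <= A.+2,
      exists v u q, p = [:: v, u & q] /\ regs s 21 = name v &
      forall p', p' \in p :: P -> rooted par p'].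

Lemma walking_reg par s s' : walking par s ->
  (forall x, x \notin scratch -> regs s' x = regs s x) ->
  (forall a, B < a -> ram s' a = ram s a) -> out s' = out s -> walking par s'.
Proof.
move=> [k1 o1 m1 st ti] kr km ko; split=> //; first by move=> x xs; rewrite kr ?k1.
- by rewrite ko.
- by move=> a ba; rewrite km ?m1 //; lia.
- have b13 : regs s 13 = base by rewrite k1.
  move=> a; rewrite -st kr // km // b13; lia.
Qed.

Lemma par_lt par s a : walking par s -> par a <= N.+1.
Proof.
case=> _ _ _ _ ti; case: (eqVneq (par a) 0) => [-> //|/ti[q]].
case: q => [|b q] + _; first by case/and3P => _ /eqP /= -> /eqP ->.
by rewrite chain_cons => /andP[/andP[/eqP -> _] _]; apply: leqW; exact: name_le.
Qed.

Definition try_time : nat := F * 22 + C * 40 + 100.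

(** Each coin selects one neighbor, and the promise after the try is the corresponding summand of
    [walk n.+1 p G]. The exception is a contradicting edge, where the rejection fulfils any
    promise. *)
Lemma try_triple par n p P s (G : seq 'I_N -> R) :
  (forall q, 0 <= G q)%R -> at_path par n.+1 p P s ->
  triple try_cmd try_time s (walk n.+1 p G)
    (fun s' y => exists par' p', y = walk n p' G /\ at_path par' n p' P s' /\
       loops s' = loops s).
Proof.
move=> G0 [ws sz [v [u [q [Ep r21]]]] rt]; have W1 : 1 < W by lia.
have [ks os ms st ti] := ws.
have cv : chain N e par r v (u :: q).
  by have [a [q' [+ c]]] := rt p (mem_head _ _); rewrite Ep => -[-> ->].
have evu : e v u by move: cv; rewrite chain_cons => /andP[/andP[]].
have pvu : par v = name u by move: cv; rewrite chain_cons => /andP[/andP[/eqP]].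
have szn : size (nb v) = deg N e v by apply: size_nbE.
have dv : 0 < deg N e v by rewrite -szn; move: (nb_mem v u); rewrite evu; case: (nb v).
have dN : deg N e v <= N.
  by rewrite -szn; apply: leq_trans (size_nb _ _ _ e_irr nb_uniq nb_mem v) _; exact: leq_pred.
have vN := name_le _ v; have uN := name_le _ u.
have r13 : regs s 13 = base by rewrite ks.
have r0 : regs s 0 = N by rewrite ks.
have r6 : regs s 6 = B by rewrite ks.
have r10 : regs s 10 = F by rewrite ks.
have r11 : regs s 11 = C by rewrite ks.
pose f coin := let w := nth v (nb v) coin in
  walk n (if (w != u) && live v w then w :: p else p) G.
pose X := ((F * 22 + 20) + ((C * 40 + 60) + 1).+1).+2.
apply: (@triple_time _ _ _ _ (1 + (X + 1).+1.+4.+2).+1.+2).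
  by rewrite /try_time /X; lia.
rewrite /try_cmd.
eapply (do_degree _ _ _ _ 26 _ _ _ (deg N e v)); [by ev; qlia | exact: query_deg | qlia | ].
set s1 := setr s 26 _.
apply: (do_cmd _ _ _ _ _ _ 1 _ _ _ _ (fun s' y => exists2 coin, coin < deg N e v &
    s' = setr s1 26 coin /\ y = f coin)).
  have E : eval W s1 (ESub (EReg 26) (EConst 1)) = (deg N e v).-1 by rewrite -subn1; ev; qlia.
  apply: (triple_random _ _ _ _ _ _ _ _ f); rewrite E.
    move=> coin cd; exists coin; first by lia.
    by rewrite set_regE //; lia.
  rewrite prednK //.
  have -> : (\sum_(coin < deg N e v) f coin = \sum_(w | e v w)
      walk n (if (w != u) && live v w then w :: p else p) G)%R.
    rewrite -szn.
    exact: (sum_nb v (fun w => walk n (if (w != u) && live v w then w :: p else p) G)).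
  by rewrite Ep.
move=> _ _ [coin cd [-> ->]].
set w := nth v (nb v) coin in f *.
have evw : e v w by rewrite -nb_mem mem_nth // szn.
have wN := name_le _ w.
eapply do_set; [by ev; qlia | qlia | ].
eapply (do_neighbor _ _ _ _ 22 _ _ _ _ _ (name w)); [by ev; qlia | by ev; qlia | | qlia | ].
  by rewrite addn1 (query_nb _ _ _ _ e_irr nb_uniq nb_mem nb_g) (nth_map v) // szn.
have stv : ram s (base + name v) = name u by rewrite -r13 st.
eapply do_set; [by ev; qlia | qlia | ].
set s2 := setr _ 23 _.
have w2 : walking par s2.
  apply: (walking_reg par s) => // x; rewrite mem_scratch => xs.
  by rewrite /= /upd; do !case: eqP => //; lia.
have stay s3 par' p' : walking par' s3 -> loops s3 = loops s ->
    size p' + n <= A.+2 -> (exists v' u' q', p' = [:: v', u' & q'] /\ regs s3 21 = name v') ->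
    (forall p1, p1 \in p' :: P -> rooted par' p1) ->
    walk n p' G = f coin ->
    exists par' p', f coin = walk n p' G /\ at_path par' n p' P s3 /\ loops s3 = loops s.
  by move=> *; exists par', p'; split=> //; split.
apply: (do_cmd _ _ _ _ _ _ X 1); last first.
  by move=> s' y H; apply: do_skip; exact: H.
eapply do_if; first by ev; qlia.
  rewrite name_eq => /eqP wu; apply: do_nop; apply: (stay _ par p) => //.
  - by lia.
  - by exists v, u, q.
  - by rewrite /f -/w wu eqxx.
rewrite name_eq => wu.
apply: (do_cmd _ _ _ _ _ _ _ _ _ _ _ (fun s' y => [/\ y = f coin, keeps (iota 24 7) B.+1 s2 s',
    regs s' 25 <= B.+1 & (B < regs s' 25) = live v w])).
  by apply: (bfs_triple R N e W B F g _ nb).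
move=> s3 _ [-> [k3 m3 o3] b3 l3].
have w3 : walking par s3.
  apply: (walking_reg par s2) => // x xs; apply: k3; apply: contra xs.
  by rewrite mem_scratch mem_iota; lia.
have r3_18 : loops s3 = loops s by rewrite /loops !k3.
have r3_21 : regs s3 21 = name v by rewrite k3.
have r3_22 : regs s3 22 = name w by rewrite k3.
have [ks3 os3 ms3 st3 ti3] := w3.
have r3_0 : regs s3 0 = N by rewrite ks3.
have r3_6 : regs s3 6 = B by rewrite ks3.
have r3_11 : regs s3 11 = C by rewrite ks3.
have r3_13 : regs s3 13 = base by rewrite ks3.
apply: (do_cmd _ _ _ _ _ _ (C * 40 + 60) 1); last first.
  by move=> s' y H; apply: do_skip; exact: H.
apply: (@triple_time _ _ _ _ ((C * 40 + 40).+3 + 1).+1.+2.+1); first by lia.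
rewrite /move_cmd; eapply do_if; first by ev; qlia.
  rewrite l3 => lvw.
  have pw := par_lt par s3 w w3.
  have stw : ram s3 (base + name w) = par w by rewrite -r3_13 st3.
  eapply do_set; [by ev; qlia | qlia | ].
  set s4 := setr s3 29 _.
  have w4 : walking par s4.
    apply: (walking_reg par s3) => // x; rewrite mem_scratch => xs.
    by rewrite /= /upd; do !case: eqP => //; lia.
  have mw par' s5 : walking par' s5 -> loops s5 = loops s -> regs s5 21 = name w ->
      (forall p1, p1 \in p :: P -> rooted par' p1) -> up N e par' w v ->
      exists par' p', f coin = walk n p' G /\ at_path par' n p' P s5 /\ loops s5 = loops s.
    move=> w5 r18 r21' rt' ua; apply: (stay s5 par' (w :: p)) => //.
    - by rewrite /=; lia.
    - by exists w, v, (u :: q); rewrite Ep.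
    - move=> p1; rewrite inE => /orP[/eqP->|p1P]; last by apply: rt'; rewrite inE p1P orbT.
      exists w, p; split=> //; have [a [q1 [+ c]]] := rt' p (mem_head _ _).
      by rewrite Ep => -[ea eq]; rewrite -ea -eq in c; rewrite chain_cons ua c.
    - by rewrite /f -/w wu lvw.
  apply: (do_cmd _ _ _ _ _ _ (C * 40 + 40).+3 1); last first.
    by move=> s' y H; apply: do_skip; exact: H.
  eapply do_if_neq0; first by ev; qlia.
    move=> pw0; eapply do_if; first by ev; qlia.
      move=> /eqP pwv; apply: (triple_time _ _ _ _ 1); first by lia.
      apply: triple_set; rewrite (_ : eval _ _ _ = name w); last by ev; qlia.
      rewrite set_regE; last by qlia.
      apply: (mw par) => //.
        apply: (walking_reg par s4) => // x; rewrite mem_scratch => xs.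
        by rewrite /= /upd; case: eqP => //; lia.
      by rewrite /up pwv eqxx e_sym.
    move=> /eqP pwv.
    have [q' cw sq'] := ti w pw0.
    apply: (@triple_time _ _ _ _ (C * 40 + 40)); first by lia.
    have [k4 o4 _ st4 _] := w4.
    apply: (cycle_triple R N e W C len O e_sym e_irr CW AC base par r v (u :: q) w q') => //.
    - by apply: walk_ge0.
    - by rewrite pvu name_eq eq_sym.
    - by apply/eqP.
    - by move: sz; rewrite Ep /len /=; lia.
  move=> pw0.
  pose par' b := if b == w then name v else par b.
  have par'P b : par b != 0 -> par' b = par b.
    by rewrite /par'; case: (eqVneq b w) => // ->; rewrite pw0.
  have rt' p1 : p1 \in p :: P -> rooted par' p1.
    by move=> /rt[a [q1 [-> c]]]; exists a, q1; split=> //; exact: chain_upd c.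
  have uw : up N e par' w v by rewrite /up /par' eqxx eqxx e_sym.
  apply: (@triple_time _ _ _ _ 5); first by lia.
  eapply do_store; [by ev; qlia | by ev; qlia | ].
  eapply do_set; [by ev; qlia | qlia | ].
  apply: do_skip; apply: (mw par') => //.
  have [k4 o4 m4 st4 ti4] := w4.
  split=> //.
  - move=> x xs; rewrite -k4 //; move: xs; rewrite mem_scratch => xs.
    by rewrite /= /upd; case: eqP => //; lia.
  - move=> a ba; rewrite -m4 //= /upd; case: eqP => //; lia.
  - move=> a; rewrite /= /upd /= r3_13 eqn_add2l name_eq /par'.
    by case: eqP => // _; rewrite -r3_13 st3.
  - move=> a; rewrite {1}/par'; case: (eqVneq a w) => [-> _|_ /ti4[q1 c sq1]].
      exists p; last by lia.
      have [a' [q1 [+ c]]] := rt' p (mem_head _ _).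
      by rewrite Ep => -[ea eq]; rewrite -ea -eq in c; rewrite chain_cons uw c.
    by exists q1 => //; exact: chain_upd c.
rewrite l3 => nlv; apply: do_nop; apply: (stay _ par p) => //.
- by lia.
- by exists v, u, q.
- by rewrite /f -/w (negbTE nlv) andbF.
Qed.

(** A walk that ends without rejecting leaves a trajectory which agrees with the tree, like all the
    earlier ones, and has no conflict by [chain_conflict]. So the promise 0 made for conflicts never
    has to be kept. *)
Lemma walks_triple (z : R) : (0 <= z)%R -> e r v0 -> out s0 = [::] ->
  stored N s0 (fun b => if b == r then N.+1 else if b == v0 then name r else 0) ->
  triple walks_cmd (K * (A * (try_time + 3) + 15) + 3) s0
    (no_conflict R N e B A [:: v0; r] K [::] * z)%R
    (fun s y => y = z /\ exists par, walking par s).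
Proof.
move=> z0 erv os0; set par0 := (fun b => _) => st0.
set p0 := [:: v0; r]; have W1 : 1 < W by lia.
have v0N := name_le _ v0.
have rv : v0 != r by apply: contraTneq erv => ->; rewrite e_irr.
have c0 : chain N e par0 r r [::] by rewrite /chain /par0 /= !eqxx.
have c1 : chain N e par0 r v0 [:: r].
  by rewrite chain_cons c0 andbT /up /par0 (negbTE rv) !eqxx e_sym.
have w0 : walking par0 s0.
  split=> // a; rewrite /par0; case: (eqVneq a r) => [-> _|ar]; first by exists [::].
  by case: (eqVneq a v0) => // -> _; exists [:: r].
pose G j P p : R := ((if conflict N p P then 0 else no_conflict R N e B A p0 j (p :: P)) * z)%R.
have G0 j P p : (0 <= G j P p)%R.
  rewrite /G; case: ifP => _; first by rewrite mul0r.
  by rewrite mulr_ge0 // no_conflict_ge0.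
pose I j s y := exists par P, [/\ y = (no_conflict R N e B A p0 (K - j) P * z)%R, walking par s &
   forall p, p \in p0 :: P -> rooted par p].
apply: (@triple_time _ _ _ _ (K * ((A * (try_time + 3) + 3 + 1).+1.+2 + 3) + 3)); first by lia.
apply: (triple_for _ _ _ _ _ _ _ _ _ I) => //.
- move=> j s y x [par [P [-> ws rt]]]; exists par, P; split=> //.
  apply: (walking_reg par s) => // x'; rewrite mem_scratch /= => xs.
  by rewrite /upd; case: eqP => //; lia.
- exists par0, [::]; rewrite subn0; split=> // p; rewrite inE => /eqP->.
  by exists v0, [:: r].
- move=> j s y jK r17 r7 [par [P [-> ws rt]]].
  have [ks _ _ _ _] := ws.
  have r20 : regs s 20 = name v0 by rewrite ks.
  eapply do_set; [by ev; qlia | qlia | ].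
  set s1 := setr s 21 _.
  have w1 : walking par s1.
    apply: (walking_reg par s) => // x'; rewrite mem_scratch /= => xs.
    by rewrite /upd; case: eqP => //; lia.
  pose I' i s' y' := exists par' p, [/\ y' = walk (A - i) p (G (K - j.+1) P),
     at_path par' (A - i) p (p0 :: P) s' & regs s' 17 = j].
  apply: (do_cmd _ _ _ _ _ _ _ _ _ _ _ (fun s' y' => I' A s' y')); last first.
    move=> s' y' [par' [p [-> [w' _ _ rt'] r17']]]; apply: do_skip; split=> //.
      by have [k' _ _ _ _] := w'; rewrite k'.
    exists par', (p :: P); split=> //; last first.
      by move=> p1; rewrite !inE orbCA -!in_cons; exact: rt'.
    have rt1 p1 : p1 \in p :: P -> rooted par' p1.
      by move=> p1P; apply: rt'; move: p1P; rewrite !inE => /orP[->//|->]; rewrite !orbT.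
    by rewrite subnn /= /G (negbTE (chain_conflict N e par' r _ _ rt1)).
  apply: (triple_for _ _ _ _ _ _ _ _ _ I') => //.
  + have [k1 _ _ _ _] := w1; by rewrite k1.
  + move=> i s' y' x [par' [p [-> [w' sz [v [u [q [Ep r21]]]] rt'] r17']]].
    exists par', p; split=> //; split=> //; last by exists v, u, q.
    apply: (walking_reg par' s') => // x'; rewrite mem_scratch /= => xs.
    by rewrite /upd; case: eqP => //; lia.
  + exists par, p0; rewrite subn0; split=> //; last first.
      split=> //; first by exists v0, r, [::].
      by move=> p; rewrite !inE => /orP[/eqP->|h]; apply: rt; rewrite ?mem_head // inE.
    rewrite (_ : K - j = (K - j.+1).+1) /=; last by lia.
    by rewrite mulrC -walkZ; apply: walk_ext => q; rewrite /G mulrC.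
  + move=> i s' y' iA r18 r5 [par' [p [-> atp r17']]].
    rewrite (_ : A - i = (A - i.+1).+1) in atp *; last by lia.
    apply: (triple_post _ _ _ _ _ _ _ _ _ _ _ (try_triple _ _ _ _ _ _ _ atp)) => //.
    move=> s2 y2 [par2 [p2 [-> [at2 [r17_2 r18_2]]]]].
    have [[k2 _ _ _ _] _ _ _] := at2.
    split; [by rewrite r18_2 | by rewrite k2 | exists par2, p2; split=> //].
    by rewrite r17_2.
move=> s y r7 [par [P [-> ws _]]]; rewrite subnn /= mul1r; split=> //.
by exists par.
Qed.

End Walking.

(** * Trials *)

(** The coin in register 35 orients the edge: an edge may be within reach from only one of its ends,
    while either of its arcs may be the useful one. *)
Definition sample_body : cmd :=
  CIf (EReg 19) CSkip
    (block [:: CRandom 21 (ESub (EReg 0) (EConst 1)); CSet 21 (EAdd (EReg 21) (EConst 1));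
       CRandom 26 (ESub (EReg 12) (EConst 1)); CSet 26 (EAdd (EReg 26) (EConst 1));
       CNeighbor 22 (EReg 21) (EReg 26);
       CIf (EReg 22)
         (block [:: CRandom 35 (EConst 1);
            CIf (EReg 35) (block [:: CSet 19 (EReg 21); CSet 20 (EReg 22)])
                          (block [:: CSet 19 (EReg 22); CSet 20 (EReg 21)])])
         CSkip]).

(** Advancing the base by [N + 1] provides fresh zero cells for the parents; clearing the old ones
    would take time linear in [N]. *)
Definition trial_cmd : cmd :=
  block [:: CSet 13 (EAdd (EReg 13) succN); CSet 19 (EConst 0); for_ 16 8 sample_body;
    CIf (EReg 19)
      (block [:: CStore (cell 19) succN; CStore (cell 20) (EReg 19); walks_cmd]) CSkip].

Definition trial_regs : seq nat := 13 :: 35 :: iota 16 19.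

Lemma mem_trial x : (x \in trial_regs) = (x == 13) || (16 <= x < 36).
Proof. by rewrite /trial_regs !inE; apply/idP/idP; lia. Qed.

Section Trial.
Variables (R : realType) (N : nat) (e : rel 'I_N) (W A B F C K M : nat).
Variables (g : incidence_lists N) (nb : 'I_N -> seq 'I_N).
Hypotheses (e_sym : symmetric e) (e_irr : irreflexive e).
Hypotheses (nb_uniq : forall v, uniq (nb v)) (nb_mem : forall v u, (u \in nb v) = e v u).
Hypothesis nb_g : forall v (i : 'I_N.-1), g v i = nth 0 [seq name u | u <- nb v] i :> nat.
Hypotheses (NW : N.+1 * N.+1 < W) (BW : B.+2 < W) (FW : F < W) (BF : 3 * B < F).
Hypotheses (AW : 0 < A < W) (CW : 0 < C < W) (KW : 0 < K < W) (AC : 2 * A.+2 <= C).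
Hypotheses (MW : 0 < M < W) (N0 : 0 < N).
Let O := graph_oracle g e.
Let len := 2 * A.+2.
Local Notation triple := (triple R W O (cycle_output N e len)).

Definition miss (r v0 : 'I_N) : R := no_conflict R N e B A [:: v0; r] K [::].

Definition attempt (y : R) (u : 'I_N) (i : nat) : R :=
  if i < size (nb u) then
    let w := nth u (nb u) i in ((miss w u + miss u w) / 2%:R)%R
  else y.

(** The promise of a trial with [n] sampling attempts left. Without a starting arc the trial does
    nothing, hence the value 1. *)
Fixpoint trial_miss (th n : nat) : R :=
  if n is n'.+1 then
    ((\sum_(u < N) (\sum_(i < th) attempt (trial_miss th n') u i) / th%:R) / N%:R)%R
  else 1%R.

Definition walks_time : nat := K * (A * (try_time F C + 3) + 15) + 3.

Variables (th : nat).
Hypothesis thW : 0 < th < W.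

Section Sampling.
Variable s0 : store.
Hypotheses (s0_0 : regs s0 0 = N) (s0_8 : regs s0 8 = M) (s0_12 : regs s0 12 = th).

(** The factor [z] is what is promised after the trial; promises of successive trials multiply. *)
Definition sampling (z : R) (n : nat) (s : store) (y : R) : Prop :=
  [/\ forall x, x \notin trial_regs \/ x = 13 -> regs s x = regs s0 x, ram s = ram s0, out s = out s0 &
      (regs s 19 = 0 /\ y = (trial_miss th n * z)%R) \/
      exists u v, [/\ e u v, regs s 19 = name u, regs s 20 = name v & y = (miss u v * z)%R]].

Lemma sampling_frame z n s y s' : sampling z n s y ->
  (forall x, x \notin trial_regs \/ x \in [:: 13; 19; 20] -> regs s' x = regs s x) -> ram s' = ram s -> out s' = out s ->
  sampling z n s' y.
Proof.
move=> [k1 m1 o1 st] kr km ko; split.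
- move=> x xs; rewrite -k1 // kr //; case: xs => [xs|->]; by [left | right].
- by rewrite km.
- by rewrite ko.
- by rewrite !kr //; right.
Qed.

Lemma sample_triple z n s y : sampling z n.+1 s y ->
  triple sample_body 24 s y (fun s' y' => sampling z n s' y' /\ regs s' 16 = regs s 16).
Proof.
move=> sam; have W1 : 1 < W by lia.
have [k1 m1 o1 st] := sam.
have r0 : regs s 0 = N by rewrite k1 //; left.
have r12 : regs s 12 = th by rewrite k1 //; left.
eapply (do_if_neq0 _ _ _ _ _ _ _ _ _ _ _ (regs s 19)).
- ev; case: st => [[-> _]|[u [v [_ -> _ _]]]]; last have := name_le _ u; lia.
- move=> n0; apply: do_nop; split=> //; split=> //.
  by case: st => [[E]|st]; [rewrite E in n0 | right].
move=> r19; case: st => [[_ ->]|[u [v [_ E]]]]; last by rewrite E in r19.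
pose avg u := ((\sum_(i < th) attempt (trial_miss th n) u i) / th%:R * z)%R.
apply: (do_cmd _ _ _ _ _ _ 1 21 _ _ _ (fun s' y => exists2 u : 'I_N, s' = setr s 21 u & y = avg u)).
  have E : eval W s (ESub (EReg 0) (EConst 1)) = N.-1 by rewrite -subn1; ev; qlia.
  apply: (triple_random _ _ _ _ _ _ _ _ (fun coin => avg (odflt (Ordinal N0) (insub coin)))); rewrite E.
    move=> coin cN; have cN' : coin < N by lia.
    by exists (Ordinal cN'); rewrite ?insubT //= set_regE //; lia.
  rewrite prednK //.
  have ins (u : 'I_N) : odflt (Ordinal N0) (insub (nat_of_ord u)) = u.
    exact: (congr1 (odflt _) (valK u)).
  rewrite (eq_bigr avg); last by move=> u _; rewrite ins.
  by rewrite /avg -mulr_suml mulrAC.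
move=> _ _ [u -> ->].
have uN := ltn_ord u; have uN1 := name_le _ u.
eapply (do_set _ _ _ _ 21 _ _ (name u)); [by rewrite (_ : name u = u + 1); [ev; qlia | rewrite addn1] | qlia | ].
set s1 := setr _ 21 _.
pose out1 (i : nat) : R := (attempt (trial_miss th n) u i * z)%R.
apply: (do_cmd _ _ _ _ _ _ 1 17 _ _ _ (fun s' y => exists2 i, i < th & s' = setr s1 26 i /\ y = out1 i)).
  have E : eval W s1 (ESub (EReg 12) (EConst 1)) = th.-1 by rewrite -subn1; ev; qlia.
  apply: (triple_random _ _ _ _ _ _ _ _ out1); rewrite E.
    move=> i ith; exists i; first by lia.
    by rewrite set_regE //; lia.
  rewrite prednK; last by lia.
  by rewrite /avg /out1 -mulr_suml mulrAC.
move=> _ _ [i ith [-> ->]].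
eapply do_set; [by ev; qlia | qlia | ].
have yN := query_nb_lt N nb u i.
eapply (do_neighbor _ _ _ _ 22 _ _ _ _ _ (nth 0 [seq name w | w <- nb u] i)); [by ev; qlia | by ev; qlia | | qlia | ].
  by rewrite [(i + 1)%N]addn1 (query_nb _ _ _ _ e_irr nb_uniq nb_mem nb_g).
set s2 := setr _ 22 _.
have fr s' : (forall x, x \notin trial_regs \/ x \in [:: 13; 16] -> regs s' x = regs s2 x) ->
    ram s' = ram s -> out s' = out s -> forall y, 
    (regs s' 19 = 0 /\ y = (trial_miss th n * z)%R) \/
      (exists u v, [/\ e u v, regs s' 19 = name u, regs s' 20 = name v & y = (miss u v * z)%R]) ->
    sampling z n s' y /\ regs s' 16 = regs s 16.
  move=> kr km ko y' st; split; last by rewrite kr //; right.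
  split=> //; last first.
  - by rewrite ko.
  - by rewrite km.
  move=> x xs; rewrite -k1 // kr; last by case: xs => [xs|->]; [left | right].
  have : x \notin [:: 21; 22; 26].
    by case: xs => [|->] //; rewrite mem_trial !inE; lia.
  rewrite !inE /s2 /= /upd; do !case: eqP => //; lia.
apply: (do_cmd _ _ _ _ _ _ 11 1); last by move=> s' y' H; apply: do_skip; exact: H.
eapply do_if_neq0; first by ev; qlia.
  case: (ltnP i (size (nb u))) => iu; last by rewrite nth_default ?size_map.
  move=> _; set w := nth u (nb u) i.
  have euw : e u w by rewrite -nb_mem mem_nth.
  have wN := name_le _ w.
  have s2w : regs s2 22 = name w by rewrite /= /upd /= (nth_map u).
  pose out2 coin : R := ((if coin == 0%N then miss w u else miss u w) * z)%R.
  apply: (do_cmd _ _ _ _ _ _ 1 8 _ _ _ (fun s' y => exists2 coin, coin < 2 & s' = setr s2 35 coin /\ y = out2 coin)).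
    have E : eval W s2 (EConst 1) = 1 by ev.
    apply: (triple_random _ _ _ _ _ _ _ _ out2); rewrite E.
      by move=> coin c1; exists coin => //; rewrite set_regE //; lia.
    by rewrite big_ord_recl big_ord1 /out2 /= /out1 /attempt iu -/w -mulrDl mulrAC.
  move=> _ _ [coin c2 [-> ->]].
  apply: (do_cmd _ _ _ _ _ _ 6 1); last by move=> s' y' H; apply: do_skip; exact: H.
  eapply do_if_neq0; first by ev; qlia.
    move=> c0; eapply do_set; [by ev; qlia | qlia | ].
    eapply do_set; [by ev; qlia | qlia | ].
    apply: do_skip; apply: fr => //.
      by move=> x [|]; rewrite ?mem_trial ?inE /= /upd => xs; do !case: eqP => //; lia.
    by right; exists u, w; split=> //; rewrite /out2 (negbTE c0).
  move=> c0; eapply do_set; [by ev; qlia | qlia | ].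
  eapply do_set; [by ev; qlia | qlia | ].
  apply: do_skip; apply: fr => //.
    by move=> x [|]; rewrite ?mem_trial ?inE /= /upd => xs; do !case: eqP => //; lia.
  by right; exists w, u; split=> //; [rewrite e_sym | rewrite /out2 c0].
case: (ltnP i (size (nb u))) => iu; first by rewrite (nth_map u).
move=> _; apply: do_nop; apply: fr => //; left; split=> //.
by rewrite /out1 /attempt ltnNge iu.
Qed.

End Sampling.
Definition trial_time : nat := M * 27 + walks_time + 30.

Lemma trial_triple (z : R) s base : (0 <= z)%R ->
  regs s 0 = N -> regs s 5 = A -> regs s 6 = B -> regs s 7 = K -> regs s 8 = M ->
  regs s 10 = F -> regs s 11 = C -> regs s 12 = th -> regs s 13 = base ->
  B < base -> base + (N.+1 + N.+1) < W -> out s = [::] ->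
  (forall a, base + N < a -> ram s a = 0) ->
  triple trial_cmd trial_time s (trial_miss th M * z)%R
    (fun s' y => [/\ y = z, forall x, x \notin trial_regs -> regs s' x = regs s x,
       regs s' 13 = base + N.+1, out s' = [::] &
       forall a, base + N.+1 + N < a -> ram s' a = 0]).
Proof.
move=> z0 r0 r5 r6 r7 r8 r10 r11 r12 r13 Bb bW os zero; have W1 : 1 < W by lia.
apply: (@triple_time _ _ _ _ ((M * (24 + 3) + 3) + ((walks_time + 1).+1.+4.+1 + 1).+1).+1.+4).
  by rewrite /trial_time; lia.
rewrite /trial_cmd.
eapply (do_set _ _ _ _ 13 _ _ (base + N.+1)); [by rewrite -[N.+1]addn1; ev; qlia | qlia | ].
eapply do_set; [by ev; qlia | qlia | ].
set s1 := setr _ 19 _.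
apply: (do_cmd _ _ _ _ _ _ _ _ _ _ _ (fun s' y => sampling s1 z 0 s' y)).
  apply: (triple_for _ _ _ _ _ _ _ _ _ (fun i s' y => sampling s1 z (M - i) s' y)) => //.
  - move=> i s' y v sam; apply: (sampling_frame _ _ _ _ _ _ sam) => // x.
    by rewrite mem_trial !inE /= /upd; case: (eqVneq x 16) => // -> [].
  - by rewrite subn0; split=> //; left.
  - move=> i s' y iM r16 r8' sam.
    rewrite (_ : M - i = (M - i.+1).+1) in sam; last by lia.
    apply: (triple_post _ _ _ _ _ _ _ _ _ _ _ (sample_triple s1 _ _ _ _ _ _ _ sam)) => //.
    by move=> s2 y2 [sam2 ->]; split=> //; have [k2 _ _ _] := sam2; rewrite k2 //; left.
  - by move=> s' y _; rewrite subnn.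
move=> s2 y [k2 m2 o2 st].
have k2' x : x \notin trial_regs -> regs s2 x = regs s x.
  by move=> xs; rewrite k2; [rewrite /s1 /= /upd; move: xs; rewrite mem_trial; do !case: eqP => //; lia | left].
have q13 : regs s2 13 = base + N.+1 by rewrite k2 //; right.
have q0 : regs s2 0 = N by rewrite k2'.
eapply (do_cmd _ _ _ _ _ _ (walks_time + 1).+1.+4.+1 1); last first.
  by move=> s' y' H; apply: do_skip; exact: H.
eapply (do_if_neq0 _ _ _ _ _ _ _ _ _ _ _ (regs s2 19)).
- ev; case: st => [[-> _]|[u [v [_ -> _ _]]]]; last have := name_le _ u; lia.
- move=> n0; case: st => [[E]|[u [v [euv r19 r20 ->]]]]; first by rewrite E in n0.
  have uN := name_le _ u; have vN := name_le _ v.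
  eapply do_store; [by ev; qlia | by ev; qlia | ].
  eapply do_store; [by ev; qlia | by ev; qlia | ].
  set s3 := setm _ _ _.
  apply: (do_cmd _ _ _ _ _ _ walks_time 1 _ _ _ (fun s' y' => y' = z /\
     exists par, walking N e A s3 (base + N.+1) u par s')).
    apply: (walks_triple R N e W A B F C K g nb _ _ _ _ _ _ _ _ _ _ _ _ _ s3 (base + N.+1)) => //.
    + exact: etrans (k2' 5 isT) r5.
    + exact: etrans (k2' 6 isT) r6.
    + exact: etrans (k2' 7 isT) r7.
    + exact: etrans (k2' 10 isT) r10.
    + exact: etrans (k2' 11 isT) r11.
    + by rewrite -addnA.
    + lia.
    + by rewrite /s3 /= o2.
    move=> b; rewrite /s3 /= q13 /upd !eqn_add2l !name_eq m2 /=.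
    have uv : u != v by apply: contraTneq euv => ->; rewrite e_irr.
    case: (eqVneq b v) => [->|bv]; first by rewrite eq_sym (negbTE uv).
    by case: (eqVneq b u) => _; rewrite ?addn1 // zero //; have := ltn0Sn (val b); rewrite -/(name b); lia.
  move=> s4 y4 [-> [par [k4 o4 m4 _ _]]]; apply: do_skip; split=> //.
  + move=> x xs; rewrite k4; first exact: k2'.
    by move: xs; rewrite mem_trial mem_scratch; lia.
  + by rewrite k4.
  + move=> a ba; rewrite m4 // /s3 /= /upd m2 /= zero; last by lia.
    by do !case: eqP => //; lia.
move=> r19; case: st => [[_ ->]|[u [v [_ E]]]]; last by rewrite E in r19.
apply: do_nop; split=> //; first by rewrite /= mul1r.
- by rewrite o2.
- by move=> a ba; rewrite m2 /= zero //; lia.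
Qed.

End Trial.

(** * The tester *)

Definition incr (r : nat) : cmd := CSet r (EAdd (EReg r) (EConst 1)).

Definition double_cmd : cmd := CSet 12 (EAdd (EReg 12) (EReg 12)).

Definition scales_cmd : cmd := for_ 14 4 (block [:: for_ 15 9 trial_cmd; double_cmd]).

(** In terms of [x] and [sq], the parameters are [A = x ^ 4], [B = x ^ 6], [M = sq * x ^ 6],
    [K = sq * x ^ 9], [T = x ^ 11], [F = x ^ 7] and [C = x ^ 5]. The parents are stored beyond [F],
    away from the cells 0 to [B] of the search. *)
Definition setup (cst : nat) : seq cmd :=
  [:: CSet 3 (EConst 0);
      CWhile (ELt (EMul (EReg 3) (EReg 3)) succN) (incr 3);
      CSet 4 (EConst 1); CSet 12 (EConst 1);
      CWhile (ELt (EReg 12) (EReg 0)) (block [:: double_cmd; incr 4]);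
      CSet 2 (EAdd (EAdd (EReg 4) (EReg 1)) (EConst cst));
      CSet 5 (EMul (EMul (EMul (EReg 2) (EReg 2)) (EReg 2)) (EReg 2));
      CSet 6 (EMul (EMul (EReg 5) (EReg 2)) (EReg 2));
      CSet 8 (EMul (EReg 3) (EReg 6));
      CSet 7 (EMul (EMul (EMul (EReg 8) (EReg 2)) (EReg 2)) (EReg 2));
      CSet 9 (EMul (EMul (EReg 6) (EReg 5)) (EReg 2));
      CSet 10 (EMul (EReg 6) (EReg 2)); CSet 11 (EMul (EReg 5) (EReg 2));
      CSet 12 (EConst 1); CSet 13 (EReg 10)].

Definition tester (cst : nat) : cmd := block (setup cst ++ [:: scales_cmd]).

Lemma sqrt_ex n : exists k, n < k * k.
Proof. by exists n.+1; rewrite mulnS; lia. Qed.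

Definition sqrt_above (n : nat) : nat := ex_minn (sqrt_ex n).

Lemma sqrt_aboveP n : n < sqrt_above n * sqrt_above n.
Proof. by rewrite /sqrt_above; case: ex_minnP. Qed.

Lemma sqrt_above_min n k : n < k * k -> sqrt_above n <= k.
Proof. by rewrite /sqrt_above; case: ex_minnP => m _; apply. Qed.

Definition nb_scales (n : nat) : nat := (up_log 2 n).+1.

Section Main.
Variables (R : realType) (N : nat) (e : rel 'I_N) (W inv cst : nat).
Variables (g : incidence_lists N) (nb : 'I_N -> seq 'I_N).
Hypotheses (e_sym : symmetric e) (e_irr : irreflexive e).
Hypotheses (nb_uniq : forall v, uniq (nb v)) (nb_mem : forall v u, (u \in nb v) = e v u).
Hypothesis nb_g : forall v (i : 'I_N.-1), g v i = nth 0 [seq name u | u <- nb v] i :> nat.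
Hypothesis N0 : 0 < N.
Let O := graph_oracle g e.
Variables (sq lg x A B M K T F C : nat).
Hypotheses (sqE : sq = sqrt_above N) (lgE : lg = nb_scales N) (xE : x = lg + inv + cst).
Hypotheses (AE : A = x * x * x * x) (BE : B = A * x * x) (ME : M = sq * B).
Hypotheses (KE : K = M * x * x * x) (TE : T = B * A * x) (FE : F = B * x) (CE : C = A * x).
Let len := 2 * A.+2.
Local Notation triple := (triple R W O (cycle_output N e len)).
Local Notation trial_miss := (trial_miss R N e A B K nb).
Hypotheses (NW : N.+1 * N.+1 < W) (x4 : 4 <= x) (CW : cst < W) (iW : inv < W).
Hypotheses (KW : K < W) (TW : T < W) (lgW : 2 ^ lg < W).
Hypothesis baseW : F + (lg * T) * N.+1 + N.+1 + N.+1 < W.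

Lemma ltW_mulr a b : 0 < b -> a * b < W -> a < W.
Proof. by move=> b0; apply: leq_ltn_trans; rewrite leq_pmulr. Qed.

Lemma x_gt0 : 0 < x. Proof. by apply: leq_trans x4. Qed.

Lemma sq_gt0 : 0 < sq.
Proof. by rewrite sqE; have := sqrt_aboveP N; case: (sqrt_above N). Qed.

Lemma A_gt0 : 0 < A. Proof. by rewrite AE !muln_gt0 x_gt0. Qed.

Lemma B_gt0 : 0 < B. Proof. by rewrite BE !muln_gt0 A_gt0 x_gt0. Qed.

Lemma M_gt0 : 0 < M. Proof. by rewrite ME muln_gt0 sq_gt0 B_gt0. Qed.

(** The partial products formed on the way to [K] have to fit in a word as well. *)
Lemma Mx_lt : [/\ M < W, M * x < W & M * x * x < W].
Proof.
have x0 := x_gt0; have h := KW; rewrite KE in h.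
have h2 := ltW_mulr _ _ x0 h; have h1 := ltW_mulr _ _ x0 h2.
by split=> //; exact: ltW_mulr h1.
Qed.

Lemma sizes : [/\ x <= A, A * 4 <= C, C <= B & 4 * B <= F].
Proof.
have x0 := x_gt0; have A0 := A_gt0; split.
- by rewrite AE leq_pmull // !muln_gt0 x0.
- by rewrite CE leq_pmul2l.
- by rewrite BE CE leq_pmulr.
- by rewrite FE mulnC leq_pmul2l // B_gt0.
Qed.

Lemma FW : F < W. Proof. by apply: leq_ltn_trans baseW; rewrite -!addnA leq_addr. Qed.

Lemma small_bounds : [/\ B.+2 < W, 3 * B < F, C < W, 2 * A.+2 <= C & sq < W].
Proof.
have [xA AC CB BF] := sizes; have A0 := A_gt0; have B0 := B_gt0; have FW := FW.
have x4A : 4 <= A by apply: leq_trans xA.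
split; try lia.
by have [h _ _] := Mx_lt; apply: (ltW_mulr _ B) => //; rewrite -ME.
Qed.

Lemma x_lt : [/\ x < W, x * x < W, x * x * x < W & A < W].
Proof.
have [_ AC CB BF] := sizes; have FW := FW.
have AW : A < W by lia.
have x0 := x_gt0; have h := AW; rewrite AE in h.
have h2 := ltW_mulr _ _ x0 h; have h1 := ltW_mulr _ _ x0 h2.
by split=> //; exact: ltW_mulr h1.
Qed.

Lemma miss_ge0 r v0 : (0 <= miss R N e A B K r v0)%R.
Proof. exact: no_conflict_ge0. Qed.

Lemma trial_miss_ge0 th n : (0 <= trial_miss th n)%R.
Proof.
elim: n => //= n IHn; apply: divr_ge0 => //; apply: sumr_ge0 => u _.
apply: divr_ge0 => //; apply: sumr_ge0 => i _; rewrite /attempt.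
by case: ifP => // _; apply: divr_ge0 => //; apply: addr_ge0; exact: miss_ge0.
Qed.

(* [n] counts the trials run so far. *)
Definition between (th n : nat) (s : store) : Prop :=
  [/\ [/\ regs s 0 = N, regs s 4 = lg, regs s 5 = A, regs s 6 = B & regs s 7 = K],
      [/\ regs s 8 = M, regs s 9 = T, regs s 10 = F, regs s 11 = C & regs s 12 = th],
      regs s 13 = F + n * N.+1, out s = [::] &
      forall a, F + n * N.+1 + N < a -> ram s a = 0].

Definition Tt : nat := trial_time A F C K M.

Lemma one_trial th n s (z : R) : between th n s -> (0 <= z)%R -> 0 < th < W ->
  (n.+1 <= lg * T) ->
  triple trial_cmd Tt s (trial_miss th M * z)%R
    (fun s' y => [/\ y = z, between th n.+1 s' & forall r, 14 <= r <= 15 -> regs s' r = regs s r]).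
Proof.
move=> [[r0 r4 r5 r6 r7] [r8 r9 r10 r11 r12] r13 os zero] z0 thW nT.
have [B2W BF CW2 CA sW] := small_bounds; have [xW _ _ AW] := x_lt.
have A0 := A_gt0; have M0 := M_gt0; have [_ AC _ _] := sizes; have [MW _ _] := Mx_lt.
have x0 := x_gt0; have FW := FW.
have K0 : 0 < K by rewrite KE !muln_gt0 M0 x0.
have nN : n.+1 * N.+1 <= lg * T * N.+1 by rewrite leq_pmul2r.
apply: (triple_post _ _ _ _ _ _ _ _ _ _ _ (trial_triple R N e W A B F C K M g nb
  e_sym e_irr nb_uniq nb_mem nb_g NW B2W FW BF _ _ _ CA _ N0 th thW z s (F + n * N.+1)
  z0 r0 r5 r6 r7 r8 r10 r11 r12 r13 _ _ os zero)) => //; try lia.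
move=> s' y [-> kr r13' o' zero']; split=> //.
- split=> //.
  + by split; rewrite kr.
  + by split; rewrite kr.
  + by rewrite r13' mulSn; lia.
  + by move=> a; rewrite mulSn => h; apply: zero'; lia.
- by move=> r rr; rewrite kr // mem_trial; lia.
Qed.

Lemma trials_triple th i s (z : R) : between th (i * T) s -> (0 <= z)%R -> 0 < th < W ->
  i < lg ->
  triple (for_ 15 9 trial_cmd) (T * (Tt + 3) + 3) s (trial_miss th M ^+ T * z)%R
    (fun s' y => [/\ y = z, between th (i.+1 * T) s' & regs s' 14 = regs s 14]).
Proof.
move=> bs z0 thW ilg.
have T0 : 0 < T by rewrite TE !muln_gt0 B_gt0 A_gt0 x_gt0.
apply: (triple_for _ _ _ _ _ _ _ _ _ (fun j s' y => [/\ y = (trial_miss th M ^+ (T - j) * z)%R,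
   between th (i * T + j) s' & regs s' 14 = regs s 14])).
- by rewrite T0 TW.
- by [].
- by case: bs => _ [].
- by move=> j s' y v [-> b1 r14]; split.
- by rewrite subn0 addn0.
- move=> j s' y jT r15 r9 [-> b1 r14].
  rewrite (_ : T - j = (T - j.+1).+1); last by lia.
  rewrite exprS -mulrA.
  apply: (triple_post _ _ _ _ _ _ _ _ _ _ _ (one_trial _ _ _ _ b1 _ thW _)).
  + move=> s2 y2 [-> b2 k2]; split; [by rewrite k2 | by case: b2 => _ [] | split=> //].
      by rewrite addnS.
    by rewrite k2.
  + by rewrite mulr_ge0 // exprn_ge0 // trial_miss_ge0.
  + have : i.+1 * T <= lg * T by rewrite leq_pmul2r.
    rewrite mulSn; lia.
- by move=> s' y _ [-> b1 r14]; rewrite subnn mul1r mulSn addnC.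
Qed.

Fixpoint scales_miss (j th : nat) : R :=
  if j is j'.+1 then (trial_miss th M ^+ T * scales_miss j' (th + th))%R else 1%R.

Lemma scales_miss_ge0 j th : (0 <= scales_miss j th)%R.
Proof. by elim: j th => //= j IHj th; rewrite mulr_ge0 ?exprn_ge0 ?trial_miss_ge0. Qed.

Definition scales_time : nat := lg * (T * (Tt + 3) + 12) + 3.

Lemma scales_triple s : between 1 0 s ->
  triple scales_cmd scales_time s (scales_miss lg 1) (fun s' y => y = 1%R).
Proof.
move=> b0; have lg0 : 0 < lg by rewrite lgE.
have lgW' : lg < W by apply: ltn_trans lgW; exact: ltn_expl.
apply: (@triple_time _ _ _ _ (lg * ((T * (Tt + 3) + 3 + 3).+1 + 3) + 3)).
  by rewrite /scales_time; lia.
apply: (triple_for _ _ _ _ _ _ _ _ _ (fun i s' y => y = scales_miss (lg - i) (2 ^ i) /\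
   between (2 ^ i) (i * T) s')).
- by rewrite lg0 lgW'.
- by [].
- by case: b0 => [[]].
- by move=> i s' y v [-> b1]; split.
- by rewrite subn0.
- move=> i s' y ilg r14 r4 [-> b1].
  rewrite (_ : lg - i = (lg - i.+1).+1); last by lia.
  rewrite [scales_miss _.+1 _]/=.
  have p2 : 2 ^ i.+1 < W by apply: leq_ltn_trans lgW; rewrite leq_exp2l.
  have pd : 2 ^ i + 2 ^ i = 2 ^ i.+1 by rewrite addnn -mul2n expnS.
  apply: (do_cmd _ _ _ _ _ _ _ _ _ _ _ _ (trials_triple _ _ _ _ b1 _ _ ilg)).
  + exact: scales_miss_ge0.
  + by rewrite expn_gt0 /=; lia.
  move=> s2 y2 [-> b2 r14']; have r12 : regs s2 12 = 2 ^ i by case: b2 => _ [].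
  have W1 : 1 < W by lia.
  eapply do_set; [by ev; lia | lia | ].
  apply: do_skip; split; [by rewrite /= /upd /= r14' | by case: b2 => [[]] | ].
  rewrite pd; split=> //.
  case: b2 => [[? ? ? ? ?] [? ? ? ? ?] ? ? rm]; split=> //; split=> //.
- by move=> s' y _ [-> _]; rewrite subnn.
Qed.

Definition tester_time : nat := sq * 4 + lg * 20 + 100 + scales_time.

Lemma sq_le : sq * sq <= N.+1 * N.+1.
Proof.
have h : sq <= N.+1 by rewrite sqE; apply: sqrt_above_min; rewrite mulnS; lia.
exact: leq_mul.
Qed.

Lemma tester_triple s : regs s 0 = N -> regs s 1 = inv -> (forall a, ram s a = 0) ->
  out s = [::] ->
  triple (tester cst) tester_time s (scales_miss lg 1) (fun s' y => y = 1%R).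
Proof.
move=> r0 r1 zero os.
have W1 : 1 < W by apply: leq_ltn_trans NW; lia.
have [B2W BF CW2 CA sW] := small_bounds; have [xW xxW xxxW AW] := x_lt.
have [MW MxW MxxW] := Mx_lt; have FW := FW; have sqW := leq_ltn_trans sq_le NW.
have BAW : B * A < W by apply: (ltW_mulr _ x); [exact: x_gt0 | rewrite -TE].
have lgW' : lg < W by apply: ltn_trans lgW; exact: ltn_expl.
pose P1 k s' y := [/\ y = scales_miss lg 1, regs s' 3 = k, forall r, r != 3 -> regs s' r = regs s r,
  ram s' = ram s & out s' = [::]].
pose P2 k s' y := [/\ y = scales_miss lg 1, [/\ regs s' 0 = N, regs s' 1 = inv, regs s' 3 = sq,
  regs s' 4 = k.+1 & regs s' 12 = 2 ^ k], ram s' = ram s & out s' = [::]].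
apply: (@triple_time _ _ _ _ ((sq * 2).+1 + ((up_log 2 N * 6).+1 + ((scales_time + 1).+1).+4.+4.+4.+4.+4).+1.+4).+1.+2).
  by rewrite /tester_time lgE /nb_scales; lia.
rewrite /tester /setup !cat_cons cat0s.
eapply do_set; [by ev; qlia | qlia | ].
apply: (do_cmd _ _ _ _ _ _ _ _ _ _ _ (P1 sq)).
  apply: (triple_while _ _ _ _ _ _ 1 (fun i s' y => exists2 k, (k + i = sq)%N & P1 k s' y)).
  - move=> i s' y [k ki [-> r3 kr rm ro]].
    have r0' : regs s' 0 = N by rewrite kr.
    have kk : k * k <= sq * sq by apply: leq_mul; lia.
    have ev1 : eval W s' (ELt (EMul (EReg 3) (EReg 3)) succN) = (k * k < N + 1) by ev; qlia.
    rewrite ev1 => kN; have {kN} kN : k * k <= N by case: leqP kN => //; lia.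
    exists i.-1.
      case: i ki => // ki; have := sqrt_aboveP N; rewrite -sqE; have -> : sq = k by lia.
      lia.
    have ks : k < sq.
      rewrite ltnNge; apply/negP => sk; have := sqrt_aboveP N; rewrite -sqE.
      by have := leq_mul sk sk; lia.
    apply: triple_set; exists k.+1; first by lia.
    have -> : eval W s' (EAdd (EReg 3) (EConst 1)) = k.+1 by rewrite -[k.+1]addn1; ev; qlia.
    rewrite set_regE; last by qlia.
    by split=> // r r3'; rewrite /= /upd (negbTE r3') kr.
  - move=> i s' y [k ki [-> r3 kr rm ro]].
    have r0' : regs s' 0 = N by rewrite kr.
    have kk : k * k <= sq * sq by apply: leq_mul; lia.
    have -> : eval W s' (ELt (EMul (EReg 3) (EReg 3)) succN) = (k * k < N + 1) by ev; qlia.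
    move=> kN; have sk : sq <= k by rewrite sqE; apply: sqrt_above_min; case: leqP kN => //; lia.
    by have <- : k = sq by lia.
  - exists 0; rewrite ?add0n //; split=> //.
    by move=> r r3; rewrite /= /upd (negbTE r3).
move=> s1 _ [-> r3 kr rm ro].
have q0 : regs s1 0 = N by rewrite kr.
have q1 : regs s1 1 = inv by rewrite kr.
do 2![eapply do_set; [by ev; qlia | qlia | ]].
have pw k : k <= up_log 2 N -> 2 ^ k < W.
  by move=> kl; apply: leq_ltn_trans lgW; rewrite lgE /nb_scales leq_exp2l //; lia.
apply: (do_cmd _ _ _ _ _ _ _ _ _ _ _ (P2 (up_log 2 N))).
  apply: (triple_while _ _ _ _ _ _ 5 (fun i s' y => exists2 k, (k + i = up_log 2 N)%N & P2 k s' y)).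
  - move=> i s' y [k ki [-> [r0' r1' r3' r4' r12'] rm' ro']].
    have kW := pw k ltac:(lia).
    have -> : eval W s' (ELt (EReg 12) (EReg 0)) = (2 ^ k < N) by ev; qlia.
    move=> kN; have {kN} kN : 2 ^ k < N by case: leqP kN.
    have kl : k < up_log 2 N.
      rewrite ltnNge; apply/negP => lk; have := up_logP N (isT : 1 < 2).
      by have := leq_exp2l (up_log 2 N) k (isT : 1 < 2); rewrite lk; lia.
    exists i.-1; first by lia.
    have kW1 := pw k.+1 kl; have pd : 2 ^ k + 2 ^ k = 2 ^ k.+1 by rewrite addnn -mul2n expnS.
    have lgE' : up_log 2 N < lg by rewrite lgE.
    rewrite /double_cmd /incr; eapply do_set; [by ev; qlia | qlia | ].
    eapply do_set; [by ev; qlia | qlia | ].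
    apply: do_skip; exists k.+1; first by lia.
    by split=> //; split=> //; rewrite /= /upd /= ?addn1.
  - move=> i s' y [k ki [-> [r0' r1' r3' r4' r12'] rm' ro']].
    have kW := pw k ltac:(lia).
    have -> : eval W s' (ELt (EReg 12) (EReg 0)) = (2 ^ k < N) by ev; qlia.
    move=> kN; have sk : up_log 2 N <= k by apply: up_log_min => //; case: leqP kN.
    by have <- : k = up_log 2 N by lia.
  - by exists 0; rewrite ?add0n //; split=> //; split=> //; rewrite /= /upd.
move=> s2 _ [-> [p0 p1 p3 p4 p12] pm po].
have {}p4 : regs s2 4 = lg by rewrite p4 lgE.
eapply (do_set _ _ _ _ 2 _ _ x); [by rewrite xE; ev; qlia | qlia | ].
eapply (do_set _ _ _ _ 5 _ _ A); [by rewrite AE; ev; qlia | qlia | ].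
eapply (do_set _ _ _ _ 6 _ _ B); [ | qlia | ].
  by have : A * x < W; [lia | move=> AxW; rewrite BE; ev; qlia].
eapply (do_set _ _ _ _ 8 _ _ M); [by rewrite ME; ev; qlia | qlia | ].
eapply (do_set _ _ _ _ 7 _ _ K); [by rewrite KE; ev; qlia | qlia | ].
eapply (do_set _ _ _ _ 9 _ _ T); [by rewrite TE; ev; qlia | qlia | ].
eapply (do_set _ _ _ _ 10 _ _ F); [by rewrite FE; ev; qlia | qlia | ].
eapply (do_set _ _ _ _ 11 _ _ C); [by rewrite CE; ev; qlia | qlia | ].
eapply do_set; [by ev; qlia | qlia | ].
eapply do_set; [by ev; qlia | qlia | ].
apply: (do_cmd _ _ _ _ _ _ scales_time 1 _ _ _ (fun s' y => y = 1%R)).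
  apply: scales_triple; split=> //=.
  - by rewrite /upd /= mul0n addn0.
  - by move=> a _; rewrite pm zero.
by move=> s' y ->; apply: do_skip.
Qed.

End Main.

Local Open Scope ring_scope.

(** * Success of a trial *)

Section Numerics.
Variables (R : realType) (N : nat) (e : rel 'I_N) (nb : 'I_N -> seq 'I_N).
Hypothesis e_sym : symmetric e.
Hypotheses (nb_uniq : forall v, uniq (nb v)) (nb_mem : forall v u, (u \in nb v) = e v u).
Variables (x sq : nat).
Hypotheses (x64 : (64 <= x)%N) (N0 : (0 < N)%N).
Hypotheses (sqN : (N < sq * sq)%N) (sq4 : (sq * sq <= 4 * N.+1)%N) (Nx : (N <= 2 ^ x)%N).
Let A := (x ^ 4)%N.
Let B := (x ^ 6)%N.
Let M := (sq * x ^ 6)%N.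
Let K := (sq * x ^ 9)%N.
Let dm := nb_arcs N e.
Hypotheses (dense : (N <= dm * x)%N) (cyclic : (dm <= marked_arcs N e B * x)%N).
Local Notation core := (core N e B).
Local Notation rich := (rich R N e B (x ^ 2)%N A).
Local Notation miss := (miss R N e A B K).

Definition good (u v : 'I_N) : bool := core u v && (((x ^ 8)%:R^-1 : R) <= rich u v).

Definition nb_good : nat := (\sum_u \sum_(v | good u v) 1)%N.

Let X : R := x%:R.

Lemma X64 : 64 <= X. Proof. by rewrite /X ler_nat. Qed.

Lemma X_gt0 : 0 < X. Proof. by apply: lt_le_trans X64. Qed.

(** In [rich_mass] with [Q = B], the main term is at least [x ^ 3 * dm]. Hard arcs cost
    [3 * x ^ 2 * dm], the trajectories with few marked vertices [2 * x ^ 2 * dm], and half of the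
    factor [x] covers the sum 5. *)
Lemma rich_total : dm%:R <= 4 * X ^+ 7 * \sum_v \sum_(u | core v u) rich u v.
Proof.
have X64 := X64; have X0 := X_gt0.
have := rich_mass R N e B e_sym B (x ^ 2) A; set S := \sum_v _.
set D := marked_arcs N e B; set H := hard_arcs N e B B => mass.
have d0 : 0 <= (dm%:R : R) by [].
have HB : X ^+ 6 * H%:R <= 3 * (dm%:R : R).
  have := hard_arcs_le N e B B; have := leaves_le N e B e_sym.
  rewrite -/dm => l1 l2; rewrite /X -natrX -!natrM ler_nat; move: l1 l2; rewrite -/H -/B mulnS; lia.
have DX : dm%:R <= (D%:R : R) * X by rewrite /X -natrM ler_nat.
have S0 : 0 <= S.
  by apply: sumr_ge0 => v _; apply: sumr_ge0 => u _; exact: rich_ge0.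
have AE : (A%:R : R) = X ^+ 4 by rewrite /A natrX.
have A2E : (A.+2%:R : R) <= 2 * X ^+ 4.
  rewrite -addn2 natrD AE mulr_natl mulr2n lerD2l.
  by rewrite (le_trans (_ : 2 <= X)) ?ler_eXnr //; lra.
have BE : (B%:R : R) = X ^+ 6 by rewrite /B natrX.
have KE : ((x ^ 2)%:R : R) = X ^+ 2 by rewrite natrX.
rewrite AE BE KE in mass.
have m1 : X ^+ 4 * D%:R >= X ^+ 3 * dm%:R.
  have -> : X ^+ 4 * D%:R = X ^+ 3 * (D%:R * X) by ring.
  by rewrite ler_wpM2l // exprn_ge0 // ltW.
have m2 : H%:R * (X ^+ 4) ^+ 2 <= 3 * X ^+ 2 * dm%:R.
  have -> : H%:R * (X ^+ 4) ^+ 2 = X ^+ 2 * (X ^+ 6 * H%:R) by ring.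
  have -> : 3 * X ^+ 2 * dm%:R = X ^+ 2 * (3 * dm%:R) by ring.
  by rewrite ler_wpM2l // exprn_ge0 // ltW.
have m3 : X ^+ 6 * A.+2%:R * S <= 2 * X ^+ 10 * S.
  rewrite ler_wpM2r //; apply: le_trans (ler_wpM2l _ A2E) _; first by rewrite exprn_ge0 // ltW.
  by rewrite le_eqVlt; apply/orP; left; apply/eqP; ring.
have m4 : X ^+ 3 * dm%:R - 5 * X ^+ 2 * dm%:R <= 2 * X ^+ 10 * S by lra.
have m5 : X ^+ 3 * dm%:R <= 4 * X ^+ 10 * S.
  have : 10 * X ^+ 2 * dm%:R <= X ^+ 3 * dm%:R.
    rewrite ler_wpM2r // (_ : X ^+ 3 = X * X ^+ 2); last by ring.
    by rewrite ler_wpM2r ?exprn_ge0 ?ltW //; lra.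
  lra.
have X3 : 0 < X ^+ 3 by rewrite exprn_gt0.
rewrite -(ler_pM2l X3); apply: le_trans m5 _.
by rewrite le_eqVlt; apply/orP; left; apply/eqP; ring.
Qed.

(** Averaging: a good arc contributes at most 1 to the sum of [rich], and the other ones at most
    [dm / x ^ 8] together. *)
Lemma nb_good_ge : (dm <= nb_good * x ^ 8)%N.
Proof.
have X64 := X64; have X0 := X_gt0; have := rich_total; set S := \sum_v _ => dS.
have : S <= nb_good%:R + dm%:R * (X ^+ 8)^-1.
  rewrite /nb_good natr_sum /dm /nb_arcs natr_sum mulr_suml -big_split /=.
  rewrite /S (exchange_big_dep predT) //=; apply: ler_sum => u _.
  rewrite natr_sum big_mkcond [X in _ <= X + _]big_mkcond /=.
  have -> : (deg N e u)%:R * (X ^+ 8)^-1 = \sum_(v : 'I_N) (e u v)%:R * (X ^+ 8)^-1.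
    rewrite -mulr_suml; congr (_ * _); rewrite /deg -sum1_card natr_sum.
    rewrite big_mkcond /=; apply: eq_bigr => v _; rewrite inE; by case: (e u v).
  rewrite -big_split /=; apply: ler_sum => v _; rewrite core_sym //.
  have i0 : 0 <= (X ^+ 8)^-1 by rewrite invr_ge0 exprn_ge0 // ltW.
  case: (boolP (core u v)) => cuv; last first.
    by rewrite addr_ge0 ?mulr_ge0 //; case: ifP.
  rewrite (core_edge _ _ _ _ _ cuv) mul1r /good cuv /= natrX -/X.
  case: ifP => [_|/negbT]; last by rewrite -ltNge add0r => /ltW.
  apply: ler_wpDr => //; apply: rich_le1 => //; by rewrite core_sym.
have X8 : 0 < X ^+ 8 by rewrite exprn_gt0.
move=> h; rewrite -(ler_nat R) natrM natrX -/X.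
have X7 : 0 < X ^+ 7 by rewrite exprn_gt0.
have h2 : dm%:R <= 4 * X ^+ 7 * (nb_good%:R + dm%:R * (X ^+ 8)^-1).
  apply: le_trans dS _; rewrite ler_wpM2l // mulr_ge0 // ltW //.
have h3 : 4 * X ^+ 7 * (dm%:R * (X ^+ 8)^-1) = 4 * (dm%:R / X) by field; rewrite gt_eqF.
have h4 : dm%:R / X <= dm%:R / 64.
  by rewrite ler_wpM2l // lef_pV2 ?posrE.
have h5 : X ^+ 7 * nb_good%:R * 64 <= nb_good%:R * X ^+ 8.
  by rewrite [X ^+ 8]exprSr mulrA [X ^+ 7 * _]mulrC ler_wpM2l // mulr_ge0 // ltW.
have g0 : 0 <= (nb_good%:R : R) by [].
have d0 : 0 <= (dm%:R : R) by [].
have := mulr_ge0 (ltW X7) g0; lra.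
Qed.

(** With [eta] the inverse of [x ^ 8] and [lam = sq * x ^ 8], the product [lam * eta] is [sq], and
    the spare factor [x] of [K] covers 18. The marked count [x ^ 2] suffices since [K ^ 2] is only
    exponential in a multiple of [x]. *)
Lemma good_miss u v : good u v -> miss u v <= 3 / 4.
Proof.
case/andP=> cuv eta; have X64 := X64; have X0 := X_gt0.
have sq0 : (0 < sq)%N by case: (sq) sqN.
apply: (no_conflict_bound R N e B e_sym (x ^ 2) A u v K (sq * x ^ 8) (X ^+ 8)^-1).
- by rewrite core_sym.
- by rewrite expn_gt0; lia.
- by rewrite muln_gt0 sq0 expn_gt0; lia.
- rewrite (_ : K = x * (sq * x ^ 8))%N; last by rewrite /K expnS mulnCA.
  by rewrite leq_mul2r; apply/orP; right; lia.
- by rewrite /X -natrX invr_ge0 ler0n.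
- rewrite -exprMn natrM natrX -/X -mulrA divff ?mulr1; last by rewrite expf_neq0 // gt_eqF.
  by rewrite -natrX ler_nat expnS expn1.
rewrite -natrX -natrM ler_nat.
have xs : (x ^ 18 <= 2 ^ (18 * x))%N.
  by rewrite mulnC expnM leq_exp2r // ltnW // ltn_expl.
have KK : (K ^ 2 <= 2 ^ (4 + x) * 2 ^ (18 * x))%N.
  rewrite /K expnMn -expnM leq_mul // expnD.
  rewrite expnS expn1; apply: leq_trans sq4 _; have := Nx; lia.
apply: (@leq_trans (2 ^ 5 * (2 ^ (4 + x) * 2 ^ (18 * x)))%N); first by rewrite leq_mul.
rewrite -!expnD leq_exp2l // expnS expn1.
have := leq_mul x64 (leqnn x); move: (x * x)%N (x64) => z; clear; lia.
Qed.

Lemma miss_le1 u v : miss u v <= 1.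
Proof. exact: no_conflict_le1. Qed.

Variable th : nat.
Hypothesis th0 : (0 < th)%N.

Definition hit (u w : 'I_N) : R := 1 - (miss w u + miss u w) / 2%:R.

(** A good arc leads to rejection with probability at least [1 / 4], and the coin picks it with
    probability [1 / 2]. *)
Lemma hit_ge u w : ((good u w)%:R + (good w u)%:R) / 8 <= hit u w.
Proof.
have uw := miss_le1 u w; have wu := miss_le1 w u; rewrite /hit.
case: (boolP (good u w)) => [/good_miss|_]; case: (boolP (good w u)) => [/good_miss|_] /=; lra.
Qed.

Lemma hit_ge0 u w : 0 <= hit u w.
Proof. by have uw := miss_le1 u w; have wu := miss_le1 w u; rewrite /hit; lra. Qed.

Local Notation trial_miss := (trial_miss R N e A B K nb th).

Definition sampled : nat := (\sum_(u < N) minn th (size (nb u)))%N.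

Definition gain : R := \sum_(u < N) \sum_(i < minn th (size (nb u))) hit u (nth u (nb u) i).

Lemma attempt_sum y u : \sum_(i < th) attempt R N e A B K nb y u i =
  th%:R * y + (minn th (size (nb u)))%:R * (1 - y)
    - \sum_(i < minn th (size (nb u))) hit u (nth u (nb u) i).
Proof.
set m := minn _ _; have mth : (m <= th)%N by exact: geq_minl.
rewrite -(big_mkord xpredT (fun i => attempt R N e A B K nb y u i)).
rewrite (@big_cat_nat _ _ _ m) //=.
rewrite [X in _ + X](eq_big_nat _ _ (F2 := fun=> y)); last first.
  by move=> i /andP[mi ith]; rewrite /attempt ifF //; rewrite /m in mi; lia.
rewrite sumr_const_nat -[y *+ _]mulr_natl natrB //.
rewrite (eq_big_nat _ _ (F2 := fun i => 1 - hit u (nth u (nb u) i))); last first.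
  move=> i /= im; rewrite /attempt ifT; last by rewrite /m in im; lia.
  by rewrite /hit /=; ring.
rewrite big_mkord sumrB sumr_const card_ord; ring.
Qed.

Lemma trial_missS n : 1 - trial_miss n.+1 =
  gain / (N * th)%:R + (1 - sampled%:R / (N * th)%:R) * (1 - trial_miss n).
Proof.
rewrite [trial_miss n.+1]/=; set y := trial_miss n.
under eq_bigr do rewrite attempt_sum.
have N0' : (N%:R : R) != 0 by rewrite pnatr_eq0 -lt0n.
have t0' : (th%:R : R) != 0 by rewrite pnatr_eq0 -lt0n.
rewrite -mulr_suml sumrB big_split /= sumr_const card_ord -[_ *+ N]mulr_natl -mulr_suml -natr_sum.
rewrite -/gain -/sampled natrM; field.
by rewrite N0' t0'.
Qed.

Lemma gain_ge0 : 0 <= gain.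
Proof. by apply: sumr_ge0 => u _; apply: sumr_ge0 => i _; exact: hit_ge0. Qed.

Lemma sampled_le : (sampled <= N * th)%N.
Proof.
rewrite -{1}[N in leqRHS]card_ord -sum_nat_const; apply: leq_sum => u _; exact: geq_minl.
Qed.

Lemma sampled_le_arcs : (sampled <= dm)%N.
Proof.
apply: leq_sum => u _; apply: leq_trans (geq_minr _ _) _.
rewrite -(card_uniqP (nb_uniq u)); apply/subset_leq_card/subsetP => w.
by rewrite nb_mem inE.
Qed.

(** With [a] the probability that one attempt finds an arc, the fraction is a lower bound for the
    solution of [trial_missS] that avoids powers of [1 - a]. *)
Lemma trial_gain_ge n :
  gain / (N * th)%:R * n%:R / (1 + sampled%:R / (N * th)%:R * n%:R) <= 1 - trial_miss n.
Proof.
set a : R := sampled%:R / (N * th)%:R; have Nth : 0 < ((N * th)%:R : R) by rewrite ltr0n muln_gt0 N0.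
have a0 : 0 <= a by rewrite divr_ge0.
have a1 : a <= 1 by rewrite ler_pdivrMr // mul1r ler_nat sampled_le.
have b0 : 0 <= gain / (N * th)%:R by rewrite divr_ge0 // gain_ge0.
elim: n => [|n IHn]; first by rewrite mulr0 mul0r /= subrr.
rewrite trial_missS -/a; set b := gain / _ in b0 IHn *.
have n0 : 0 <= (n%:R : R) by [].
have an0 := mulr_ge0 a0 n0.
have d1 : 0 < 1 + a * n%:R by lra.
have d2 : 0 < 1 + a * n.+1%:R by rewrite -natr1 mulrDr; lra.
apply: (@le_trans _ _ (b + (1 - a) * (b * n%:R / (1 + a * n%:R)))); last first.
  by rewrite lerD2l ler_wpM2l // subr_ge0.
rewrite (_ : b + _ = b * n.+1%:R / (1 + a * n%:R)).
  rewrite ler_wpM2l //; first by rewrite mulr_ge0.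
  by rewrite lef_pV2 ?posrE // lerD2l ler_wpM2l // ler_nat.
by rewrite -natr1; field; rewrite gt_eqF.
Qed.

Definition high : {set 'I_N} := [set u | (th < deg N e u)%N].

Lemma high_le : (#|high| * th <= dm)%N.
Proof.
rewrite -sum_nat_const /dm /nb_arcs [leqRHS](bigID (mem high)) /=.
apply: leq_trans (leq_addr _ _); apply: leq_sum => u; rewrite inE; exact: ltnW.
Qed.

(** An edge with an end of degree at most [th] is within reach of the sampling from that end. Only
    arcs with both ends in [high] may be lost; the factor 8 is that of [hit_ge]. *)
Lemma nb_good_le : nb_good%:R <= 8 * gain + (#|high| ^ 2)%:R.
Proof.
have size_nb u : size (nb u) = deg N e u.
  by rewrite -(card_uniqP (nb_uniq u)); apply: eq_card => w; rewrite nb_mem inE.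
have g1 : \sum_(u | u \notin high) \sum_w ((good u w)%:R + (good w u)%:R) <= 8 * gain.
  rewrite /gain mulr_sumr [leRHS](bigID (fun u => u \notin high)) /=.
  apply: ler_wpDr.
    apply: sumr_ge0 => u _; apply: mulr_ge0 => //.
    by apply: sumr_ge0 => i _; exact: hit_ge0.
  apply: ler_sum => u; rewrite inE -leqNgt => lu.
  rewrite (minn_idPr _) ?size_nb // -size_nb.
  rewrite -(big_mkord xpredT (fun i => hit u (nth u (nb u) i))) -(big_nth u xpredT (hit u)).
  rewrite mulr_sumr (big_uniq _ (nb_uniq u)) /= [leLHS](bigID (fun w => w \in nb u)) /=.
  rewrite [X in _ + X]big1 ?addr0.
    by apply: ler_sum => w _; have := hit_ge u w; lra.
  move=> w; rewrite nb_mem => /negbTE euw.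
  have ng a b : e a b = false -> good a b = false.
    by move=> eab; apply: contraFF eab => /andP[/core_edge].
  by rewrite !ng ?addr0 // e_sym.
apply: le_trans (lerD g1 (lexx _)).
have -> : (nb_good%:R : R) = \sum_u \sum_w (good u w)%:R.
  rewrite /nb_good natr_sum; apply: eq_bigr => u _.
  by rewrite natr_sum big_mkcond /=; apply: eq_bigr => w _; case: (good u w).
have -> : \sum_(u | u \notin high) \sum_w ((good u w)%:R + (good w u)%:R) =
   \sum_u \sum_w (((u \notin high) && good u w)%:R + ((w \notin high) && good u w)%:R) :> R.
  under eq_bigr do rewrite big_split /=.
  under [RHS]eq_bigr do rewrite big_split /=.
  rewrite !big_split /= [X in _ = _ + X]exchange_big /= !(big_mkcond (fun u => u \notin high)) /=.
  congr (_ + _); apply: eq_bigr => u _.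
    by case: ifP => _; [apply: eq_bigr => w _ | rewrite big1].
  by case: ifP => _; [apply: eq_bigr => w _ | rewrite big1].
have -> : ((#|high| ^ 2)%:R : R) = \sum_u \sum_w ((u \in high) && (w \in high))%:R.
  rewrite -mulnn -!sum1_card natrM !natr_sum mulr_suml big_mkcond /=.
  apply: eq_bigr => u _; case: (u \in high); last by rewrite big1.
  by rewrite mul1r big_mkcond /=; apply: eq_bigr => w _; case: (w \in high).
rewrite -big_split /=; apply: ler_sum => u _; rewrite -big_split /=; apply: ler_sum => w _.
by case: (u \in high); case: (w \in high); case: (good u w) => /=; lra.
Qed.

(** After multiplication by [N * th], both terms of the denominator in [trial_gain_ge] are at most
    [M * dm], which leaves [gain / (2 * dm)]. This is at least the inverse of [32 * x ^ 8], and [x]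
    exceeds 32. *)
Lemma trial_gain : (2 * #|high| ^ 2 <= nb_good)%N -> (N * th <= M * dm)%N ->
  ((x ^ 9)%:R)^-1 <= 1 - trial_miss M.
Proof.
move=> hg Nth_le; apply: le_trans (trial_gain_ge M).
have X64 := X64; have X0 := X_gt0; have g0 := gain_ge0.
have Nth : 0 < ((N * th)%:R : R) by rewrite ltr0n muln_gt0 N0.
have dm0 : (0 < dm)%N by move: dense; case: (dm) => //; rewrite mul0n; lia.
have M0 : (0 < M)%N.
  by move: Nth_le; case: (M) => //; rewrite mul0n leqn0 muln_eq0; lia.
have dm0' : 0 < (dm%:R : R) by rewrite ltr0n.
have M0' : 0 < (M%:R : R) by rewrite ltr0n.
set t : R := (N * th)%:R in Nth *.
have tM : t <= M%:R * dm%:R by rewrite -natrM ler_nat.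
clearbody t.
have gg : nb_good%:R <= 16 * gain.
  have := nb_good_le; have : 2 * (#|high| ^ 2)%:R <= (nb_good%:R : R) by rewrite -natrM ler_nat.
  lra.
have gx : dm%:R <= nb_good%:R * X ^+ 8 by rewrite /X -natrX -natrM ler_nat nb_good_ge.
have X8 : 0 < X ^+ 8 by rewrite exprn_gt0.
apply: (@le_trans _ _ (gain / (2 * dm%:R))).
  rewrite natrX -/X ler_pdivlMr ?mulr_gt0 // mulrC ler_pdivrMr ?exprn_gt0 //.
  have -> : gain * X ^+ 9 = (X * gain) * X ^+ 8 by ring.
  have h1 : 16 * gain * X ^+ 8 >= dm%:R by apply: le_trans gx _; rewrite ler_wpM2r // ltW.
  have h2 : 64 * gain * X ^+ 8 <= X * gain * X ^+ 8 by apply: ler_wpM2r; [exact: ltW | exact: ler_wpM2r].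
  lra.
have s0 : 0 <= (sampled%:R : R) by [].
have sd : (sampled%:R : R) <= dm%:R by rewrite ler_nat sampled_le_arcs.
rewrite -mulrA -mulrA ler_wpM2l //.
have den : 0 < t + sampled%:R * M%:R by rewrite ltr_wpDr // mulr_ge0.
have dn : t + sampled%:R * M%:R != 0 by rewrite gt_eqF.
have tn : t != 0 by rewrite gt_eqF.
have -> : t^-1 * (M%:R / (1 + sampled%:R / t * M%:R)) = M%:R / (t + sampled%:R * M%:R).
  by field; rewrite tn dn.
rewrite ler_pdivlMr // mulrC ler_pdivrMr ?mulr_gt0 //.
have : sampled%:R * M%:R <= dm%:R * (M%:R : R) by rewrite ler_wpM2r.
lra.
Qed.

End Numerics.

Section Success.
Variables (R : realType) (N : nat) (e : rel 'I_N) (nb : 'I_N -> seq 'I_N).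
Hypothesis e_sym : symmetric e.
Hypotheses (nb_uniq : forall v, uniq (nb v)) (nb_mem : forall v u, (u \in nb v) = e v u).
Variables (x sq : nat).
Hypotheses (x64 : (64 <= x)%N) (N0 : (0 < N)%N).
Hypotheses (sqN : (N < sq * sq)%N) (sq4 : (sq * sq <= 4 * N.+1)%N) (Nx : (N <= 2 ^ x)%N).
Local Notation dm := (nb_arcs N e).
Hypotheses (dense : (N <= dm * x)%N) (cyclic : (dm <= marked_arcs N e (x ^ 6) * x)%N).
Local Notation nb_good := (nb_good R N e x).
Local Notation trial_miss := (trial_miss R N e (x ^ 4) (x ^ 6) (sq * x ^ 9) nb).

(** The scale is about the square root of [2 * x ^ 8 * dm]. As [#|high| * 2 ^ i <= dm], few arcs
    have both ends in [high]; by minimality the scale is small enough for [M] attempts of rejection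
    sampling. At [N <= 2 ^ i] no vertex is high. *)
Lemma good_scale : exists2 i, (i < nb_scales N)%N &
  (2 * #|high N e (2 ^ i)| ^ 2 <= nb_good)%N /\ (N * 2 ^ i <= sq * x ^ 6 * dm)%N.
Proof.
have gx := nb_good_ge R N e e_sym x sq x64 N0 sqN sq4 Nx dense cyclic.
have dm0 : (0 < dm)%N by move: dense; case: (dm) => //; rewrite mul0n; lia.
have x0 : (0 < x)%N by lia.
pose P i := ((N <= 2 ^ i) || (2 * x ^ 8 * dm <= (2 ^ i) ^ 2))%N.
have Pex : exists i, P i by exists (up_log 2 N); rewrite /P up_logP.
case: (ex_minnP Pex) => i Pi min_i; exists i; first by rewrite ltnS min_i // /P up_logP.
split.
- case/orP: Pi => [Ni|xi].
    suff -> : #|high N e (2 ^ i)| = 0%N by [].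
    apply: eq_card0 => u; rewrite !inE ltnNge; apply/negbF.
    apply: leq_trans Ni; rewrite -[N in leqRHS]card_ord; exact: max_card.
  set h := #|_|; have hd : (h * 2 ^ i <= dm)%N by exact: high_le.
  have h2 : (h ^ 2 * (2 ^ i) ^ 2 <= dm ^ 2)%N by rewrite -expnMn leq_exp2r.
  have h3 : (h ^ 2 * (2 * x ^ 8 * dm) <= dm ^ 2)%N.
    by apply: leq_trans h2; rewrite leq_mul2l xi orbT.
  have h4 : (2 * h ^ 2 * x ^ 8 <= dm)%N.
    rewrite -(leq_pmul2r dm0); apply: leq_trans (_ : dm ^ 2 <= _)%N; last by rewrite expnS expn1.
    by apply: leq_trans h3; move: (h ^ 2)%N (x ^ 8)%N dm => a b d; lia.
  have x8 : (0 < x ^ 8)%N by rewrite expn_gt0 x0.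
  by rewrite -(leq_pmul2r x8); apply: leq_trans gx.
have sN : (N <= sq * sq)%N by exact: ltnW.
have M0 : (0 < sq)%N by case: (sq) sqN.
case: i Pi min_i => [|i] Pi min_i.
  rewrite expn0 muln1; apply: leq_trans dense _.
  rewrite mulnC leq_mul2r; apply/orP; right.
  by apply: leq_trans (leq_pmull _ M0); rewrite -{1}[x]expn1 leq_exp2l //; lia.
have : ~~ P i by apply/negP => /min_i; rewrite ltnn.
rewrite negb_or -!ltnNge => /andP[_ small].
have dx : (x ^ 3 * N <= x ^ 4 * dm)%N.
  by rewrite [(x ^ 4)%N]expnSr -mulnA [(x * dm)%N]mulnC leq_mul2l dense orbT.
have x3 : (8 <= x ^ 3)%N.
  by apply: leq_trans (leq_trans _ x64) _; rewrite // -{1}[x]expn1 leq_exp2l //; lia.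
have NN : (8 * (N * N) <= (sq * sq) * (x ^ 4 * dm))%N.
  rewrite mulnCA; apply: leq_mul => //; apply: leq_trans dx; exact: leq_mul.
have pS : ((2 ^ i.+1) ^ 2 = 4 * (2 ^ i) ^ 2)%N by rewrite (expnS 2 i) expnMn.
rewrite -(@leq_exp2r _ _ 2) // expnMn pS expnMn -(mulnn dm).
rewrite (_ : (sq * x ^ 6) ^ 2 = (sq * sq) * (x ^ 4 * x ^ 8))%N; last first.
  by rewrite expnMn -expnM -expnD mulnn.
apply: (@leq_trans (N ^ 2 * (4 * (2 * x ^ 8 * dm)))%N).
  by rewrite leq_mul2l leq_mul2l ltnW ?orbT.
rewrite -(mulnn N); have := leq_mul NN (leqnn (x ^ 8 * dm)%N).
by move: (x ^ 4)%N (x ^ 8)%N dm (N * N)%N (sq * sq)%N; clear => a b d n q; lia.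
Qed.

Lemma trial_miss_le1 th n : (0 < th)%N -> trial_miss th n <= 1.
Proof.
move=> th0; rewrite -subr_ge0.
apply: le_trans (trial_gain_ge R N e nb x sq x64 N0 sqN sq4 Nx dense cyclic th th0 n).
have g0 : 0 <= gain R N e nb x sq th by exact: gain_ge0.
apply: divr_ge0; first by rewrite mulr_ge0 // divr_ge0.
by rewrite addr_ge0 // mulr_ge0 // divr_ge0.
Qed.

Lemma scales_miss_le (M T j th i : nat) : (0 < th)%N -> (i < j)%N ->
  scales_miss R N e nb (x ^ 4) (x ^ 6) M (sq * x ^ 9) T j th <= trial_miss (th * 2 ^ i) M ^+ T.
Proof.
have sm1 j' th' : (0 < th')%N ->
    scales_miss R N e nb (x ^ 4) (x ^ 6) M (sq * x ^ 9) T j' th' <= 1.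
  elim: j' th' => //= j' IHj th' th0; rewrite mulr_ile1 ?scales_miss_ge0 ?exprn_ge0 ?trial_miss_ge0 //.
    by apply: exprn_ile1; rewrite ?trial_miss_ge0 ?trial_miss_le1.
  by apply: IHj; rewrite addn_gt0 th0.
elim: j th i => // j IHj th [|i] th0 ij /=.
  rewrite muln1 -[leRHS]mulr1 ler_wpM2l ?exprn_ge0 ?trial_miss_ge0 // sm1 //.
  by rewrite addn_gt0 th0.
have th2 : (0 < th + th)%N by rewrite addn_gt0 th0.
rewrite (_ : th * 2 ^ i.+1 = (th + th) * 2 ^ i)%N; last by rewrite (expnS 2 i); lia.
apply: le_trans (IHj (th + th)%N i th2 ij); rewrite -[leRHS]mul1r ler_wpM2r ?scales_miss_ge0 //.
by apply: exprn_ile1; rewrite ?trial_miss_ge0 ?trial_miss_le1.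
Qed.

(** At the good scale, [x ^ 11] trials each reject with probability at least the inverse of [x ^ 9],
    which leaves at most [1 / (1 + x ^ 2)]; the other scales only contribute factors at most 1. *)
Lemma scales_miss_third :
  scales_miss R N e nb (x ^ 4) (x ^ 6) (sq * x ^ 6) (sq * x ^ 9) (x ^ 11) (nb_scales N) 1 <= 3^-1.
Proof.
have [i il [hg Nth]] := good_scale.
apply: le_trans (scales_miss_le _ _ _ 1 i _ il) _ => //; rewrite mul1n.
have th0 : (0 < 2 ^ i)%N by rewrite expn_gt0.
have := trial_gain R N e nb e_sym nb_uniq nb_mem x sq x64 N0 sqN sq4 Nx dense cyclic _ th0 hg Nth.
set y := trial_miss _ _ => gy.
have x0 : 0 < (x%:R : R) by rewrite ltr0n; lia.
have y0 : 0 <= y by exact: trial_miss_ge0.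
set d : R := (x ^ 9)%:R^-1 in gy.
have d0 : 0 <= d by rewrite invr_ge0.
have d1 : d <= 1 by lra.
apply: (@le_trans _ _ ((1 - d) ^+ (x ^ 11))).
  by apply: lerXn2r; rewrite ?nnegrE ?subr_ge0 //; lra.
apply: le_trans (pow_le_inv R d (x ^ 11) _) _; first by rewrite d0 d1.
have -> : (x ^ 11)%:R * d = x%:R ^+ 2.
  by rewrite /d !natrX (_ : 11 = 2 + 9)%N // exprD -mulrA divff ?mulr1 // expf_neq0 // gt_eqF.
have x64' : 64 <= (x%:R : R) by rewrite ler_nat.
rewrite lef_pV2 ?posrE; [nra | nra | by []].
Qed.

End Success.

(** * The resulting tester *)

Section Runs.
Variables (R : realType) (W : nat) (O : oracle).

Lemma always_imp (P Q : config -> Prop) t c : (forall f, P f -> Q f) ->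
  always W O P t c -> always W O Q t c.
Proof.
move=> PQ; elim: t c => [|t IHt] c /=; first exact: PQ.
by move=> H coin /H; exact: IHt.
Qed.

Lemma prob_le (P Q : pred config) t c : (forall f, P f -> Q f) ->
  prob R W O P t c <= prob R W O Q t c.
Proof.
move=> PQ; elim: t c => [|t IHt] c /=.
  by rewrite ler_nat; case: (P c) (PQ c) => // ->.
by rewrite ler_wpM2r ?invr_ge0 // ler_sum.
Qed.

Lemma prob_always (P : pred config) t c : always W O P t c -> prob R W O P t c = 1.
Proof.
elim: t c => [|t IHt] c /=; first by move=> ->.
move=> H; rewrite (eq_bigr (fun=> 1)) => [|coin _]; last exact/IHt/H.
by rewrite sumr_const card_ord divff // pnatr_eq0; case: c {H} => // -[|[] *].
Qed.

End Runs.

Lemma sqrt_above_sq n : (0 < sqrt_above n <= n.+1)%N /\ ((sqrt_above n).-1 * (sqrt_above n).-1 <= n)%N.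
Proof.
have := sqrt_aboveP n; have := sqrt_above_min n; case: (sqrt_above n) => // k min_k _.
split; first by apply: min_k; rewrite mulnS; lia.
by rewrite leqNgt; apply/negP => /min_k; rewrite ltnn.
Qed.

Lemma expn2_nb_scales n : (0 < n)%N -> (2 ^ nb_scales n <= 4 * n)%N.
Proof.
rewrite /nb_scales leq_eqVlt => /predU1P[<-|n1]; first by rewrite up_log1.
have := up_log_gtn (isT : (1 < 2)%N) n1; have : (0 < up_log 2 n)%N by rewrite up_log_gt0.
by case: (up_log 2 n) => // k _; rewrite !expnS /=; lia.
Qed.

Definition scale_param (cst N inv : nat) : nat := (nb_scales N + inv + cst)%N.

(** The exponent 32 is 12, for at most [x * x ^ 11] trials, plus 20, for the product [K * A * F] of
    the loops in a trial. *)
Definition time_bound (cst N inv : nat) : nat :=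
  (400 * sqrt_above N * scale_param cst N inv ^ 32)%N.

Section Tester.
Variables (R : realType) (N : nat) (G : sgraph N) (g : incidence_lists N).
Variables (cst : nat) (eps : R).
Hypotheses (c64 : (64 <= cst)%N) (params : valid_params (N, eps)).
Let inv := inv_param eps.
Let x := scale_param cst N inv.
Let sq := sqrt_above N.
Let d := (12 * cst.+2 + 4)%N.
Let W := word_modulus d N eps.

Lemma N_gt0 : (0 < N)%N. Proof. by case: params. Qed.

Lemma eps_gt0 : 0 < eps. Proof. by case: params => _ /andP[]. Qed.

Lemma invE : inv%:R = (Num.ceil eps^-1)%:~R :> R.
Proof.
rewrite /inv /inv_param natr_absz ger0_norm // ceil_ge0.
by apply: lt_le_trans (ltrN10 R) _; rewrite invr_ge0 ltW // eps_gt0.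
Qed.

Lemma inv_ge : eps^-1 <= inv%:R.
Proof. by rewrite invE; exact: ceil_ge. Qed.

Lemma inv_lt : inv%:R < eps^-1 + 1.
Proof. by rewrite invE -ltrBlDr -[X in _ - X]/(1%:~R) -intrB ceilB1_lt. Qed.

Lemma inv_gt0 : (0 < inv)%N.
Proof. by rewrite -(ltr_nat R); apply: lt_le_trans inv_ge; rewrite invr_gt0 eps_gt0. Qed.

Lemma x_ge64 : (64 <= x)%N.
Proof. by rewrite /x /scale_param; lia. Qed.

Lemma time_le : (tester_time sq (nb_scales N) (x ^ 4) (sq * x ^ 6) (sq * x ^ 9) (x ^ 11) (x ^ 7) (x ^ 5)
  < time_bound cst N inv)%N.
Proof.
have x0 : (0 < x)%N by have := x_ge64; lia.
have lx : (nb_scales N <= x)%N by rewrite /x /scale_param; lia.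
have sq0 : (0 < sq)%N by have [/andP[]] := sqrt_above_sq N.
have le_exp a b : (a <= b)%N -> (x ^ a <= x ^ b)%N by move=> ab; rewrite leq_pexp2l.
have try_le : (try_time (x ^ 7) (x ^ 5) <= 162 * x ^ 7)%N.
  rewrite /try_time; have := le_exp 5 7 isT; have := le_exp 0 7 isT; lia.
have walks_le : (walks_time (x ^ 4) (x ^ 7) (x ^ 5) (sq * x ^ 9) <= 183 * (sq * x ^ 20))%N.
  have A_le : (x ^ 4 * (try_time (x ^ 7) (x ^ 5) + 3) + 15 <= 180 * x ^ 11)%N.
    apply: (@leq_trans (x ^ 4 * (165 * x ^ 7) + 15 * x ^ 11)%N).
      rewrite leq_add ?leq_mul //; last by rewrite -[leqLHS]muln1 leq_mul2l /= expn_gt0 x0.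
      by have := le_exp 0 7 isT; lia.
    by rewrite mulnCA -expnD; lia.
  have : (1 <= sq * x ^ 20)%N by rewrite muln_gt0 sq0 expn_gt0 x0.
  rewrite /walks_time; have := leq_mul (leqnn (sq * x ^ 9)) A_le.
  rewrite -[X in (_ <= X)%N -> _]mulnA [X in (_ <= _ * X)%N -> _]mulnCA -expnD; lia.
have sx n : (sq <= sq * x ^ n)%N by rewrite leq_pmulr // expn_gt0 x0.
have sle a b : (a <= b)%N -> (sq * x ^ a <= sq * x ^ b)%N by move=> ab; rewrite leq_mul2l le_exp ?orbT.
have trial_le : (trial_time (x ^ 4) (x ^ 7) (x ^ 5) (sq * x ^ 9) (sq * x ^ 6) + 3 <= 243 * (sq * x ^ 20))%N.
  rewrite /trial_time; have := sle 6 20 isT; have := sx 20; move: walks_le; clear -sq0; lia.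
have T_le : (x ^ 11 * (trial_time (x ^ 4) (x ^ 7) (x ^ 5) (sq * x ^ 9) (sq * x ^ 6) + 3) + 12
    <= 255 * (sq * x ^ 31))%N.
  have -> : (255 * (sq * x ^ 31) = x ^ 11 * (243 * (sq * x ^ 20)) + 12 * (sq * x ^ 31))%N.
    by rewrite (_ : 31 = 11 + 20)%N // expnD; move: (x ^ 11)%N (x ^ 20)%N => a b; clear; lia.
  rewrite leq_add ?leq_mul //; have := sx 31; clear -sq0; lia.
have scales_le : (scales_time (nb_scales N) (x ^ 4) (sq * x ^ 6) (sq * x ^ 9) (x ^ 11) (x ^ 7) (x ^ 5)
    <= 258 * (sq * x ^ 32))%N.
  apply: (@leq_trans (x * (255 * (sq * x ^ 31)) + 3 * (sq * x ^ 32))%N).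
    rewrite /scales_time /Tt leq_add ?leq_mul //; have := sx 32; clear -sq0; lia.
  by rewrite [(x ^ 32)%N]expnS; move: (x ^ 31)%N; clear => a; lia.
have x_le : (x <= sq * x ^ 32)%N.
  by apply: leq_trans (leq_pmull _ sq0); rewrite -{1}[x]expn1 le_exp.
have x64 := x_ge64.
rewrite /time_bound -/x -/sq /tester_time -mulnA.
by move: scales_le (sx 32) x_le lx x64; clear -sq0; move: (sq * x ^ 32)%N => y; lia.
Qed.

(** With [n = N + inv + 1], the number [x] is at most [n ^ cst.+2]. The largest demand is the memory
    for all trials, about [x ^ 12 * N.+1]; the remaining factor [n ^ 3] of the modulus absorbs the
    constants. *)
Lemma W_bounds : [/\ (N.+1 * N.+1 < W)%N, (x < W)%N, (sq * x ^ 9 < W)%N, (x ^ 11 < W)%N &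
  ((2 ^ nb_scales N < W)%N /\ (x ^ 7 + nb_scales N * x ^ 11 * N.+1 + N.+1 + N.+1 < W)%N)].
Proof.
have N0 := N_gt0; have i0 := inv_gt0.
rewrite /W /word_modulus -/inv; set n := (N + inv).+1.
have n3 : (3 <= n)%N by rewrite /n; lia.
have n0 : (0 < n)%N by lia.
have le_exp a b : (a <= b)%N -> (n ^ a <= n ^ b)%N by move=> ab; rewrite leq_pexp2l.
have Nn : (N.+1 <= n)%N by rewrite /n; lia.
have sn : (sq <= n)%N by have [/andP[_ h] _] := sqrt_above_sq N; exact: leq_trans h Nn.
have cn : (cst <= n ^ cst)%N by apply: ltnW; apply: ltn_expl; lia.
have lgn : (nb_scales N <= n)%N.
  rewrite /nb_scales; apply: leq_trans Nn; rewrite ltnS up_log_min // ltnW // ltn_expl //.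
have xn : (x <= n ^ cst.+2)%N.
  apply: (@leq_trans (3 * n ^ cst.+1)%N); last by rewrite [(n ^ cst.+2)%N]expnS leq_mul.
  have := le_exp 1%N cst.+1 isT; have := le_exp cst cst.+1 (leqnSn _); rewrite expn1.
  by rewrite /x /scale_param; move: lgn cn; rewrite /n; clear -N0; lia.
have xk k : (x ^ k <= n ^ (k * cst.+2))%N.
  by rewrite mulnC expnM; case: k => // k; rewrite leq_exp2r.
have lt_W y : (y <= 4 * n ^ (12 * cst.+2 + 1))%N -> (y < n ^ d)%N.
  move=> yn; apply: (leq_ltn_trans yn); rewrite /d (_ : 12 * cst.+2 + 4 = 3 + (12 * cst.+2 + 1))%N; last by lia.
  rewrite (expnD n 3) ltn_pmul2r ?expn_gt0 ?n0 //; apply: leq_trans (_ : 3 ^ 3 <= _)%N => //.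
  by rewrite leq_exp2r.
have le_top a y : (a <= 12 * cst.+2 + 1)%N -> (y <= n ^ a)%N -> (y <= n ^ (12 * cst.+2 + 1))%N.
  by move=> ad yn; apply: leq_trans yn (le_exp _ _ ad).
have le4 y : (y <= n ^ (12 * cst.+2 + 1))%N -> (y <= 4 * n ^ (12 * cst.+2 + 1))%N.
  by move=> h; apply: leq_trans h _; rewrite leq_pmull.
have N1 : (N.+1 <= n ^ (12 * cst.+2 + 1))%N by apply: (le_top 1%N); lia.
split.
- apply/lt_W/le4/(le_top 2); first by lia.
  by rewrite -mulnn leq_mul.
- apply/lt_W/le4/(le_top cst.+2) => //; lia.
- apply/lt_W/le4/(le_top (1 + 9 * cst.+2)%N); first by lia.
  by rewrite expnD expn1 leq_mul.
- apply/lt_W/le4/(le_top (11 * cst.+2)%N) => //; lia.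
split.
  apply: lt_W; apply: leq_trans (expn2_nb_scales _ N0) _; rewrite leq_mul2l /=; lia.
apply: lt_W; rewrite (_ : 4 * _ = n ^ (12 * cst.+2 + 1) + n ^ (12 * cst.+2 + 1) +
  n ^ (12 * cst.+2 + 1) + n ^ (12 * cst.+2 + 1))%N; last by lia.
do 3![apply: leq_add => //].
  apply: (le_top (7 * cst.+2)%N) => //; lia.
rewrite (expnD n _ 1) expn1 leq_mul //; apply: leq_trans _ (xk 12%N).
by rewrite (expnS x 11) leq_mul // /x /scale_param -addnA leq_addr.
Qed.

Lemma tester_judge (nb : 'I_N -> seq 'I_N) :
  (forall v, uniq (nb v)) -> (forall v u, (u \in nb v) = G v u) ->
  (forall v (i : 'I_N.-1), g v i = nth 0%N [seq name u | u <- nb v] i :> nat) ->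
  judge R W (graph_oracle g G) (cycle_output N G (2 * (x ^ 4).+2)) (time_bound cst N inv)
    (initial (tester cst) N eps)
    (scales_miss R N G nb (x ^ 4) (x ^ 6) (sq * x ^ 6) (sq * x ^ 9) (x ^ 11) (nb_scales N) 1).
Proof.
move=> nb_uniq nb_mem nb_g; have [NW xW KW TW [lgW baseW]] := W_bounds.
have x64 := x_ge64.
have CW : (cst < W)%N by apply: leq_ltn_trans xW; rewrite /x /scale_param; lia.
have iW : (inv < W)%N by apply: leq_ltn_trans xW; rewrite /x /scale_param; lia.
have AE : (x ^ 4 = x * x * x * x)%N by rewrite !expnSr expn0 mul1n.
have BE : (x ^ 6 = x ^ 4 * x * x)%N by rewrite -!expnSr.
have KE : (sq * x ^ 9 = sq * x ^ 6 * x * x * x)%N by rewrite -!mulnA; congr (_ * _)%N; rewrite !mulnA -!expnSr.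
have TE : (x ^ 11 = x ^ 6 * x ^ 4 * x)%N by rewrite -expnD -expnSr.
have FE : (x ^ 7 = x ^ 6 * x)%N by rewrite -expnSr.
have CE : (x ^ 5 = x ^ 4 * x)%N by rewrite -expnSr.
have x4 : (4 <= x)%N by apply: leq_trans x64.
have tr := tester_triple R N G W inv cst g nb (@adj_sym _ G) (@adj_irr _ G) nb_uniq nb_mem nb_g
  N_gt0 sq _ x _ _ _ _ _ _ _ erefl erefl erefl AE BE erefl KE TE FE CE NW x4 CW iW KW TW lgW baseW.
apply: (judge_time _ _ _ _ (1 + tester_time sq (nb_scales N) (x ^ 4) (sq * x ^ 6) (sq * x ^ 9)
  (x ^ 11) (x ^ 7) (x ^ 5))); first exact: time_le.
apply: tr => // s' y ->; exact: judge_det.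
Qed.

Lemma scale_dense : N%:R <= cst%:R * #|edges G|%:R :> R -> (N <= nb_arcs N G * x)%N.
Proof.
move=> dense; rewrite -(ler_nat R); apply: le_trans dense _.
rewrite -natrM ler_nat mulnC leq_mul ?edges_le_arcs //.
by rewrite /x /scale_param leq_addl.
Qed.

Lemma scale_cyclic : eps_far eps G -> (nb_arcs N G <= marked_arcs N G (x ^ 6) * x)%N.
Proof.
move=> far; have := far_marked N G (x ^ 6) (@adj_sym _ G) R eps far.
set D := marked_arcs _ _ _ => hD.
apply: leq_trans (nb_arcs_le N G (@adj_irr _ G)) _; rewrite -(ler_nat R) !natrM.
have e0 := eps_gt0; have xe : 1 <= eps * x%:R.
  rewrite -ler_pdivrMl // mulr1; apply: le_trans inv_ge _; rewrite ler_nat /x /scale_param; lia.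
have x0 : 0 < (x%:R : R) by rewrite ltr0n; have := x_ge64; lia.
apply: (@le_trans _ _ (2 * eps * #|edges G|%:R * x%:R)); last by rewrite ler_pM2r // ltW.
have E0 : 0 <= (#|edges G|%:R : R) by [].
have := ler_wpM2r (mulr_ge0 (ler0n R 2) E0) xe; lra.
Qed.

Lemma miss_third (nb : 'I_N -> seq 'I_N) :
  (forall v, uniq (nb v)) -> (forall v u, (u \in nb v) = G v u) ->
  N%:R <= cst%:R * #|edges G|%:R :> R -> eps_far eps G ->
  scales_miss R N G nb (x ^ 4) (x ^ 6) (sq * x ^ 6) (sq * x ^ 9) (x ^ 11) (nb_scales N) 1 <= 3^-1.
Proof.
move=> nb_uniq nb_mem dense far.
have [/andP[sq0 sN] sqN] := sqrt_above_sq N.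
apply: scales_miss_third => //.
- exact: adj_sym.
- exact: x_ge64.
- exact: N_gt0.
- exact: sqrt_aboveP.
- move: sq0 sqN; rewrite -/sq; case: (sq) => // k _ /= kN; nia.
- apply: leq_trans (up_logP N (isT : (1 < 2)%N)) _; rewrite leq_exp2l // /x /scale_param /nb_scales; lia.
- exact: scale_dense.
- exact: scale_cyclic.
Qed.

Lemma scale_ln : (nb_scales N)%:R * ln 2 <= 2 * ln 2 + ln N%:R :> R.
Proof.
have N0 := N_gt0; have h := expn2_nb_scales _ N0.
have N0' : 0 < (N%:R : R) by rewrite ltr0n.
have : ln ((2 ^ nb_scales N)%:R : R) <= ln ((4 * N)%:R).
  by rewrite ler_ln ?posrE ?ltr0n ?muln_gt0 ?expn_gt0 // ler_nat.
rewrite natrX lnXn // natrM lnM ?posrE // (_ : 4 = 2 ^+ 2); last by rewrite -natrX.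
by rewrite lnXn // !mulr_natl.
Qed.

(** From [ln 2 <= ln N], the single variable [eps^-1 * ln N] dominates both [inv] and the number of
    scales, up to constants; at [N = 1] it would vanish. *)
Lemma length_le : (2 <= N)%N ->
  (2 * (x ^ 4).+2)%:R <= (6 *: ((2 / ln 2) *: 'X + (3 + cst%:R)%:P) ^+ 4).[eps^-1 * ln N%:R].
Proof.
move=> N2; set z := eps^-1 * ln _; rewrite hornerZ horner_exp hornerD hornerZ hornerX hornerC.
have l0 : 0 < ln (2 : R) by rewrite ln_gt0 // ltr1n.
have lN : ln 2 <= ln (N%:R : R) by rewrite ler_ln ?posrE ?ltr0n ?ler_nat //; lia.
have e0 := eps_gt0; have e1 : 1 <= eps^-1 by rewrite invf_ge1 //; case: params => _ /andP[].
have iz : inv%:R * ln 2 <= z + ln 2.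
  apply: (@le_trans _ _ ((eps^-1 + 1) * ln 2)); first by rewrite ler_pM2r // ltW // inv_lt.
  by rewrite mulrDl mul1r lerD2r ler_wpM2l //; lra.
have lz : (nb_scales N)%:R * ln 2 <= 2 * ln 2 + z.
  apply: le_trans scale_ln _; rewrite lerD2l -[leLHS]mul1r ler_wpM2r //; lra.
have xz : x%:R <= 2 / ln 2 * z + (3 + cst%:R).
  rewrite -(ler_pM2r l0) mulrDl mulrAC divfK ?gt_eqF // /x /scale_param !natrD -/inv; lra.
have x1 : 1 <= (x%:R : R) by rewrite ler1n; have := x_ge64; lia.
apply: (@le_trans _ _ (6 * x%:R ^+ 4)).
  rewrite natrM -[(x ^ 4).+2]addn2 natrD (natrX R x 4).
  have : 1 <= (x%:R : R) ^+ 4 by rewrite exprn_ege1.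
  lra.
by rewrite ler_pM2l // lerXn2r // nnegrE; lra.
Qed.

Lemma time_bound_le (f := (('X + 1) ^+ 32).[eps^-1] * Num.sqrt (N%:R : R)) :
  (time_bound cst N inv)%:R <=
    800 * (cst.+2%:R * (4 / ln 2)) ^+ 32 * (f * ln (2 + f) ^+ 32).
Proof.
have l0 : 0 < ln (2 : R) by rewrite ln_gt0 // ltr1n.
have e0 := eps_gt0; have N0 := N_gt0; have ie0 : 0 < eps^-1 by rewrite invr_gt0.
have fE : f = (eps^-1 + 1) ^+ 32 * Num.sqrt (N%:R : R) by rewrite /f !hornerE.
have r1 : 1 <= Num.sqrt (N%:R : R) by rewrite -[X in X <= _]sqrtr1 ler_wsqrtr // ler1n.
have rN : Num.sqrt (N%:R : R) ^+ 2 = N%:R by rewrite sqr_sqrtr.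
have sr : sq%:R <= 2 * Num.sqrt (N%:R : R).
  have [/andP[sq0 _] sN] := sqrt_above_sq N; rewrite -/sq in sq0 sN.
  have : (sq.-1%:R : R) <= Num.sqrt N%:R.
    by rewrite -(ler_pXn2r (isT : (0 < 2)%N)) ?nnegrE ?sqrtr_ge0 // sqr_sqrtr // -natrX ler_nat -mulnn.
  rewrite -{2}(prednK sq0) -natr1; lra.
have fr : Num.sqrt (N%:R : R) <= f.
  by rewrite fE ler_peMl ?sqrtr_ge0 // exprn_ege1 //; lra.
have L2 : ln 2 <= ln (2 + f) by rewrite ler_ln ?posrE; lra.
have LN : ln N%:R <= 2 * ln (2 + f).
  rewrite -rN lnXn; last by lra.
  by rewrite mulr_natl ler_pMn2r // ler_ln ?posrE; lra.
have lL : (nb_scales N)%:R <= 4 / ln 2 * ln (2 + f).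
  rewrite -(ler_pM2r l0) mulrAC divfK ?gt_eqF //; have := scale_ln; lra.
(* Bounding the sum [x] by a product separates the power of [1 / eps], which is part of [f], from
   the logarithm, which is charged to [ln (2 + f)]. *)
have xle : (x <= cst.+2 * nb_scales N * inv)%N.
  have i0 := inv_gt0; rewrite /x /scale_param /nb_scales -/inv in i0 *; nia.
have x_le : x%:R <= cst.+2%:R * (4 / ln 2) * ln (2 + f) * (eps^-1 + 1).
  apply: (@le_trans _ _ (cst.+2%:R * (nb_scales N)%:R * inv%:R)); first by rewrite -!natrM ler_nat.
  rewrite -[X in _ <= X * _]mulrA; apply: ler_pM; rewrite ?mulr_ge0 //; first by rewrite ler_wpM2l.
  exact/ltW/inv_lt.
rewrite /time_bound -/inv -/x -/sq 2!natrM natrX.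
have -> : 800 * (cst.+2%:R * (4 / ln 2)) ^+ 32 * (f * ln (2 + f) ^+ 32) =
  400 * (2 * Num.sqrt N%:R) * (cst.+2%:R * (4 / ln 2) * ln (2 + f) * (eps^-1 + 1)) ^+ 32.
  move: (ln (2 + f)) (cst.+2%:R * _) => L a; rewrite fE; move: (eps^-1 + 1) (Num.sqrt _) => b r; rewrite !exprMn; ring.
apply: ler_pM; [by rewrite mulr_ge0 | by rewrite exprn_ge0 | by rewrite ler_pM2l | ].
by rewrite lerXn2r // nnegrE // (le_trans _ x_le).
Qed.

End Tester.

Theorem theorem8p1 (R : realType) (c : R) (hc : 0 < c) :
  exists (P : cmd) (d : nat) (T : nat * R -> nat) (p q : {poly R}),
    soft_O (@valid_params R) (fun x => (T x)%:R)
      (fun x => p.[x.2^-1] * Num.sqrt x.1%:R) /\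
    forall (N : nat) (eps : R) (G : sgraph N) (g : incidence_lists N),
      valid_params (N, eps) ->
      c * N%:R <= #|edges G|%:R ->
      represents g G ->
      let W := word_modulus d N eps in
      let O := graph_oracle g G in
      let start := initial P N eps in
      let t := T (N, eps) in
      [/\ always W O (fun f => halted f) t start,
          cycle_free G -> prob R W O accepted t start = 1,
          eps_far eps G -> prob R W O accepted t start <= 3%:R^-1
        & always W O (fun f => forall o : seq nat, f = Halt false o ->
            names_short_cycle G (q.[eps^-1 * ln N%:R]) o) t start].
Proof.
(* One constant encodes the density [c] and supplies the numerical slack [64 <= x]. *)
pose cst := (`|Num.ceil c^-1| + 64)%N; have c64 : (64 <= cst)%N by rewrite leq_addl.
exists (tester cst), (12 * cst.+2 + 4)%N, (fun i => time_bound cst i.1 (inv_param i.2)).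
exists (('X + 1) ^+ 32), (6 *: ((2 / ln 2) *: 'X + (3 + cst%:R)%:P) ^+ 4); split.
  exists (800 * (cst.+2%:R * (4 / ln 2)) ^+ 32), 32 => -[N eps] params; exact: time_bound_le.
move=> N eps G g params hE gG /=.
have [nb nbP] := choice gG.
have nb_uniq v : uniq (nb v) by case: (nbP v).
have nb_mem v u : (u \in nb v) = G v u by case: (nbP v).
have nb_g v (i : 'I_N.-1) : g v i = nth 0%N [seq name u | u <- nb v] i :> nat by case: (nbP v).
have [safe_t pr] := tester_judge R N G g cst eps c64 params nb nb_uniq nb_mem nb_g.
set W := word_modulus _ _ _ in safe_t pr *; set O := graph_oracle _ _ in safe_t pr *.
have cE : N%:R <= cst%:R * #|edges G|%:R :> R.
  have ic : c^-1 <= cst%:R.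
    rewrite natrD natr_absz ler_wpDr //; apply: le_trans (ceil_ge _) _.
    by rewrite ler_int ler_norm.
  have E0 : 0 <= (#|edges G|%:R : R) by [].
  by apply: le_trans (ler_wpM2r E0 ic); rewrite mulrC ler_pdivlMr // mulrC.
(* A single vertex has no edge, against the density. *)
have N2 : (2 <= N)%N.
  rewrite ltnNge; apply/negP => N1; have N0 := N_gt0 R N eps params.
  suff E0 : edges G = set0 by move: cE; rewrite E0 cards0 mulr0 lern0; lia.
  apply/eqP; rewrite -subset0; apply/subsetP => F /imsetP[[u w]]; rewrite inE /=.
  by rewrite (_ : w = u) ?adj_irr //; apply: ord_inj; have := ltn_ord u; have := ltn_ord w; move: N1; clear; lia.
split.
- by apply: always_imp safe_t => f [].
(* A rejection would come with a simple cycle of [G]. *)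
- move=> cf; apply: prob_always; apply: always_imp safe_t => -[k s|[] o] [] // _ rej.
  by have [s [_ cs _]] := rej o erefl; have := cf s; rewrite cs.
- move=> far; apply: le_trans (prob_le _ _ _ accepted (fun f => ~~ rejected f) _ _ _) _.
    by case=> // -[].
  apply: le_trans pr _; exact: miss_third.
- apply: always_imp safe_t => f [_ rej] o fo; have [s [oE cs sl]] := rej o fo; exists s; split=> //.
  by apply: le_trans (length_le R N cst eps c64 params N2); rewrite ler_nat.
Qed.
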